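(* Let $s\in\mathbb{Z}$, $s\in(0,d)$. Suppose that $T$ is an $s$-dimensional CZO in $\mathbb{R}^d$, and that the only $s$-AD regular reflectionless measures associated to $T$ are of the form $c\,\mathcal{H}^s|L$ for a constant $c>0$ and an $s$-plane $L$ (here $\mathcal{H}^s|L$ is the restriction to $L$ of the $s$-dimensional Hausdorff measure). If $\mu$ is an $s$-AD regular measure for which $T$ is bounded in $L^2(\mu)$, then for every $\delta>0$ the family of dyadic $\delta$-non LCV cubes is a Carleson family; that is, for each $\delta>0$ there exists $C_\delta>0$ such that for every $P\in\mathcal{D}$, $$\sum_{\substack{Q\in\mathcal{D}:\,Q\subset P,\\ Q\text{ is }\delta\text{-non LCV for }\mu}}\ell(Q)^s\le C_\delta\,\ell(P)^s.$$
   Context: A measure means a non-negative locally finite Borel measure on $\mathbb{R}^d$; $\operatorname{supp}(\mu)$ is its closed support. $\mathcal{D}$ is a lattice of open dyadic cubes in $\mathbb{R}^d$; $\ell(Q)$ is the sidelength of a cube $Q$, and $3Q$ is the concentric cube of sidelength $3\ell(Q)$. CZOs. An $s$-dimensional CZO $T$ is given by a kernel $K:\mathbb{R}^d\setminus\{0\}\to\mathbb{C}^{d'}$ with: (i) $|K(x)|\le|x|^{-s}$; (ii) $K(-x)=-K(x)$; (iii) for some $\alpha\in(0,1]$ the function $x\mapsto|x|^{s+\alpha}K(x)$ is Hölder continuous of order $\alpha$; (iv) $K(\lambda x)=\lambda^{-s}K(x)$ for $\lambda>0$. AD regularity. For $\Lambda>0$, $\mu$ is $\Lambda$-nice if $\mu(B(x,r))\le\Lambda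 r^s$ for every ball $B(x,r)$; it is $\Lambda$-AD regular if it is nonzero, $\Lambda$-nice, and $\mu(B(x,r))\ge\frac1\Lambda r^s$ for every $x\in\operatorname{supp}(\mu)$, $r>0$. It is ($s$-)AD regular if it is $\Lambda$-AD regular for some $\Lambda>0$. Boundedness. For $\delta>0$, let $K_\delta(x)=K(x)\bigl(\frac{|x|}{\max(|x|,\delta)}\bigr)^{s+\alpha}$, $K_\delta(0)=0$, and $T_{\mu,\delta}(f)(x)=\int K_\delta(x-y)f(y)\,d\mu(y)$. $T$ is bounded in $L^2(\mu)$ if $\sup_{\delta>0}\|T_{\mu,\delta}\|_{L^2(\mu)\to L^2(\mu)}<\infty$. Reflectionless measures. $\operatorname{Lip}_0(\mathbb{R}^d)$ is the set of compactly supported scalar Lipschitz functions. A measure $\mu$ is diffuse if it has no atoms and $(x,y)\mapsto|x-y|^{-(s-1)}$ lies in $L^1_{\rm loc}(\mu\times\mu)$; it has restricted growth at infinity if $\int_{|x|\ge1}|x|^{-s-\alpha}d\mu(x)<\infty$. For $\mu$ diffuse and $f,\varphi\in\operatorname{Lip}_0(\mathbb{R}^d)$ put $\langle T(f\mu),\varphi\rangle_\mu=\iint K(x-y)\,\tfrac12[f(y)\varphi(x)-\varphi(y)f(x)]\,d\mu(x)d\mu(y)$. If also $\mu$ has restricted growth at infinity and $f\in\operatorname{Lip}_0(\mathbb{R}^d)$ has $\int f\,d\mu=0$, put $\langle T(f\mu),1\rangle_\mu=\langle T(f\mu),\psi\rangle_\mu+\int T(f\mu)(x)[1-\psi(x)]\,d\mu(x)$,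 where $\psi\in\operatorname{Lip}_0(\mathbb{R}^d)$ equals $1$ on a neighbourhood of $\operatorname{supp} f$ and $T(f\mu)(x)=\int K(x-y)f(y)\,d\mu(y)$ (independent of $\psi$). A diffuse measure with restricted growth at infinity is reflectionless for $T$ if $\langle T(f\mu),1\rangle_\mu=0$ for every $f\in\operatorname{Lip}_0(\mathbb{R}^d)$ with $\int f\,d\mu=0$. LCV. For an AD-regular $\mu$ and $\delta>0$, a cube $Q\in\mathcal{D}$ is $\delta$-non LCV if there exist $x,y\in\overline{3Q}\cap\operatorname{supp}(\mu)$ with $B(\frac{x+y}{2},\delta\ell(Q))\cap\operatorname{supp}(\mu)=\varnothing$. *)

(* Defs.v *)
From HB Require Import structures.
From mathcomp Require Import all_boot all_order all_algebra.
From mathcomp Require Import all_classical all_reals all_analysis.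
From mathcomp Require Import complex.

Set Implicit Arguments.
Unset Strict Implicit.
Unset Printing Implicit Defensive.

Import Order.TTheory GRing.Theory Num.Theory.
Import numFieldNormedType.Exports.
Import Normc.

Local Open Scope classical_set_scope.
Local Open Scope ring_scope.
Local Open Scope complex_scope.

Section euclidean.
Variables (R : realType) (d : nat).
Local Notation E := 'rV[R]_d.

(* The library norm on 'rV[R]_d is the sup norm, with the same open sets as the
   Euclidean norm; all metric notions below use the Euclidean norm. *)
Definition enorm (x : E) : R := Num.sqrt (\sum_i x ord0 i ^+ 2).

Definition eball (x : E) (r : R) : set E := [set y | enorm (y - x) < r].

Definition cnorm (n : nat) (v : 'rV[R[i]]_n) : R :=
  Num.sqrt (\sum_i normc (v ord0 i) ^+ 2).

Definition borelE := g_sigma_algebraType (@open E).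

Definition locally_finite (mu : set borelE -> \bar R) :=
  forall x : E, exists2 U : set E, nbhs x U & (mu U < +oo)%E.

Definition msupp (mu : set borelE -> \bar R) : set E :=
  [set x | forall U : set E, open U -> U x -> (0 < mu U)%E].

Definition fsupp (f : E -> R[i]) : set E := closure [set x | f x != 0].

Definition Lip0 (f : E -> R[i]) :=
  compact (fsupp f) /\
  exists C : R, forall x y, normc (f x - f y) <= C * enorm (x - y).

(* The value 0 is added to the set of distances so that the empty set has
   diameter 0. *)
Definition ediam (A : set E) : \bar R :=
  ereal_sup (0%E |` [set (enorm (z.1 - z.2))%:E | z in A `*` A]).

Definition hausdorff_content (s : nat) (delta : R) (A : set E) : \bar R :=
  ereal_inf [set (\sum_(0 <= k <oo) (ediam (F k) ^+ s))%E | F in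
    [set F : nat -> set E | A `<=` \bigcup_k F k /\
                            forall k, (ediam (F k) <= delta%:E)%E]].

(* s-dimensional Hausdorff (outer) measure for s > 0, without normalizing
   constant (immaterial below, where it is multiplied by an arbitrary c > 0). *)
Definition hausdorff (s : nat) (A : set E) : \bar R :=
  ereal_sup [set hausdorff_content s delta A | delta in [set delta | 0 < delta]].

Definition is_plane (s : nat) (L : set E) :=
  exists (p : E) (W : {vspace E}),
    \dim W = s /\ L = [set x | x - p \in W].

(* A cube is encoded by its lower corner and its sidelength. *)
Definition cube := (E * R)%type.

Definition side (Q : cube) : R := Q.2.

Definition cube_set (Q : cube) : set E :=
  [set x | forall i, Q.1 ord0 i < x ord0 i < Q.1 ord0 i + Q.2].

Definition triple (Q : cube) : cube := (Q.1 - const_mx Q.2, 3 * Q.2).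

(* At every scale 2^k, k in Z, the cubes of sidelength 2^k form the grid with
   origin o k; the condition on o says that the grid at scale 2^(k+1) is a
   coarsening of the one at scale 2^k.  The choice o = 0 gives the standard
   dyadic cubes. *)
Definition dyadic_lattice (D : set cube) :=
  exists o : int -> E,
    (forall k : int, exists m : 'rV[int]_d,
        o (k + 1) = o k + (2 : R) ^ k *: map_mx intr m) /\
    D = [set Q | exists (k : int) (m : 'rV[int]_d),
           Q = (o k + (2 : R) ^ k *: map_mx intr m, (2 : R) ^ k)].

End euclidean.

Section complex_integral.
Context {disp : measure_display} {T : measurableType disp} {R : realType}.

Definition cint (mu : set T -> \bar R) (f : T -> R[i]) : R[i] :=
  fine (\int[mu]_x (complex.Re (f x))%:E)%E +i*
  fine (\int[mu]_x (complex.Im (f x))%:E)%E.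

Definition cvint (n : nat) (mu : set T -> \bar R) (F : T -> 'rV[R[i]]_n) :
    'rV[R[i]]_n :=
  \row_j cint mu (fun x => F x ord0 j).

Definition L2fun (mu : {measure set T -> \bar R}) (f : T -> R[i]) :=
  [/\ measurable_fun setT (fun x => complex.Re (f x)),
      measurable_fun setT (fun x => complex.Im (f x)) &
      (Lnorm mu 2%:E (fun x => (normc (f x))%:E) < +oo)%E].

Definition L2_opnorm (n : nat) (mu : {measure set T -> \bar R})
    (A : (T -> R[i]) -> T -> 'rV[R[i]]_n) : \bar R :=
  ereal_sup [set (Lnorm mu 2%:E (fun x => (cnorm (A f x))%:E))%E | f in
    [set f | L2fun mu f /\ (Lnorm mu 2%:E (fun x => (normc (f x))%:E) <= 1)%E]].

End complex_integral.

Section czo.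
Variables (R : realType) (d d' s : nat).
Local Notation E := 'rV[R]_d.
Local Notation B := (borelE R d).
Implicit Types (mu : {measure set B -> \bar R}) (alpha delta : R).

(* K is a total function; its value at 0 is irrelevant. *)
Definition is_CZO alpha (K : E -> 'rV[R[i]]_d') :=
  [/\ forall x, x != 0 -> cnorm (K x) <= enorm x ^- s,
      forall x, x != 0 -> K (- x) = - K x,
      0 < alpha <= 1 /\
      (exists C : R, forall x y, x != 0 -> y != 0 ->
         cnorm ((enorm x `^ (s%:R + alpha))%:C *: K x -
                (enorm y `^ (s%:R + alpha))%:C *: K y)
           <= C * enorm (x - y) `^ alpha) &
      forall (x : E) (l : R), x != 0 -> 0 < l ->
        K (l *: x) = (l ^- s)%:C *: K x].

Definition nice (Lambda : R) mu :=
  forall (x : E) (r : R), 0 < r -> (mu (eball x r) <= (Lambda * r ^+ s)%:E)%E.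

Definition AD_regular_with (Lambda : R) mu :=
  [/\ mu setT != 0%E,
      nice Lambda mu &
      forall (x : E) (r : R), msupp mu x -> 0 < r ->
        ((Lambda^-1 * r ^+ s)%:E <= mu (eball x r))%E].

Definition AD_regular mu := exists2 Lambda : R, 0 < Lambda & AD_regular_with Lambda mu.

Definition Kreg alpha (K : E -> 'rV[R[i]]_d') delta (x : E) : 'rV[R[i]]_d' :=
  if x == 0 then 0
  else ((enorm x / Num.max (enorm x) delta) `^ (s%:R + alpha))%:C *: K x.

Definition Treg alpha (K : E -> 'rV[R[i]]_d') mu delta (f : E -> R[i]) (x : E) :
    'rV[R[i]]_d' :=
  cvint mu (fun y : B => f y *: Kreg alpha K delta (x - y : E)).

Definition L2_bounded alpha (K : E -> 'rV[R[i]]_d') mu : Prop :=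
  (ereal_sup [set L2_opnorm mu (Treg alpha K mu delta : (B -> R[i]) -> B -> _)
             | delta in [set delta : R | (0 < delta)%R]] < +oo)%E.

(* For s > 1 the integrand takes the value 0 instead of +oo on the diagonal,
   which is a null set when mu has no atoms. *)
Definition diffuse mu :=
  (forall x : E, mu [set x] = 0%E) /\
  (forall A : set (E * E), compact A ->
    (\int[(mu \x mu)%E]_(z in (A : set (B * B)))
        (enorm (z.1 - z.2 : E) ^- s.-1)%:E < +oo)%E).

Definition restricted_growth alpha mu : Prop :=
  (\int[mu]_(x in [set x : B | (1 <= enorm x)%R]) (enorm x `^ (- (s%:R + alpha)))%:E
     < +oo)%E.

Definition Tpair (K : E -> 'rV[R[i]]_d') mu (f phi : E -> R[i]) : 'rV[R[i]]_d' :=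
  cvint (mu \x mu)%E (fun z : B * B =>
    (2^-1 * (f z.2 * phi z.1 - phi z.2 * f z.1)) *: K (z.1 - z.2 : E)).

Definition Tmeas (K : E -> 'rV[R[i]]_d') mu (f : E -> R[i]) (x : E) : 'rV[R[i]]_d' :=
  cvint mu (fun y : B => f y *: K (x - y : E)).

Definition Tpair_one_via (psi : E -> R[i]) (K : E -> 'rV[R[i]]_d') mu
    (f : E -> R[i]) : 'rV[R[i]]_d' :=
  Tpair K mu f psi + cvint mu (fun x : B => (1 - psi x) *: Tmeas K mu f x).

Definition cutoff_for (f psi : E -> R[i]) :=
  Lip0 psi /\
  exists U : set E, [/\ open U, fsupp f `<=` U & forall x, U x -> psi x = 1].

(* <T(f mu), 1>_mu is Tpair_one_via psi K mu f for any cutoff psi, the value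
   being independent of psi. *)
Definition reflectionless alpha (K : E -> 'rV[R[i]]_d') mu :=
  [/\ diffuse mu, restricted_growth alpha mu &
      forall f, Lip0 f -> cint mu (f : B -> R[i]) = 0 ->
        forall psi, cutoff_for f psi -> Tpair_one_via psi K mu f = 0].

Definition is_plane_measure mu :=
  exists (c : R) (L : set E), [/\ 0 < c, is_plane s L &
    forall A : set B, measurable A ->  mu A = (c%:E * hausdorff s (A `&` L))%E].

Definition non_LCV mu delta (Q : cube R d) :=
  exists x y : E,
    [/\ (closure (cube_set (triple Q)) `&` msupp mu) x,
        (closure (cube_set (triple Q)) `&` msupp mu) y &
        eball (2^-1 *: (x + y)) (delta * side Q) `&` msupp mu = set0].

Definition Carleson_family (D F : set (cube R d)) :=
  exists2 C : R, 0 < C & forall P, D P ->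
    (\esum_(Q in [set Q | [/\ D Q, cube_set Q `<=` cube_set P & F Q]])
       (side Q ^+ s)%:E <= (C * side P ^+ s)%:E)%E.

End czo.

(* Main.v *)
From HB Require Import structures.
Require Import Defs.
From mathcomp Require Import all_boot all_order all_algebra.
From mathcomp Require Import all_classical all_reals all_analysis.
From mathcomp Require Import measurable_realfun.
From mathcomp Require Import complex.
From mathcomp Require Import ring lra.

(* Suppose that at unit scale some delta-non LCV configurations made every test
   pairing of T with a mean-zero Lipschitz function arbitrarily small. A weak
   limit of the measures along an ultrafilter (it exists by Riesz
   representation) is then AD regular and reflectionless, hence a multiple of
   H^s on a plane; the two limit points are in its support but their midpoint
   is not, which is absurd. By scaling, every delta-non LCV cube Q therefore has
   a mean-zero function psi_Q, Lipschitz at scale l(Q) and supported near Q, such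
   that some component of <T_t(1_S), psi_Q> is at least c l(Q)^s whenever S
   contains a large multiple of Q and t is small. Since
     |<psi_Q, psi_Q'>| <= C l(Q')^s l(Q') / l(Q)  for l(Q') <= l(Q),
   the psi_Q are almost orthogonal in L^2(mu), so the L^2 bound of T_t(1_S), with
   S a ball comparable to P, controls the sum of l(Q)^s over Q inside P. *)

(** Three mismatches separate the hypothesis on reflectionless measures from the smallness that a
    contradiction supplies. The smallness concerns truncated kernels and indicators of large sets,
    whereas the definition uses the singular kernel and an arbitrary cutoff; both are compared with
    the pairing truncated at height [eps] against a bump of radius [N]. The error is O(eps +
    N^-alpha), uniformly over measures with growth constant [L], and for fixed [eps], [N] this
    pairing is weakly continuous. A function of mean zero for the limit need not have mean zero
    along the sequence; subtracting a multiple, tending to 0, of a bump at a support point corrects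
    this. Finally [K] is complex and vector valued, while detection needs one real number: all is
    done for its finitely many real components, and the cubes are sorted at the end by the component
    that detects them. Along an ultrafilter all bounded sequences converge at once, so no
    subsequences are extracted. The truncation height depends on the finite family of cubes
    considered; the L^2 bound does not. *)

Set Implicit Arguments.
Unset Strict Implicit.
Unset Printing Implicit Defensive.

Import Order.TTheory GRing.Theory Num.Theory.
Import numFieldNormedType.Exports.

Local Open Scope classical_set_scope.
Local Open Scope ring_scope.

(* Typeclass resolution does not find this instance through the filtered
   structure that [continuous] infers on row vectors. *)
#[local] Instance rV_nbhs_filter (R : realType) (d : nat) (x : 'rV[R]_d) :
  ProperFilter (nbhs x).
Proof. exact: (@nbhs_pfilter 'rV[R]_d x). Qed.

(** * Euclidean norm and Borel sets *)

Section euclidean_norm.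
Variables (R : realType) (d : nat).
Local Notation E := 'rV[R]_d.
Local Notation B := (borelE R d).
Implicit Types x y z : E.

Lemma enorm_ge0 x : 0 <= enorm x.
Proof. exact: sqrtr_ge0. Qed.

Lemma enorm_sqr x : enorm x ^+ 2 = \sum_i x ord0 i ^+ 2.
Proof. by rewrite sqr_sqrtr// sumr_ge0// => i _; rewrite sqr_ge0. Qed.

Lemma coord_le_enorm x i : `|x ord0 i| <= enorm x.
Proof.
rewrite -(ler_pXn2r (n := 2))// ?nnegrE ?enorm_ge0// real_normK ?num_real//.
rewrite enorm_sqr (bigD1 i)//= lerDl sumr_ge0// => j _; exact: sqr_ge0.
Qed.

Lemma enorm0 : enorm (0 : E) = 0.
Proof.
rewrite /enorm big1 ?sqrtr0// => i _.
by rewrite mxE expr0n.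
Qed.

Lemma enorm_eq0 x : enorm x = 0 -> x = 0.
Proof.
move=> x0; apply/rowP => i; rewrite mxE; apply/eqP; rewrite -normr_le0 -x0.
exact: coord_le_enorm.
Qed.

Lemma enorm_gt0 x : (0 < enorm x) = (x != 0).
Proof.
rewrite lt_neqAle enorm_ge0 andbT eq_sym; congr (~~ _).
by apply/eqP/eqP => [/enorm_eq0//|->]; rewrite enorm0.
Qed.

Lemma enormZ (a : R) x : enorm (a *: x) = `|a| * enorm x.
Proof.
rewrite /enorm (eq_bigr (fun i => a ^+ 2 * x ord0 i ^+ 2)); last first.
  by move=> i _; rewrite mxE exprMn.
by rewrite -mulr_sumr sqrtrM ?sqr_ge0// sqrtr_sqr.
Qed.

Lemma enormN x : enorm (- x) = enorm x.
Proof. by rewrite -scaleN1r enormZ normrN1 mul1r. Qed.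

Lemma enormB x y : enorm (x - y) = enorm (y - x).
Proof. by rewrite -opprB enormN. Qed.

Lemma enormD x y : enorm (x + y) <= enorm x + enorm y.
Proof.
have [->|x0] := eqVneq x 0; first by rewrite enorm0 !add0r.
have [->|y0] := eqVneq y 0; first by rewrite enorm0 !addr0.
have a0 : 0 < enorm x by rewrite enorm_gt0.
have b0 : 0 < enorm y by rewrite enorm_gt0.
rewrite -(ler_pXn2r (n := 2))// ?nnegrE ?addr_ge0 ?enorm_ge0//.
rewrite enorm_sqr sqrrD !enorm_sqr.
rewrite (eq_bigr (fun i => x ord0 i ^+ 2 + 2 * (x ord0 i * y ord0 i)
    + y ord0 i ^+ 2)); last by move=> i _; rewrite mxE sqrrD mulr_natl.
rewrite !big_split/= -mulr_sumr.
suff : \sum_i x ord0 i * y ord0 i <= enorm x * enorm y by lra.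
set a := enorm x in a0 *; set b := enorm y in b0 *.
(* Cauchy-Schwarz from the weighted inequality [x y <= (b/a) x^2 / 2 + (a/b) y^2 / 2]; these weights
   make each of the two sums equal to [a b / 2]. *)
apply: (@le_trans _ _
   (\sum_i (b / a / 2 * x ord0 i ^+ 2 + a / b / 2 * y ord0 i ^+ 2))).
  apply: ler_sum => i _; rewrite -subr_ge0.
  have -> : b / a / 2 * x ord0 i ^+ 2 + a / b / 2 * y ord0 i ^+ 2 -
     x ord0 i * y ord0 i =
     (b * x ord0 i - a * y ord0 i) ^+ 2 / (a * b * 2).
    by field; rewrite !gt_eqF.
  by rewrite divr_ge0 ?sqr_ge0// !mulr_ge0// ltW.
rewrite big_split/= -!mulr_sumr -!enorm_sqr -/a -/b le_eqVlt; apply/orP; left.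
by apply/eqP; field; rewrite !gt_eqF.
Qed.

Lemma enormDB x y z : enorm (x - z) <= enorm (x - y) + enorm (y - z).
Proof. by apply: le_trans (enormD _ _); rewrite addrA subrK. Qed.

Lemma enorm_subl x y : enorm x - enorm y <= enorm (x - y).
Proof. by rewrite lerBlDr; apply: le_trans (enormD _ _); rewrite subrK. Qed.

Lemma enorm_dist x y : `|enorm x - enorm y| <= enorm (x - y).
Proof.
by rewrite ler_norml enorm_subl andbT lerNl opprB enormB enorm_subl.
Qed.

Lemma enorm_le_coord x (b : R) : 0 <= b ->
  (forall i, `|x ord0 i| <= b) -> enorm x <= d%:R * b.
Proof.
move=> b0 xb; rewrite -(ler_pXn2r (n := 2))// ?nnegrE ?enorm_ge0 ?mulr_ge0//.
rewrite enorm_sqr; apply: (@le_trans _ _ (\sum_(i < d) b ^+ 2)).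
  by apply: ler_sum => i _; rewrite -real_normK ?num_real// lerXn2r ?nnegrE.
rewrite sumr_const card_ord exprMn -[leLHS]mulr_natl ler_wpM2r ?sqr_ge0//.
by rewrite -natrX ler_nat; case: d => // n; rewrite expnS leq_pmulr// expn_gt0.
Qed.

Lemma enorm_le_norm x : enorm x <= d%:R * `|x|.
Proof.
apply: enorm_le_coord => // i.
by rewrite [leRHS]/Num.norm/= mx_normrE; apply/bigmax_geP; right => /=; exists (ord0, i).
Qed.

Lemma norm_le_enorm x : `|x| <= enorm x.
Proof.
rewrite [leLHS]/Num.norm/= mx_normrE; apply/bigmax_leP; split; first exact: enorm_ge0.
by case=> i j _ /=; rewrite (ord1 i) coord_le_enorm.
Qed.

Lemma continuous_enorm : continuous (@enorm R d).
Proof.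
move=> x; apply/cvgrPdist_lt => e e0.
(* [d + 1] instead of [d] keeps the radius positive when [d = 0]. *)
have c0 : 0 < e / (d%:R + 1) by rewrite divr_gt0// ltr_wpDl.
apply/(@nbhs_ballP _ E); exists (e / (d%:R + 1)) => //= y; rewrite -ball_normE/= => xy.
apply: (le_lt_trans (enorm_dist _ _)); apply: (le_lt_trans (enorm_le_norm _)).
apply: (@le_lt_trans _ _ ((d%:R + 1) * `|x - y|)); first by rewrite ler_wpM2r ?lerDl.
by rewrite mulrC -ltr_pdivlMr// ltr_wpDl.
Qed.

Lemma continuous_enormB x : continuous (fun y : E => enorm (y - x)).
Proof.
move=> y; apply: (@continuous_comp _ _ _ (fun y => y - x) (@enorm R d)).
  by apply: cvgB; [exact: cvg_id|exact: cvg_cst].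
exact: continuous_enorm.
Qed.

Lemma eball_center x r : 0 < r -> eball x r x.
Proof. by move=> r0; rewrite /eball/= subrr enorm0. Qed.

Lemma open_eball x r : open (eball x r).
Proof.
rewrite (_ : eball x r = (fun y => enorm (y - x)) @^-1` [set t : R | t < r])//.
by apply: (@open_comp E R) => [y _|]; [exact: continuous_enormB|exact: open_lt].
Qed.

Lemma nbhs_eballP x (A : set E) :
  nbhs x A <-> exists2 r : R, 0 < r & eball x r `<=` A.
Proof.
split=> [/nbhs_ballP[r/= r0 rA]|[r r0 rA]].
  exists r => // y yr; apply: rA; rewrite -ball_normE/=.
  by apply: le_lt_trans yr; rewrite distrC norm_le_enorm.
apply: filterS rA _; apply: open_nbhs_nbhs; split; first exact: open_eball.
exact: eball_center.
Qed.

Lemma open_eballP (A : set E) x : open A -> A x ->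
  exists2 r : R, 0 < r & eball x r `<=` A.
Proof. by move=> oA Ax; apply/nbhs_eballP/open_nbhs_nbhs. Qed.

Lemma closed_cball x r : closed [set y : E | enorm (y - x) <= r].
Proof.
rewrite (_ : mkset _ = (fun y => enorm (y - x)) @^-1` [set t : R | t <= r])//.
by apply: (@closed_comp E R) => [y _|]; [exact: continuous_enormB|exact: closed_le].
Qed.

Lemma compact_cball x r : compact [set y : E | enorm (y - x) <= r].
Proof.
apply: bounded_closed_compact; last exact: closed_cball.
exists (r + enorm x); split; first exact: num_real.
move=> M rM y /= yr; apply: (le_trans (norm_le_enorm _)).
apply: le_trans (ltW rM); rewrite -lerBlDr.
by apply: le_trans (enorm_subl _ _) yr.
Qed.

Lemma compact_bounded (A : set E) : compact A ->
  exists2 r : R, 0 < r & A `<=` eball 0 r.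
Proof.
move=> /compact_bounded[M [_ MA]].
exists (d%:R * (`|M| + 1) + 1); first by rewrite ltr_wpDl// mulr_ge0// addr_ge0.
move=> x Ax; rewrite /eball/= subr0; apply: (le_lt_trans (enorm_le_norm _)).
rewrite (@le_lt_trans _ _ (d%:R * (`|M| + 1)))// ?ltrDl//.
rewrite ler_wpM2l//; apply: MA => //.
by rewrite (le_lt_trans (ler_norm _))// ltrDl.
Qed.

Lemma sub_eball x y (r t : R) : enorm (x - y) + r <= t -> eball x r `<=` eball y t.
Proof.
move=> rt z zr; rewrite /eball/=.
apply: lt_le_trans rt; apply: (le_lt_trans (enormDB _ x _)).
by rewrite addrC ltrD2l.
Qed.

Lemma measurable_open (U : set E) : open U -> measurable (U : set B).
Proof. by move=> oU; exact: sub_gen_smallest. Qed.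

Lemma measurable_closed (U : set E) : closed U -> measurable (U : set B).
Proof.
move=> cU; rewrite -(setCK U); apply: measurableC.
by apply: measurable_open; exact: closed_openC.
Qed.

Lemma measurable_eball x r : measurable (eball x r : set B).
Proof. by apply: measurable_open; exact: open_eball. Qed.

Lemma measurable_singleton x : measurable ([set x] : set B).
Proof.
apply: measurable_closed.
rewrite (_ : [set x] = [set y | enorm (y - x) <= 0]); first exact: closed_cball.
apply/seteqP; split=> y /=; first by move=> ->; rewrite subrr enorm0.
move=> y0; apply/eqP; rewrite -subr_eq0; apply/eqP/enorm_eq0/eqP.
by rewrite eq_le y0 enorm_ge0.
Qed.

Lemma continuous_measurable (f : E -> R) : continuous f ->
  measurable_fun setT (f : B -> R).
Proof.
move=> cf; apply: (measurability (@measurable_realfun.RGenOpens.G R)).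
  exact: measurable_realfun.RGenOpens.measurableE.
move=> _ [_ [a [b ->]] <-]; rewrite setTI; apply: measurable_open.
by apply: (@open_comp E R) => [y _|]; [exact: cf|exact: interval_open].
Qed.

End euclidean_norm.

Section borel_base.
Variables (R : realType) (d : nat).
Local Notation E := 'rV[R]_d.
Local Notation B := (borelE R d).

(** The index type is countable, so these cubes with rational centres form a countable base of the
    topology. *)
Definition rat_box (p : 'rV[rat]_d * nat) : set E :=
  [set y | forall i, `|y ord0 i - ratr (p.1 ord0 i)| < p.2.+1%:R^-1].

Lemma rat_box_nbhs (U : set E) (x : E) : open U -> U x ->
  exists2 p, rat_box p x & rat_box p `<=` U.
Proof.
move=> oU Ux.
have /(@nbhs_ballP _ E)[r/= r0 rU] : nbhs x U by exact: open_nbhs_nbhs.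
have [n nr] : exists n : nat, n.+1%:R^-1 < r / 2.
  have [n] := ltr_add_invr (divr_gt0 r0 (@ltr0n R 2)).
  by rewrite add0r => ?; exists n.
have n0 : 0 < (n.+1%:R^-1 : R) by rewrite invr_gt0.
have /choice[q hq] : forall i : 'I_d, exists q : rat,
    `|x ord0 i - ratr q| < n.+1%:R^-1.
  move=> i; have [|q] := @rat_in_itvoo R (x ord0 i - n.+1%:R^-1) (x ord0 i + n.+1%:R^-1).
    by rewrite ltrD2l (lt_trans _ n0)// oppr_lt0.
  rewrite in_itv/= => /andP[q1 q2]; exists q.
  by rewrite ltr_distlC q1 q2.
exists (\row_i q i, n); first by move=> i; rewrite mxE.
move=> y yq; apply: rU.
rewrite -ball_normE/= /Num.norm/= mx_normrE; apply/bigmax_ltP; split => //.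
case=> i j _/=; rewrite (ord1 i) !mxE.
have := yq j; rewrite mxE => yqj.
rewrite (le_lt_trans (ler_distD (ratr (q j)) _ _))//.
by rewrite [ltRHS]splitr ltrD// ?(lt_trans (hq j))// distrC (lt_trans yqj).
Qed.

Lemma rat_box_bigcup (U : set E) : open U ->
  U = \bigcup_(p in [set p | rat_box p `<=` U]) rat_box p.
Proof.
move=> oU; apply/seteqP; split=> [x Ux|x [p pU px]]; last exact: pU.
by have [p px pU] := rat_box_nbhs oU Ux; exists p.
Qed.

Lemma measurable_coord (i : 'I_d) : measurable_fun setT (fun x : B => (x : E) ord0 i).
Proof.
apply: (@continuous_measurable R d (fun x : E => x ord0 i)).
exact: coord_continuous.
Qed.

(** The Borel structure is generated by open sets, not by coordinates. An open set is a countable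
    union of boxes, and a box is a finite conjunction of conditions on coordinates. *)
Lemma measurable_to_borelE disp (T : measurableType disp) (phi : T -> E) :
  (forall i, measurable_fun setT (fun t => phi t ord0 i)) ->
  measurable_fun setT (phi : T -> B).
Proof.
move=> mphi; apply: (@measurability _ _ T B setT phi (@open E)) => //.
move=> _ [U oU <-]; rewrite setTI (rat_box_bigcup oU) preimage_bigcup.
rewrite bigcup_mkcond; apply: countable_bigcupT_measurable => // p.
case: ifPn => _; last exact: measurable0.
rewrite (_ : _ @^-1` _ = \bigcap_(i in [set: 'I_d])
   ((fun t => phi t ord0 i - ratr (p.1 ord0 i)) @^-1` (ball 0 p.2.+1%:R^-1))); last first.
  apply/seteqP; split => [t /= tp i _ /=|t /= tp i].
    by rewrite -ball_normE/= sub0r normrN; exact: tp.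
  by have := tp i I; rewrite /= -ball_normE/= sub0r normrN.
apply: fin_bigcap_measurable => // i _.
rewrite -[X in measurable X]setTI.
have mf : measurable_fun setT (fun t => phi t ord0 i - ratr (p.1 ord0 i)).
  by apply: measurable_funB => //; exact: measurable_cst.
by apply: mf => //; exact: measurable_ball.
Qed.

Lemma measurable_coordT disp (T : measurableType disp) (phi : T -> E) i :
  measurable_fun setT (phi : T -> B) -> measurable_fun setT (fun t => phi t ord0 i).
Proof. by move=> mphi; exact: (measurableT_comp (measurable_coord i) mphi). Qed.

Lemma measurable_subE disp (T : measurableType disp) (f g : T -> E) :
  measurable_fun setT (f : T -> B) -> measurable_fun setT (g : T -> B) ->
  measurable_fun setT (fun t => f t - g t : B).
Proof.
move=> mf mg; apply: measurable_to_borelE => i.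
under eq_fun do rewrite !mxE.
by apply: measurable_funB; exact: measurable_coordT.
Qed.

Lemma measurable_affine (a : R) (v : E) :
  measurable_fun setT (fun x : B => (a *: ((x : E) - v) : B)).
Proof.
apply: measurable_to_borelE => i.
under eq_fun do rewrite !mxE.
apply: measurable_funM; first exact: measurable_cst.
by apply: measurable_funB; [exact: measurable_coord|exact: measurable_cst].
Qed.

(** Each point off the support has a null open neighbourhood, which can be shrunk to a box of the
    countable base; hence countably many null boxes cover [U]. *)
Lemma null_open (mu : {measure set B -> \bar R}) (U : set E) : open U ->
  U `&` msupp mu = set0 -> mu U = 0%E.
Proof.
move=> oU Umu.
suff UN : U `<=` \bigcup_n (if unpickle n is Some p then
    if p \in [set p | mu.-negligible (rat_box p : set B)] then rat_box p
    else set0 else set0).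
  have mU : measurable (U : set B) by exact: measurable_open.
  apply/negligibleP => //; apply: (@negligibleS _ _ _ mu _ _ UN).
  apply: negligible_bigcup => n.
  case: unpickle => [p|]; last exact: negligible_set0.
  by case: ifPn => [/set_mem//|_]; exact: negligible_set0.
move=> x Ux; have : ~ msupp mu x by move=> sx; have : (U `&` msupp mu) x by []; rewrite Umu.
move=> /existsNP[V] /not_implyP[oV] /not_implyP[Vx] /negP.
rewrite -leNgt => muV.
have [p px pV] := rat_box_nbhs oV Vx.
exists (pickle p) => //=; rewrite pickleK mem_set//=.
apply: (@negligibleS _ _ _ mu _ _ pV); exists V; split => //; first exact: measurable_open.
by apply/eqP; rewrite eq_le muV/=.
Qed.

End borel_base.

Section sigma_finite_copy.
Context disp (T : measurableType disp) (R : realType).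
Variables (mu : {measure set T -> \bar R}) (sf : sigma_finite setT mu).

(** An alias of [mu] carrying the sigma-finite structure that product measures and Fubini ask
    for. *)
Definition sigma_finite_copy of sigma_finite setT mu : set T -> \bar R := mu.

HB.instance Definition _ := Measure.on (sigma_finite_copy sf).
HB.instance Definition _ :=
  @Measure_isSigmaFinite.Build _ _ _ (sigma_finite_copy sf) sf.

End sigma_finite_copy.

(** * Measures of growth [s] *)

Section nice_measures.
Variables (R : realType) (d s : nat).
Local Notation E := 'rV[R]_d.
Local Notation B := (borelE R d).

Lemma nice_eball_lty (L : R) (mu : {measure set B -> \bar R}) x r :
  nice s L mu -> (mu (eball x r) < +oo)%E.
Proof.
move=> nmu; have [r0|r0] := ltP 0 r; first exact: le_lt_trans (nmu _ _ r0) (ltry _).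
rewrite (_ : eball x r = set0) ?measure0//.
apply/seteqP; split=> // y; rewrite /eball/= => yr.
by have := lt_le_trans yr r0; rewrite ltNge enorm_ge0.
Qed.

Lemma nice_sigma_finite (L : R) (mu : {measure set B -> \bar R}) :
  nice s L mu -> sigma_finite setT mu.
Proof.
move=> nmu; exists (fun n => eball 0 n%:R).
  apply/seteqP; split => // x _.
  have [n] := archi_boundP (enorm_ge0 x).
  by exists (Num.bound (enorm x)) => //; rewrite /eball/= subr0; exact: archi_boundP (enorm_ge0 x).
by move=> n; split; [exact: measurable_eball|exact: nice_eball_lty nmu].
Qed.

Lemma nice_sigma_finite_measure (L : R) (mu : {measure set B -> \bar R}) :
  nice s L mu -> exists mu' : {sigma_finite_measure set B -> \bar R}, mu = mu'.
Proof.
move=> /nice_sigma_finite sf; exists (sigma_finite_copy sf).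
by case: mu sf => m [[]].
Qed.

Lemma nice_locally_finite (L : R) (mu : {measure set B -> \bar R}) :
  nice s L mu -> locally_finite mu.
Proof.
move=> nmu x; exists (eball x 1); last exact: nice_eball_lty nmu.
by apply/nbhs_eballP; exists 1.
Qed.

Lemma sum_geometric_le (q : R) n : 0 <= q < 1 -> \sum_(0 <= j < n) q ^+ j <= (1 - q)^-1.
Proof.
move=> /andP[q0 q1]; have p : 0 < 1 - q by rewrite subr_gt0.
rewrite -[leRHS]mul1r ler_pdivlMr// mulrC -opprB mulNr big_mkord -subrX1 opprB.
by rewrite gerBl exprn_ge0.
Qed.

(* Dyadic decomposition: [c j] bounds [F] on the [j]-th annulus, which lies in
   the ball of radius [r j]. *)
Lemma integral_shells (L : R) (mu : {measure set B -> \bar R}) (F : B -> R)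
    (x : E) (c r : nat -> R) (D q : R) :
  nice s L mu -> measurable_fun setT F -> (forall y, 0 <= F y) ->
  (forall j, 0 <= c j) -> (forall j, 0 < r j) -> 0 <= q < 1 -> 0 <= D ->
  (forall y : E, F y = 0 \/ exists2 j, F y <= c j & enorm (y - x) < r j) ->
  (forall j, c j * (L * r j ^+ s) <= D * q ^+ j) ->
  (\int[mu]_y (F y)%:E <= (D / (1 - q))%:E)%E.
Proof.
move=> nmu mF F0 c0 r0 q01 D0 hF hc.
pose g j (y : B) : \bar R := (c j * \1_(eball x (r j)) y)%:E.
have mg j : measurable_fun setT (g j).
  apply/measurable_EFinP; apply: measurable_funM; first exact: measurable_cst.
  by apply: measurable_indic; exact: measurable_eball.
have g0 j y : (0 <= g j y)%E by rewrite lee_fin mulr_ge0.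
apply: (@le_trans _ _ (\int[mu]_y (\sum_(j <oo) g j y))%E).
  apply: ge0_le_integral => //.
  - by move=> y _; rewrite lee_fin.
  - exact/measurable_EFinP.
  - by apply: ge0_emeasurable_sum => // *; exact: g0.
  move=> y _; have [->|[j Fj yj]] := hF y; first by apply: nneseries_ge0 => *; exact: g0.
  apply: le_trans (nneseries_lim_ge j.+1 _); last by move=> *; exact: g0.
  rewrite big_nat_recr//=; apply: (@le_trans _ _ (g j y)).
    by rewrite /g indicE mem_set//= mulr1 lee_fin.
  by rewrite leeDr// sume_ge0// => *; exact: g0.
rewrite (@integral_nneseries _ _ _ mu _ measurableT g mg (fun n y _ => g0 n y)).
apply: lime_le; first by apply: is_cvg_nneseries => *; apply: integral_ge0 => *; exact: g0.
apply: nearW => n; apply: (@le_trans _ _ (\sum_(0 <= j < n) (D * q ^+ j)%:E)%E).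
  apply: lee_sum => j _.
  rewrite /g; under eq_integral do rewrite EFinM.
  rewrite ge0_integralZl//; last 2 first.
  - by apply/measurable_EFinP; apply: measurable_indic; exact: measurable_eball.
  - by rewrite lee_fin.
  rewrite integral_indic ?setIT//; last exact: measurable_eball.
  apply: (@le_trans _ _ ((c j)%:E * (L * r j ^+ s)%:E)%E).
    by apply: lee_wpmul2l; [rewrite lee_fin|exact: nmu].
  by rewrite -EFinM lee_fin.
rewrite sumEFin lee_fin -mulr_sumr ler_wpM2l//.
exact: sum_geometric_le.
Qed.

End nice_measures.

(** * Kernel estimates *)

Section powers.
Variable R : realType.
Implicit Types p q a t : R.

Lemma powRN_le p q a : 0 < p -> p <= q -> 0 <= a -> q `^ (- a) <= p `^ (- a).
Proof.
move=> p0 pq a0; have q0 := lt_le_trans p0 pq.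
rewrite !powRN lef_pV2 ?posrE ?powR_gt0//.
by apply: ge0_ler_powR => //; rewrite nnegrE ltW.
Qed.

(** With [r = p / q <= 1] one has [1 - r^a <= 1 - r^m <= m (1 - r)], the last by induction on [m];
    the integer [m >= a] takes the place of the mean value theorem. *)
Lemma powRN_sub_le p q a (m : nat) : 0 < p -> p <= q -> 0 <= a -> a <= m%:R ->
  p `^ (- a) - q `^ (- a) <= p `^ (- a) * (m%:R * (q - p) / q).
Proof.
move=> p0 pq a0 am; have q0 := lt_le_trans p0 pq.
have r01 : 0 < p / q <= 1 by rewrite divr_gt0//= ler_pdivrMr// mul1r.
have /andP[r0 r1] := r01.
have -> : q `^ (- a) = p `^ (- a) * (p / q) `^ a.
  rewrite powRM ?invr_ge0 ?(ltW p0) ?(ltW q0)// mulrA !powRN mulVf ?mul1r.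
    by rewrite -(powR_inv1 (ltW q0)) -powRrM mulN1r powRN.
  by rewrite gt_eqF// powR_gt0.
rewrite -[X in X - _]mulr1 -mulrBr ler_wpM2l ?powR_ge0//.
apply: (@le_trans _ _ (1 - (p / q) ^+ m)).
  by rewrite lerD2l lerN2 -powR_mulrn ?(ltW r0)//; exact: ger_powR.
have -> : m%:R * (q - p) / q = m%:R * (1 - p / q) by field; rewrite gt_eqF.
elim: m {am} => [|m IH]; first by rewrite expr0 subrr mul0r.
rewrite exprS -natr1 mulrDl mul1r.
apply: (@le_trans _ _ (p / q * (1 - (p / q) ^+ m) + (1 - p / q))); first by lra.
rewrite lerD2r; apply: le_trans IH.
by rewrite ler_piMl// subr_ge0 exprn_ile1// ltW.
Qed.

(** The larger of [p] and [q] is kept in the denominator: in [kreg_far] it absorbs the size of the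
    numerator, in [kreg_continuous] it is bounded below by [delta]. *)
Lemma powRN_dist_le p q u a (m : nat) : 0 < u -> u <= p -> u <= q ->
  0 <= a -> a <= m%:R ->
  `|p `^ (- a) - q `^ (- a)| <= u `^ (- a) * (m%:R * `|p - q| / Num.max p q).
Proof.
move=> u0; wlog pq : p q / p <= q => [hw up uq a0 am|up uq a0 am].
  have [pq|qp] : p <= q \/ q <= p by apply/orP; exact: le_total.
    exact: hw.
  by rewrite distrC (distrC p) maxC; exact: hw.
have p0 := lt_le_trans u0 up; have q0 := lt_le_trans p0 pq.
rewrite ger0_norm ?subr_ge0 ?powRN_le//.
rewrite (max_r pq) distrC ger0_norm ?subr_ge0//.
apply: (le_trans (powRN_sub_le p0 pq a0 am)).
rewrite ler_wpM2r ?powRN_le// divr_ge0 ?(ltW q0)// mulr_ge0// subr_ge0//.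
Qed.

Lemma dyadic_scale t : 1 <= t -> exists j : nat, 2 ^+ j <= t < 2 ^+ j.+1.
Proof.
move=> t1; have ex : exists j, t < 2 ^+ j.+1.
  exists (Num.bound t); have := archi_boundP (le_trans ler01 t1).
  move=> /lt_le_trans; apply; rewrite -natrX ler_nat.
  by rewrite (leq_trans (ltnW (ltn_expl _ (isT : 1 < 2)%N)))// leq_exp2l.
exists (ex_minn ex); case: ex_minnP => j -> hj; rewrite andbT.
case: j hj => [|j] hj; first by rewrite expr0.
by rewrite leNgt; apply/negP => /hj; rewrite ltnn.
Qed.

End powers.

Section near_far.
Variables (R : realType) (d s : nat).
Local Notation E := 'rV[R]_d.
Local Notation B := (borelE R d).
Variables (L : R) (mu : {measure set B -> \bar R}).
Hypotheses (L0 : 0 <= L) (nmu : nice s L mu) (s0 : (0 < s)%N).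

(** The kernel size [|z|^-s] times the factor [|z|] gained from Lipschitz data, cut off at radius
    [e]. At [z = 0] the value is 1 if [s = 1] and 0 if [s > 1], the inverse of 0 being 0. *)
Definition near_fun (e : R) (z : E) : R :=
  if enorm z < e then enorm z ^- s.-1 else 0.

Definition far_fun (a N : R) (y : E) : R :=
  if N <= enorm y then enorm y `^ (- a) else 0.

Lemma near_fun_ge0 e z : 0 <= near_fun e z.
Proof. by rewrite /near_fun; case: ifP => // _; rewrite invr_ge0 exprn_ge0 ?enorm_ge0. Qed.

Lemma far_fun_ge0 a N y : 0 <= far_fun a N y.
Proof. by rewrite /far_fun; case: ifP => // _; exact: powR_ge0. Qed.

Lemma measurable_enorm : measurable_fun setT (fun x : B => enorm (x : E)).
Proof. exact: continuous_measurable (@continuous_enorm R d). Qed.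

Lemma measurable_near_fun e : measurable_fun setT (near_fun e : B -> R).
Proof.
rewrite (_ : near_fun e = fun z => if enorm z < e then enorm z `^ (- s.-1%:R) else 0); last first.
  by apply/funext => z; rewrite /near_fun powR_invn// enorm_ge0.
apply: measurable_fun_ifT.
- by apply: measurable_fun_ltr; [exact: measurable_enorm|exact: measurable_cst].
- by apply: (measurableT_comp (measurable_powR _)); exact: measurable_enorm.
- exact: measurable_cst.
Qed.

Lemma measurable_far_fun a N : measurable_fun setT (far_fun a N : B -> R).
Proof.
apply: measurable_fun_ifT.
- by apply: measurable_fun_ler; [exact: measurable_cst|exact: measurable_enorm].
- by apply: (measurableT_comp (measurable_powR _)); exact: measurable_enorm.
- exact: measurable_cst.
Qed.

Lemma measurable_shift (x : E) : measurable_fun setT (fun y : B => (y - x : E) : B).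
Proof. by have := @measurable_affine R d 1 x; under eq_fun do rewrite scale1r. Qed.

Lemma integral_near (x : E) e : 0 < e ->
  (\int[mu]_y (near_fun e (y - x))%:E <= (L * 4 ^+ s * e)%:E)%E.
Proof.
move=> e0.
have p2 (j : nat) : 0 < (2 ^+ j : R) by rewrite exprn_gt0.
have -> : L * 4 ^+ s * e = (L * 4 ^+ s * e / 2) / (1 - 2^-1) by field.
(* The annulus [e / 2^(j+1) < |y - x| <= e / 2^j] lies in the open ball of twice its outer radius.
   With [t = e / 2^(j+1)] it contributes [L 4^s t], and these [t] sum to [e]. *)
apply: (@integral_shells R d s L mu _ x (fun j => (e / 2 ^+ j.+1) ^- s.-1)
  (fun j => 4 * (e / 2 ^+ j.+1))) => //.
- exact: (measurableT_comp (measurable_near_fun e) (measurable_shift x)).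
- by move=> y; exact: near_fun_ge0.
- by move=> j; rewrite invr_ge0 exprn_ge0// divr_ge0// ltW.
- by move=> j; rewrite mulr_gt0// divr_gt0.
- by apply/andP; split; lra.
- by rewrite !mulr_ge0 ?exprn_ge0// ltW.
- move=> y; rewrite /near_fun; case: ifPn => [ye|]; last by left.
  right; have [y0|y0] := eqVneq (enorm (y - x)) 0.
    exists 0%N; last by rewrite y0 mulr_gt0// divr_gt0.
    rewrite y0; case: s.-1 => [|n]; first by rewrite !expr0.
    by rewrite expr0n/= invr0 invr_ge0 exprn_ge0// divr_ge0 ?ltW.
  have yp : 0 < enorm (y - x) by rewrite lt_neqAle eq_sym y0 enorm_ge0.
  have [|j /andP[j1 j2]] := @dyadic_scale R (e / enorm (y - x)).
    by rewrite ler_pdivlMr// mul1r ltW.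
  exists j.
    rewrite lef_pV2 ?posrE ?exprn_gt0 ?divr_gt0// lerXn2r ?nnegrE ?enorm_ge0//.
      by rewrite divr_ge0// ltW.
    by rewrite ler_pdivrMr// mulrC -ler_pdivrMr// ltW.
  rewrite ler_pdivlMr// in j1.
  rewrite exprS -(ltr_pM2l (p2 j)) (le_lt_trans j1)//.
  rewrite (_ : 2 ^+ j * _ = 2 * e) ?ltr_pMl ?ltr1n//.
  by field; rewrite gt_eqF.
move=> j; set t := e / 2 ^+ j.+1.
have t0 : 0 < t by rewrite divr_gt0.
have -> : (4 * t) ^+ s = 4 ^+ s * (t * t ^+ s.-1) by rewrite exprMn -exprS prednK.
have tn : t ^+ s.-1 != 0 by rewrite expf_neq0// gt_eqF.
rewrite (_ : t ^- s.-1 * _ = L * 4 ^+ s * t); last by field.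
rewrite /t exprS le_eqVlt; apply/orP; left; apply/eqP.
rewrite exprVn; field; rewrite gt_eqF//.
Qed.

Lemma integral_far alpha N : 0 < alpha -> 0 < N ->
  (\int[mu]_y (far_fun (s%:R + alpha) N y)%:E <=
     (L * 2 ^+ s / (1 - 2 `^ (- alpha)) * N `^ (- alpha))%:E)%E.
Proof.
move=> a0 N0.
have sa : 0 <= s%:R + alpha by rewrite addr_ge0// ltW.
have p2 (j : nat) : 0 < (2 ^+ j : R) by rewrite exprn_gt0.
rewrite mulrAC.
(* The growth of order [s] cancels against [|y|^-s]; what remains of the [j]-th annulus is
   [L 2^s (2^j N)^-alpha], of ratio [2^-alpha]. *)
apply: (@integral_shells R d s L mu _ 0 (fun j => (2 ^+ j * N) `^ (- (s%:R + alpha)))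
  (fun j => 2 ^+ j.+1 * N)) => //.
- exact: measurable_far_fun.
- by move=> y; exact: far_fun_ge0.
- by move=> j; exact: powR_ge0.
- by move=> j; rewrite mulr_gt0.
- rewrite powR_ge0/= powRN invf_lt1 ?powR_gt0//.
  have := @gt0_ltr_powR R alpha a0 1 2; rewrite powR1; apply; rewrite ?nnegrE//; lra.
- by rewrite !mulr_ge0 ?exprn_ge0 ?powR_ge0.
- move=> y; rewrite /far_fun; case: ifPn => [Ny|]; last by left.
  right; have [|j /andP[j1 j2]] := @dyadic_scale R (enorm y / N).
    by rewrite ler_pdivlMr// mul1r.
  rewrite ler_pdivlMr// in j1; rewrite ltr_pdivrMr// in j2.
  exists j; last by rewrite subr0.
  by apply: powRN_le => //; rewrite mulr_gt0.
move=> j; set t := 2 ^+ j * N.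
have t0 : 0 < t by rewrite mulr_gt0.
have -> : 2 ^+ j.+1 * N = 2 * t by rewrite /t exprS mulrA.
rewrite opprD powRD; last by rewrite (gt_eqF t0) implybT.
rewrite powR_invn ?(ltW t0)// (exprMn s 2 t).
rewrite (_ : t ^- s * t `^ (- alpha) * (L * (2 ^+ s * t ^+ s)) = L * 2 ^+ s * t `^ (- alpha)); last first.
  by field; rewrite expf_neq0// gt_eqF.
rewrite /t powRM ?(ltW N0) ?(ltW (p2 j))// -[leRHS]mulrA ler_wpM2l ?mulr_ge0 ?exprn_ge0// le_eqVlt.
rewrite -powR_mulrn// -powRrM -powR_mulrn ?powR_ge0// -powRrM.
by rewrite mulrC [j%:R * _]mulrC eqxx.
Qed.

End near_far.

Section holder_continuous.
Variables (R : realType) (d : nat).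
Local Notation E := 'rV[R]_d.

Lemma holder_continuous (f : E -> R) (C a : R) : 0 < a ->
  (forall x y, `|f x - f y| <= C * enorm (x - y) `^ a) -> continuous f.
Proof.
move=> a0 fC x; apply/cvgrPdist_lt => e e0.
pose C' := `|C| + 1; have C'0 : 0 < C' by rewrite ltr_wpDl.
have r0 : 0 < (e / C') `^ a^-1 by rewrite powR_gt0// divr_gt0.
apply/nbhs_eballP; exists ((e / C') `^ a^-1) => // y; rewrite /eball/= => yx.
apply: (le_lt_trans (fC _ _)); rewrite enormB.
have lt1 : enorm (y - x) `^ a < e / C'.
  have -> : e / C' = ((e / C') `^ a^-1) `^ a.
    by rewrite -powRrM mulVf ?gt_eqF// powRr1// divr_ge0// ltW.
  by apply: gt0_ltr_powR => //; rewrite nnegrE ?powR_ge0 ?enorm_ge0.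
apply: (@le_lt_trans _ _ (C' * enorm (y - x) `^ a)).
  by rewrite ler_wpM2r ?powR_ge0// (le_trans (ler_norm C))// lerDl.
by rewrite mulrC -ltr_pdivlMr.
Qed.

Lemma lipschitz_continuous (f : E -> R) (C : R) :
  (forall x y, `|f x - f y| <= C * enorm (x - y)) -> continuous f.
Proof.
move=> fC; apply: (@holder_continuous f C 1) => // x y.
by rewrite powRr1 ?enorm_ge0.
Qed.

End holder_continuous.

(* [h] is a real component of [x |-> enorm x `^ (s + alpha) *: K x]; the
   regularized kernels below are then continuous on the whole space. *)
Record numerator (R : realType) (d : nat) (alpha C : R) (h : 'rV[R]_d -> R) : Prop := Numerator {
  num_size : forall x, `|h x| <= enorm x `^ alpha;
  num_odd : forall x, h (- x) = - h x;
  num_holder : forall x y, `|h x - h y| <= C * enorm (x - y) `^ alpha;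
  num_hom : forall (l : R) x, 0 < l -> h (l *: x) = l `^ alpha * h x }.

Section kernel.
Variables (R : realType) (d s : nat) (alpha C : R) (h : 'rV[R]_d -> R).
Local Notation E := 'rV[R]_d.
Local Notation B := (borelE R d).
Hypotheses (s0 : (0 < s)%N) (a01 : 0 < alpha <= 1) (C0 : 0 <= C)
  (hh : numerator alpha C h).

(** [delta > 0] gives a component of the regularized kernel and [delta = 0] one of the singular
    kernel, both vanishing at 0, so one set of estimates serves for both. *)
Definition kreg (delta : R) (x : E) : R :=
  h x * Num.max (enorm x) delta `^ (- (s%:R + alpha)).

Let a0 : 0 < alpha. Proof. by case/andP: a01. Qed.
Let a1 : alpha <= 1. Proof. by case/andP: a01. Qed.
Let sa0 : 0 <= s%:R + alpha. Proof. by rewrite addr_ge0// ltW. Qed.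
Let sam : s%:R + alpha <= s.+1%:R. Proof. by rewrite -natr1 lerD2l. Qed.

Lemma num0 : h 0 = 0.
Proof.
apply/eqP; rewrite -normr_le0 (le_trans (num_size hh _))//.
by rewrite enorm0 powR0// gt_eqF.
Qed.

Lemma kreg0 delta : kreg delta 0 = 0.
Proof. by rewrite /kreg num0 mul0r. Qed.

Lemma kreg_odd delta x : kreg delta (- x) = - kreg delta x.
Proof. by rewrite /kreg (num_odd hh) enormN mulNr. Qed.

Lemma kreg_size delta x : 0 <= delta -> x != 0 -> `|kreg delta x| <= enorm x ^- s.
Proof.
move=> d0 x0; have e0 : 0 < enorm x by rewrite enorm_gt0.
rewrite /kreg normrM [X in _ * X]ger0_norm ?powR_ge0//.
apply: (@le_trans _ _ (enorm x `^ alpha * enorm x `^ (- (s%:R + alpha)))).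
  apply: ler_pM; [exact: normr_ge0|exact: powR_ge0|exact: (num_size hh)|].
  by apply: powRN_le => //; rewrite le_max lexx.
by rewrite -powRD ?(gt_eqF e0) ?implybT// opprD addrC subrK powR_invn// ltW.
Qed.

Lemma kreg_near_size delta x : 0 <= delta ->
  `|kreg delta x| * enorm x <= enorm x ^- s.-1.
Proof.
move=> d0; have [->|x0] := eqVneq x 0.
  by rewrite kreg0 normr0 mul0r enorm0 invr_ge0 exprn_ge0.
have e0 : 0 < enorm x by rewrite enorm_gt0.
apply: (@le_trans _ _ (enorm x ^- s * enorm x)).
  by rewrite ler_wpM2r ?enorm_ge0// kreg_size.
rewrite -{1}(prednK s0) exprS invfM mulrAC mulVf ?mul1r//.
by rewrite gt_eqF.
Qed.

Lemma kreg_bound delta x : 0 < delta -> `|kreg delta x| <= delta ^- s.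
Proof.
move=> d0; rewrite /kreg normrM [X in _ * X]ger0_norm ?powR_ge0//.
have m0 : 0 < Num.max (enorm x) delta by rewrite lt_max d0 orbT.
apply: (@le_trans _ _ (Num.max (enorm x) delta `^ alpha * Num.max (enorm x) delta `^ (- (s%:R + alpha)))).
  rewrite ler_wpM2r ?powR_ge0// (le_trans (num_size hh _))//.
  apply: ge0_ler_powR; rewrite ?nnegrE ?enorm_ge0 ?(ltW a0) ?(ltW m0)//.
  by rewrite le_max lexx.
rewrite -powRD ?(gt_eqF m0) ?implybT// opprD addrC subrK powR_invn ?(ltW m0)//.
rewrite lef_pV2 ?posrE ?exprn_gt0// lerXn2r ?nnegrE ?(ltW m0) ?(ltW d0)//.
by rewrite le_max lexx orbT.
Qed.

Lemma kreg_eq delta eps x : delta <= eps -> eps <= enorm x -> kreg delta x = kreg eps x.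
Proof.
by move=> de ex; rewrite /kreg !max_l// (le_trans de).
Qed.

(** The two kernels agree off the ball of radius [eps], and inside it each is bounded by the kernel
    size. By [integral_near] the right-hand side has integral O(eps). *)
Lemma kreg_diff delta eps x : 0 <= delta -> delta <= eps ->
  `|kreg delta x - kreg eps x| * enorm x <= 2 * near_fun s eps x.
Proof.
move=> d0 de; rewrite /near_fun; case: ltP => [xe|ex]; last first.
  by rewrite (kreg_eq de ex) subrr normr0 mul0r mulr0.
apply: (le_trans (ler_wpM2r (enorm_ge0 _) (ler_normB _ _))).
rewrite mulrDl; apply: (le_trans (lerD (kreg_near_size x d0) (kreg_near_size x (le_trans d0 de)))).
by rewrite -mulr2n mulr_natl.
Qed.

Lemma num_continuous : continuous h.
Proof. exact: holder_continuous a0 (num_holder hh). Qed.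

Lemma kreg_continuous delta : 0 < delta -> continuous (kreg delta).
Proof.
move=> d0 x; apply: cvgM; first exact: num_continuous.
apply: (@lipschitz_continuous R d (fun x => Num.max (enorm x) delta `^ (- (s%:R + alpha)))
  (delta `^ (- (s%:R + alpha)) * (s.+1%:R / delta))) => {}x y.
have mx (z : E) : delta <= Num.max (enorm z) delta by rewrite le_max lexx orbT.
apply: (le_trans (powRN_dist_le d0 (mx x) (mx y) sa0 sam)).
rewrite -[leRHS]mulrA ler_wpM2l ?powR_ge0// [leRHS]mulrAC.
apply: (@le_trans _ _ (s.+1%:R * `|Num.max (enorm x) delta - Num.max (enorm y) delta| / delta)).
  rewrite ler_wpM2l ?mulr_ge0// lef_pV2 ?posrE//.
    by rewrite le_max mx.
  by rewrite lt_max (lt_le_trans d0 (mx x)).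
rewrite ler_wpM2r ?invr_ge0 ?(ltW d0)// ler_wpM2l//.
apply: le_trans (enorm_dist _ _).
rewrite !maxEle; case: (leP (enorm x) delta); case: (leP (enorm y) delta) => yd xd.
- by rewrite subrr normr0.
- by do 2 (rewrite ler0_norm; last lra); lra.
- by do 2 (rewrite ger0_norm; last lra); lra.
- by [].
Qed.

Lemma measurable_kreg delta : 0 <= delta -> measurable_fun setT (kreg delta : B -> R).
Proof.
move=> d0; apply: measurable_funM.
  exact: continuous_measurable num_continuous.
apply: (measurableT_comp (measurable_powR _)).
by apply: measurable_maxr; [exact: measurable_enorm|exact: measurable_cst].
Qed.

Lemma kreg_scale delta (l : R) x : 0 < l -> 0 <= delta ->
  kreg (l * delta) (l *: x) = l ^- s * kreg delta x.
Proof.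
move=> l0 d0; rewrite /kreg (num_hom hh)// enormZ gtr0_norm//.
rewrite -maxr_pMr ?(ltW l0)// powRM ?(ltW l0)//; last by rewrite le_max enorm_ge0.
rewrite mulrACA -powRD ?(gt_eqF l0) ?implybT//.
by rewrite opprD addrC subrK powR_invn ?(ltW l0).
Qed.

(** The difference of products is split in two. The Hölder bound on [h] gives [C rho^alpha], with
    [|x - y| >= |y| / 2] in the power. The variation of the power gives [(s + 1) rho / |y|], whose
    denominator absorbs [|h (- y)| <= |y|^alpha <= |y|]; this is where [1 <= |y|] enters. The gain
    over the size [|y|^-s] is [|y|^-alpha]. *)
Lemma kreg_far (rho delta : R) x y : 0 <= rho -> 0 <= delta -> enorm x <= rho ->
  1 <= enorm y -> 2 * rho <= enorm y -> 2 * delta <= enorm y ->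
  `|kreg delta (x - y) - kreg delta (- y)| <=
     2 `^ (s%:R + alpha) * (C * rho `^ alpha + s.+1%:R * rho) *
     enorm y `^ (- (s%:R + alpha)).
Proof.
move=> r0 d0 xr y1 yr yd.
set a := s%:R + alpha.
have y0 : 0 < enorm y by apply: lt_le_trans y1.
have xy1 : enorm y / 2 <= enorm (x - y).
  have := enorm_subl y x; rewrite enormB; lra.
have xy2 : `|enorm (x - y) - enorm y| <= rho.
  by have := enorm_dist (y - x) y; rewrite enormB addrAC subrr add0r enormN enormB; move/le_trans; apply.
have hy0 : 0 < enorm y / 2 by rewrite divr_gt0.
rewrite /kreg -/a enormN !max_l; [|lra..].
have -> : h (x - y) * enorm (x - y) `^ (- a) - h (- y) * enorm y `^ (- a) =
  (h (x - y) - h (- y)) * enorm (x - y) `^ (- a) +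
  h (- y) * (enorm (x - y) `^ (- a) - enorm y `^ (- a)) by ring.
apply: (le_trans (ler_normD _ _)).
have hya : (enorm y / 2) `^ (- a) = 2 `^ a * enorm y `^ (- a).
  rewrite powRM ?invr_ge0 ?(ltW y0)// mulrC; congr (_ * _).
  by rewrite -(@powR_inv1 R 2)// -powRrM mulrNN mul1r.
rewrite [_ `^ a * _]mulrDr [leRHS]mulrDl; apply: lerD.
  rewrite normrM [X in _ * X]ger0_norm ?powR_ge0//.
  rewrite mulrAC mulrC.
  apply: ler_pM; rewrite ?powR_ge0 ?normr_ge0//.
    by rewrite -hya; apply: powRN_le.
  apply: (le_trans (num_holder hh _ _)); rewrite opprK subrK ler_wpM2l//.
  by apply: ge0_ler_powR; rewrite ?nnegrE ?enorm_ge0 ?(ltW a0).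
rewrite normrM.
have uy : enorm y / 2 <= enorm y by lra.
apply: (le_trans (ler_wpM2l (normr_ge0 _) (powRN_dist_le hy0 xy1 uy sa0 sam))).
rewrite -/a hya.
have hy : `|h (- y)| <= enorm y.
  apply: (le_trans (num_size hh _)); rewrite enormN.
  exact: ler1_powR.
set M := Num.max _ _.
have M0 : enorm y <= M by rewrite le_max lexx orbT.
have Mp : 0 < M by exact: lt_le_trans M0.
rewrite [leRHS]mulrAC mulrCA ler_wpM2l ?mulr_ge0 ?powR_ge0//.
rewrite mulrA ler_pdivrMr//.
rewrite mulrCA -mulrA ler_wpM2l// mulrC; apply: ler_pM => //.
exact: le_trans M0.
Qed.

End kernel.

(** * Real-valued integrals against [mu] and [mu \x mu] *)

Section integrals.
Variables (R : realType) (d s : nat).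
Local Notation E := 'rV[R]_d.
Local Notation B := (borelE R d).
Variables (L : R) (mu : {sigma_finite_measure set B -> \bar R}).
Hypotheses (L0 : 0 <= L) (nmu : nice s L mu).
Local Notation P := (mu \x mu)%E.
Local Notation "mu .-rint f" := (mu.-integrable setT (EFin \o f)) (at level 2).

Lemma rint_bounded_at (c : E) (F : B -> R) (M r : R) : 0 <= M -> 0 < r ->
  measurable_fun setT F -> (forall x, `|F x| <= M) ->
  (forall x : E, r <= enorm (x - c) -> F x = 0) ->
  mu.-integrable setT (EFin \o F) /\ `|\int[mu]_x F x| <= M * (L * r ^+ s).
Proof.
move=> M0 r0 mF FM F0.
have mI : measurable_fun setT (fun x : B => M * \1_(eball c r) x : R).
  apply: measurable_funM; first exact: measurable_cst.
  by apply: measurable_indic; exact: measurable_eball.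
have FI x : `|F x| <= M * \1_(eball c r) x.
  rewrite indicE /eball; case: (boolP (x \in _)); rewrite ?mulr1//= mulr0.
  by rewrite notin_setE/= => /negP; rewrite -leNgt => /F0 ->; rewrite normr0.
have hI : (\int[mu]_x (M * \1_(eball c r) x)%:E <= (M * (L * r ^+ s))%:E)%E.
  under eq_integral do rewrite EFinM.
  rewrite ge0_integralZl//; last first.
    by apply/measurable_EFinP; apply: measurable_indic; exact: measurable_eball.
  rewrite integral_indic ?setIT//; last exact: measurable_eball.
  by rewrite EFinM; apply: lee_wpmul2l; [rewrite lee_fin|exact: nmu].
have hF : (\int[mu]_x `|(F x)%:E| <= (M * (L * r ^+ s))%:E)%E.
  apply: le_trans hI; apply: ge0_le_integral => //.
  - by do 2 (apply: measurableT_comp => //).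
  - exact/measurable_EFinP.
  - by move=> x _; rewrite lee_fin.
have iF : mu.-integrable setT (EFin \o F).
  apply/integrableP; split; first exact/measurable_EFinP.
  exact: le_lt_trans hF (ltry _).
split => //; rewrite -lee_fin EFin_normr_Rintegral//.
apply: le_trans hF; apply: le_abse_integral => //.
exact/measurable_EFinP.
Qed.

Lemma rint_bounded (F : B -> R) (M r : R) : 0 <= M -> 0 < r ->
  measurable_fun setT F -> (forall x, `|F x| <= M) ->
  (forall x : E, r <= enorm x -> F x = 0) ->
  mu.-integrable setT (EFin \o F) /\ `|\int[mu]_x F x| <= M * (L * r ^+ s).
Proof.
by move=> M0 r0 mF FM F0; apply: (@rint_bounded_at 0) => // x; rewrite subr0; exact: F0.
Qed.

Lemma prod_rint_le (F : B * B -> R) (D r : R) : 0 <= D -> 0 < r ->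
  measurable_fun setT F ->
  (forall x y : E, r <= enorm x -> F (x, y) = 0) ->
  (forall x, \int[mu]_y `|(F (x, y))%:E| <= D%:E)%E ->
  P.-integrable setT (EFin \o F) /\ `|\int[P]_z F z| <= D * (L * r ^+ s).
Proof.
move=> D0 r0 mF F0 FD.
have mEF : measurable_fun setT (EFin \o F) by exact/measurable_EFinP.
have maF : measurable_fun setT (abse \o (EFin \o F)) by exact: measurableT_comp.
have h1 : (\int[P]_z `|(F z)%:E| <= (D * (L * r ^+ s))%:E)%E.
  rewrite (fubini_tonelli1 (abse \o (EFin \o F)))//=.
  apply: (@le_trans _ _ (\int[mu]_x (D * \1_(eball 0 r) x)%:E)%E); last first.
    under eq_integral do rewrite EFinM.
    rewrite ge0_integralZl//; last first.
      by apply/measurable_EFinP; apply: measurable_indic; exact: measurable_eball.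
    rewrite integral_indic ?setIT//; last exact: measurable_eball.
    by rewrite EFinM; apply: lee_wpmul2l; [rewrite lee_fin|exact: nmu].
  apply: ge0_le_integral => //.
  - by move=> x _; apply: integral_ge0 => y _; exact: abse_ge0.
  - by apply: measurable_fun_fubini_tonelli_F => // z; exact: abse_ge0.
  - apply/measurable_EFinP; apply: measurable_funM; first exact: measurable_cst.
    by apply: measurable_indic; exact: measurable_eball.
  move=> x _; rewrite indicE /eball; case: (boolP (x \in _)) => /=.
    by rewrite mulr1 => _; exact: FD.
  rewrite notin_setE/= subr0 => /negP; rewrite -leNgt => rx.
  by rewrite mulr0 /fubini_F integral0_eq// => y _; rewrite /= F0// normr0.
have iF : P.-integrable setT (EFin \o F).
  by apply/integrableP; split => //; exact: le_lt_trans h1 (ltry _).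
split=> //; rewrite -lee_fin EFin_normr_Rintegral//.
by apply: le_trans h1; exact: le_abse_integral.
Qed.

(** [Rintegral] sends infinite values to 0 through [fine]; finiteness of every section, rather than
    almost every one, makes the real iterated integral agree pointwise with the extended one. *)
Lemma Rintegral_prod12 (F : B * B -> R) : P.-integrable setT (EFin \o F) ->
  (forall x, \int[mu]_y `|(F (x, y))%:E| < +oo)%E ->
  \int[P]_z F z = \int[mu]_x \int[mu]_y F (x, y).
Proof.
move=> iF Flty; rewrite [LHS]/Rintegral -(integral12_prod_meas1 iF).
rewrite [RHS]/Rintegral; congr fine; apply: eq_integral => x _.
rewrite /Rintegral fineK// /fubini_F integrable_fin_num//.
apply/integrableP; split; last exact: Flty.
exact: (measurableT_comp (measurable_int _ iF) (pair1_measurable x)).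
Qed.

Lemma Rintegral_prod21 (F : B * B -> R) : P.-integrable setT (EFin \o F) ->
  (forall y, \int[mu]_x `|(F (x, y))%:E| < +oo)%E ->
  \int[P]_z F z = \int[mu]_y \int[mu]_x F (x, y).
Proof.
move=> iF Flty; rewrite [LHS]/Rintegral -(integral21_prod_meas1 iF).
rewrite [RHS]/Rintegral; congr fine; apply: eq_integral => y _.
rewrite /Rintegral fineK// /fubini_G integrable_fin_num//.
apply/integrableP; split; last exact: Flty.
exact: (measurableT_comp (measurable_int _ iF) (pair2_measurable y)).
Qed.

Lemma prod_rint_swap (F : B * B -> R) : P.-integrable setT (EFin \o F) ->
  P.-integrable setT (EFin \o (fun z => F (z.2, z.1))) /\
  \int[P]_z F (z.2, z.1) = \int[P]_z F z.
Proof.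
move=> iF.
have mF : measurable_fun setT (EFin \o F) by exact: measurable_int iF.
have mS : measurable_fun setT (fun z : B * B => (z.2, z.1)).
  by apply/measurable_fun_pairP; split; [exact: measurable_snd|exact: measurable_fst].
have mFS : measurable_fun setT (EFin \o (fun z => F (z.2, z.1))).
  exact: (measurableT_comp mF mS).
have iFS : P.-integrable setT (EFin \o (fun z => F (z.2, z.1))).
  by apply/(integrable12ltyP _ _ mFS)/(integrable21ltyP _ _ mF).
split=> //; rewrite /Rintegral.
by rewrite -(integral12_prod_meas1 iFS) -(integral21_prod_meas1 iF).
Qed.

(** The section integral is the difference of the integrals of the positive and negative parts, each
    measurable by Tonelli. *)
Lemma measurable_Rintegral2 (F : B * B -> R) : measurable_fun setT F ->
  measurable_fun setT (fun y : B => \int[mu]_x F (x, y)).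
Proof.
move=> mF.
have mEF : measurable_fun setT (EFin \o F) by exact/measurable_EFinP.
apply: (measurableT_comp (@fine_measurable R setT measurableT)).
under eq_fun do rewrite integralE.
apply: emeasurable_funB.
  rewrite [X in measurable_fun _ X](_ : _ = fubini_G mu (EFin \o F)^\+%E).
    by apply: measurable_fun_fubini_tonelli_G => //; exact: measurable_funepos.
  by apply/funext => y; apply: eq_integral => x _; rewrite !unlock.
rewrite [X in measurable_fun _ X](_ : _ = fubini_G mu (EFin \o F)^\-%E).
  by apply: measurable_fun_fubini_tonelli_G => //; exact: measurable_funeneg.
by apply/funext => y; apply: eq_integral => x _; rewrite !unlock.
Qed.

Lemma measurable_diff (k : E -> R) : measurable_fun setT (k : B -> R) ->
  measurable_fun setT (fun z : B * B => k ((z.1 : E) - z.2)).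
Proof.
move=> mk; apply: (measurableT_comp mk).
by apply: measurable_subE; [exact: measurable_fst|exact: measurable_snd].
Qed.

End integrals.

(** * Riesz representation *)

Section compactly_supported.
Variables (R : realType) (d : nat).
Local Notation E := 'rV[R]_d.

(** Turns a property that holds eventually and locally uniformly into one that holds eventually on a
    whole compact set. It is applied along [\oo], along neighbourhoods of a point, along the
    ultrafilter, and along radii tending to 0. *)
Lemma compact_near (K : set E) I (F : set_system I) (P : I -> E -> Prop) :
  Filter F -> compact K ->
  (forall x, K x -> exists2 r : R, 0 < r & F [set i | forall y, enorm (y - x) < r -> P i y]) ->
  F [set i | K `<=` P i].
Proof.
move=> FF /compact_near_coveringP cK hP; apply: cK => x Kx.
have [r r0 Fr] := hP x Kx; exists (eball x r, [set i | forall y, enorm (y - x) < r -> P i y]).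
  by split => //=; apply/nbhs_eballP; exists r.
by move=> [y i]/= [yr]; exact.
Qed.

Definition Cc (f : E -> R) := continuous f /\ exists r, forall x, r <= enorm x -> f x = 0.

Lemma Cc_bounded_support f : Cc f -> exists2 r, 0 < r & forall x, r <= enorm x -> f x = 0.
Proof.
move=> [_ [r fr]]; exists (`|r| + 1); first by rewrite ltr_wpDl.
by move=> x rx; apply: fr; apply: le_trans rx; rewrite (le_trans (ler_norm r))// lerDl.
Qed.

Lemma Cc_comp f (g : R -> R) : Cc f -> continuous g -> g 0 = 0 -> Cc (fun x => g (f x)).
Proof.
move=> [cf [r fr]] cg g0; split; last by exists r => x /fr ->.
by move=> x; apply: (@continuous_comp E R R); [exact: cf|exact: cg].
Qed.

Lemma Cc_add f g : Cc f -> Cc g -> Cc (fun x => f x + g x).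
Proof.
move=> Cf Cg; split; first by move=> x; apply: cvgD; [exact: Cf.1|exact: Cg.1].
have [r _ fr] := Cc_bounded_support Cf; have [t _ gt] := Cc_bounded_support Cg.
by exists (Num.max r t) => x; rewrite ge_max => /andP[/fr -> /gt ->]; rewrite addr0.
Qed.

Lemma Cc_mull (f g : E -> R) : continuous f -> Cc g -> Cc (fun x => f x * g x).
Proof.
move=> cf [cg [r gr]]; split; first by move=> x; apply: cvgM; [exact: cf|exact: cg].
by exists r => x /gr ->; rewrite mulr0.
Qed.

Lemma Cc_scale (a : R) f : Cc f -> Cc (fun x => a * f x).
Proof. by apply: Cc_mull => x; exact: cvg_cst. Qed.

Lemma Cc_opp f : Cc f -> Cc (fun x => - f x).
Proof. by move=> /(Cc_scale (-1)); under eq_fun do rewrite mulN1r. Qed.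

Lemma Cc_sub f g : Cc f -> Cc g -> Cc (fun x => f x - g x).
Proof. by move=> Cf /Cc_opp Cg; exact: Cc_add. Qed.

Lemma Cc0 : Cc (fun=> 0).
Proof. by split=> [x|]; [exact: cvg_cst|exists 0]. Qed.

Lemma Cc_sum I (r : seq I) (P : pred I) (f : I -> E -> R) :
  (forall i, P i -> Cc (f i)) -> Cc (fun x => \sum_(i <- r | P i) f i x).
Proof.
move=> Cf; elim: r => [|i r IH]; first by under eq_fun do rewrite big_nil; exact: Cc0.
case Pi : (P i); last by under eq_fun do rewrite big_cons Pi.
by under eq_fun do rewrite big_cons Pi; apply: Cc_add => //; exact: Cf.
Qed.

Lemma continuous_posr (e : R) : continuous (fun t : R => Num.max (t - e) 0).
Proof.
move=> t; apply: (@continuous_max R R (fun t => t - e) (fun=> 0)).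
  by apply: cvgB; [exact: cvg_id|exact: cvg_cst].
exact: cvg_cst.
Qed.

Lemma Cc_trunc f e : Cc f -> 0 <= e -> Cc (fun x => Num.max (f x - e) 0).
Proof.
move=> Cf e0; apply: (Cc_comp Cf (continuous_posr (e := e))).
by rewrite sub0r max_r// oppr_le0.
Qed.

Lemma Cc_bounded f : Cc f -> exists2 M, 0 < M & forall x, `|f x| <= M.
Proof.
move=> Cf; have [r r0 fr] := Cc_bounded_support Cf.
have [n hn] : exists n : nat, [set y : E | enorm (y - 0) <= r] `<=` [set y | `|f y| <= n%:R].
  have : \forall n \near \oo, [set y : E | enorm (y - 0) <= r] `<=` [set y | `|f y| <= n%:R].
    apply: (@compact_near _ _ _ (fun n y => `|f y| <= n%:R)) => [|x _].
      exact: compact_cball.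
    have [e e0 he] : exists2 e : R, 0 < e & eball x e `<=` [set y | `|f x - f y| < 1].
      by apply/nbhs_eballP; have /cvgrPdist_lt := Cf.1 x; exact.
    exists e => //; near=> n; move=> y /he/= fxy.
    have : `|f x| + 1 <= n%:R by near: n; exact: nbhs_infty_ger.
    by apply: le_trans; rewrite -lerBlDl (le_trans (lerB_dist _ _))// distrC ltW.
  by case=> n _ hn; exists n; apply: hn => /=.
exists (n%:R + 1); first by rewrite ltr_wpDl.
move=> x; have [xr|/ltW xr] := leP (enorm x) r.
  by rewrite (le_trans (hn x _))//= ?subr0// lerDl.
by rewrite fr// normr0 addr_ge0.
Unshelve. all: by end_near. Qed.

Definition clamp (t : R) : R := Num.min (Num.max t 0) 1.

Lemma clamp_ge0 t : 0 <= clamp t.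
Proof. by rewrite /clamp le_min ler01 le_max lexx orbT. Qed.

Lemma clamp_le1 t : clamp t <= 1.
Proof. by rewrite /clamp ge_min lexx orbT. Qed.

Lemma clamp_eq1 t : 1 <= t -> clamp t = 1.
Proof. by move=> t1; rewrite /clamp min_r// le_max t1. Qed.

Lemma clamp_eq0 t : t <= 0 -> clamp t = 0.
Proof. by move=> t0; rewrite /clamp (max_r t0) min_l// ler01. Qed.

Lemma clamp_lip t u : `|clamp t - clamp u| <= `|t - u|.
Proof.
wlog tu : t u / t <= u => [hw|].
  have [/hw//|/hw] : t <= u \/ u <= t by apply/orP; exact: le_total.
  by rewrite distrC (distrC u).
rewrite !(distrC t) !(distrC (clamp t)) (ger0_norm (_ : 0 <= u - t)) ?subr_ge0//.
rewrite /clamp; case: (leP t 0); case: (leP u 0) => u0 t0;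
  rewrite ?(minElt 0) ?ltr01/=; try lra.
- by rewrite subrr normr0 subr_ge0.
- by case: (leP u 1) => u1; rewrite subr0 ger0_norm; lra.
- by case: (leP u 1) => u1; case: (leP t 1) => t1; rewrite ger0_norm; lra.
Qed.

Lemma clamp_dist_lip (x y : E) (a r : R) c : 0 < r ->
  `|clamp (a - enorm (x - c) / r) - clamp (a - enorm (y - c) / r)| <= r^-1 * enorm (x - y).
Proof.
move=> r0; apply: (le_trans (clamp_lip _ _)).
rewrite (_ : _ - _ = (enorm (y - c) - enorm (x - c)) / r); last by field; rewrite gt_eqF.
rewrite normrM [X in _ * X]gtr0_norm ?invr_gt0// mulrC ler_pM2l ?invr_gt0//.
apply: (le_trans (enorm_dist _ _)).
by rewrite opprB addrA subrK enormB.
Qed.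

Definition bump (c : E) (r : R) (x : E) : R := clamp (2 - enorm (x - c) / r).

Lemma bump_ge0 c r x : 0 <= bump c r x. Proof. exact: clamp_ge0. Qed.
Lemma bump_le1 c r x : bump c r x <= 1. Proof. exact: clamp_le1. Qed.

Lemma bump_eq1 c r x : 0 < r -> enorm (x - c) <= r -> bump c r x = 1.
Proof.
by move=> r0 xr; rewrite /bump clamp_eq1// lerBrDl -lerBrDr ler_pdivrMr//; lra.
Qed.

Lemma bump_eq0 c r x : 0 < r -> 2 * r <= enorm (x - c) -> bump c r x = 0.
Proof. by move=> r0 xr; rewrite /bump clamp_eq0// subr_le0 ler_pdivlMr. Qed.

Lemma bump_lip c r x y : 0 < r -> `|bump c r x - bump c r y| <= r^-1 * enorm (x - y).
Proof. exact: clamp_dist_lip. Qed.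

Lemma bump_Cc c r : 0 < r -> Cc (bump c r).
Proof.
move=> r0; split.
  by apply: (@lipschitz_continuous _ _ _ r^-1) => x y; exact: bump_lip.
exists (2 * r + enorm c) => x xr; apply: bump_eq0 => //.
by apply: le_trans (enorm_subl _ _); rewrite lerBrDr.
Qed.

(* Distance to the complement of [U], capped at 1 so that it makes sense for
   [U] the whole space. *)
Definition codist (U : set E) (x : E) : R :=
  inf [set t | t = 1 \/ exists2 a, ~ U a & t = enorm (x - a)].

Lemma codist_lbound (U : set E) (x : E) :
  has_lbound [set t | t = 1 \/ exists2 a, ~ U a & t = enorm (x - a)].
Proof. by exists 0 => t [->//|[a _ ->]]; exact: enorm_ge0. Qed.

Lemma codist_le U x y : codist U x <= codist U y + enorm (x - y).
Proof.
rewrite -lerBlDr; apply: lb_le_inf; first by exists 1; left.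
move=> t [->|[a Ua ->]]; rewrite lerBlDr.
  apply: (@le_trans _ _ 1); last by rewrite lerDl enorm_ge0.
  by apply: ge_inf; [exact: codist_lbound|left].
apply: (@le_trans _ _ (enorm (x - a))); last by rewrite [leRHS]addrC enormDB.
by apply: ge_inf; [exact: codist_lbound|right; exists a].
Qed.

Lemma codist_lip U x y : `|codist U x - codist U y| <= enorm (x - y).
Proof.
rewrite ler_norml lerBlDl codist_le andbT lerBrDl lerBlDr enormB.
by rewrite codist_le.
Qed.

Lemma codist0 U x : ~ U x -> codist U x <= 0.
Proof.
move=> Ux; apply: ge_inf; first exact: codist_lbound.
by right; exists x => //; rewrite subrr enorm0.
Qed.

Lemma codist_ge U x r : r <= 1 -> eball x r `<=` U -> r <= codist U x.
Proof.
move=> r1 rU; apply: lb_le_inf; first by exists 1; left.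
move=> t [->//|[a Ua ->]]; rewrite leNgt; apply/negP => xa; apply: Ua; apply: rU.
by rewrite /eball/= enormB.
Qed.

End compactly_supported.

Section riesz.
Variables (R : realType) (d : nat).
Local Notation E := 'rV[R]_d.
Local Notation B := (borelE R d).

Record positive_functional (L : (E -> R) -> R) : Prop := PositiveFunctional {
  pf_ge0 : forall f, Cc f -> (forall x, 0 <= f x) -> 0 <= L f;
  pf_add : forall f g, Cc f -> Cc g -> L (fun x => f x + g x) = L f + L g;
  pf_scale : forall a f, Cc f -> L (fun x => a * f x) = a * L f }.

Section positive.
Variables (L : (E -> R) -> R) (hL : positive_functional L).

Lemma pf_sub f g : Cc f -> Cc g -> L (fun x => f x - g x) = L f - L g.
Proof.
move=> Cf Cg; rewrite (pf_add hL)//; last exact: Cc_opp.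
by congr (_ + _); rewrite -mulN1r -(pf_scale hL)//; congr L; apply/funext => x; rewrite mulN1r.
Qed.

Lemma pf_mono f g : Cc f -> Cc g -> (forall x, f x <= g x) -> L f <= L g.
Proof.
move=> Cf Cg fg; rewrite -subr_ge0 -pf_sub//; apply: (pf_ge0 hL).
  exact: Cc_sub.
by move=> x; rewrite subr_ge0.
Qed.

Lemma pf0 : L (fun=> 0) = 0.
Proof.
have -> : L (fun=> 0) = 0 * L (fun=> 0); last by rewrite mul0r.
rewrite -(pf_scale hL); last exact: Cc0.
by congr L; apply/funext => x; rewrite mul0r.
Qed.

Lemma pf_sum I (r : seq I) (f : I -> E -> R) : (forall i, Cc (f i)) ->
  L (fun x => \sum_(i <- r) f i x) = \sum_(i <- r) L (f i).
Proof.
move=> Cf; elim: r => [|i r IH].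
  by rewrite big_nil -[RHS]pf0; congr L; apply/funext => x; rewrite big_nil.
rewrite big_cons -IH -(pf_add hL)//; last exact: Cc_sum.
by congr L; apply/funext => x; rewrite big_cons.
Qed.

(** Only vanishing off [U] is asked, not compact support inside [U]; [dominated_trim] regains a
    closed support at a small loss. *)
Definition dominated (U : set E) (f : E -> R) :=
  [/\ Cc f, forall x, 0 <= f x <= 1 & forall x, ~ U x -> f x = 0].

(** The usual Riesz construction: open sets are measured from inside by test functions, and
    arbitrary sets from outside by open sets. *)
Definition open_content (U : set E) : \bar R :=
  ereal_sup [set (L f)%:E | f in dominated U].

Definition riesz_outer (A : set E) : \bar R :=
  ereal_inf [set open_content U | U in [set U | open U /\ A `<=` U]].

Lemma dominated0 U : dominated U (fun=> 0).
Proof. by split=> // [|x]; [exact: Cc0|rewrite lexx ler01]. Qed.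

Lemma dominated_le U f : dominated U f -> ((L f)%:E <= open_content U)%E.
Proof. by move=> Uf; apply: ereal_sup_ubound; exists f. Qed.

Lemma open_content_ge0 U : (0 <= open_content U)%E.
Proof. by apply: le_trans (dominated_le (dominated0 U)); rewrite pf0. Qed.

Lemma open_content_mono U V : U `<=` V -> (open_content U <= open_content V)%E.
Proof.
move=> UV; apply: ereal_sup_le => _ [f [Cf f01 f0] <-]; exists f => //; split=> // x Vx.
by apply: f0 => /UV.
Qed.

Lemma riesz_outer_open U : open U -> riesz_outer U = open_content U.
Proof.
move=> oU; apply/eqP; rewrite eq_le; apply/andP; split.
  by apply: ereal_inf_lbound; exists U => //; split.
by apply: le_ereal_inf_tmp => _ [V [oV UV] <-]; exact: open_content_mono.
Qed.

Lemma riesz_outer_ge0 A : (0 <= riesz_outer A)%E.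
Proof. by apply: le_ereal_inf_tmp => _ [V _ <-]; exact: open_content_ge0. Qed.

Lemma riesz_outer0 : riesz_outer set0 = 0%E.
Proof.
rewrite riesz_outer_open; last exact: open0.
apply/eqP; rewrite eq_le open_content_ge0 andbT.
apply: ge_ereal_sup => _ [f [_ _ f0] <-].
rewrite (_ : f = fun=> 0) ?pf0//; apply/funext => x; exact: f0.
Qed.

Lemma riesz_outer_mono A A' : A `<=` A' -> (riesz_outer A <= riesz_outer A')%E.
Proof.
move=> AA'; apply: ereal_inf_le_tmp => _ [V [oV AV] <-]; exists V => //.
by split=> //; exact: subset_trans AV.
Qed.

(* Truncating [f] at a small height leaves a function supported in a closed
   subset of [U], at a small cost. *)
Lemma dominated_trim U f e : dominated U f -> 0 < e ->
  exists2 eps : R, 0 < eps &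
    dominated U (fun x => Num.max (f x - eps) 0) /\
    L f <= L (fun x => Num.max (f x - eps) 0) + e.
Proof.
move=> [Cf f01 f0] e0; have [r r0 fr] := Cc_bounded_support Cf.
pose b := bump (0 : E) r; have Cb : Cc b by exact: bump_Cc.
have Lb0 : 0 <= L b by apply: (pf_ge0 hL) => // x; exact: bump_ge0.
pose eps := e / (L b + 1).
have eps0 : 0 < eps by rewrite divr_gt0// ltr_wpDl.
exists eps => //; split.
  split=> [|x|x Ux]; first by apply: Cc_trunc => //; exact: ltW.
    have /andP[_ f1] := f01 x.
    by rewrite le_max lexx orbT/= ge_max ler01 andbT lerBlDr (le_trans f1)// lerDl ltW.
  by rewrite f0// sub0r max_r// oppr_le0 ltW.
apply: (@le_trans _ _ (L (fun x => Num.max (f x - eps) 0) + eps * L b)); last first.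
  rewrite lerD2l /eps mulrAC ler_pdivrMr ?ltr_wpDl// ler_pM2l//.
  by rewrite lerDl.
rewrite -(pf_scale hL)// -(pf_add hL); last 2 first.
- by apply: Cc_trunc => //; exact: ltW.
- exact: Cc_scale.
apply: pf_mono => //.
  by apply: Cc_add; [apply: Cc_trunc => //; exact: ltW|exact: Cc_scale].
move=> x; have [xr|/ltW xr] := leP (enorm x) r.
  by rewrite /b bump_eq1 ?subr0// mulr1 -lerBlDr le_max lexx.
by rewrite fr// sub0r addr_ge0// ?le_max ?lexx ?orbT// mulr_ge0 ?bump_ge0// ltW.
Qed.

(** After trimming, [g] is nonzero only on a compact set [K] covered by finitely many [U n]. The
    cutoffs [w n] need not sum to 1: at each point of [K] one of them equals 1, so the sum of the
    [w n * g] dominates [g]. *)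
Lemma open_content_bigcup (U : (set E)^nat) : (forall n, open (U n)) ->
  (open_content (\bigcup_n U n) <= \sum_(n <oo) open_content (U n))%E.
Proof.
move=> oU; apply: ge_ereal_sup => _ [f Uf <-].
apply/lee_addgt0Pr => e e0.
have [eps eps0 [Ug fg]] := dominated_trim Uf e0.
apply: (le_trans (y := (L (fun x => Num.max (f x - eps) 0) + e)%:E)); first by rewrite lee_fin.
rewrite EFinD leeD2r//; have [Cf _ f0] := Uf.
pose g x := Num.max (f x - eps) 0; rewrite -/g in Ug fg *.
have [Cg g01 _] := Ug.
have [r r0 fr] := Cc_bounded_support Cf.
pose K := [set x : E | enorm (x - 0) <= r] `&` [set x | eps <= f x].
have cK : compact K.
  apply: compact_closedI; first exact: compact_cball.
  rewrite (_ : [set x | _] = f @^-1` [set t | eps <= t])//.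
  by apply: (@closed_comp E R) => [x _|]; [exact: Cf.1|exact: closed_ge].
have [k hk] : exists k : nat, K `<=` [set x | exists2 n, (n < k)%N & k.+1%:R^-1 <= codist (U n) x].
  have : \forall k \near \oo, K `<=` [set x | exists2 n, (n < k)%N & k.+1%:R^-1 <= codist (U n) x].
    apply: (@compact_near _ _ _ _ _ (fun k x => exists2 n, (n < k)%N & k.+1%:R^-1 <= codist (U n) x)) => // x [_ /= fx].
    have [n _ Unx] : (\bigcup_n U n) x.
      by apply: contrapT => /f0 fx0; move: fx; rewrite fx0 leNgt eps0.
    have [t t0 tU] := open_eballP (oU n) Unx.
    exists (t / 2); first by rewrite divr_gt0.
    near=> k; move=> y yx; exists n; first by near: k; exact: nbhs_infty_gt.
    apply: codist_ge; first by rewrite invf_le1 ?ler1n.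
    apply: subset_trans tU; apply: sub_eball.
    rewrite [leRHS]splitr lerD ?(ltW yx)//.
    near: k; have [N _ hN] := near_infty_natSinv_lt (PosNum (divr_gt0 t0 (@ltr0n R 2))).
    by exists N => // m /hN /ltW.
  by case=> n _ hn; exists n; apply: hn => /=.
have k0 : 0 < (k.+1%:R : R) by [].
pose w n x := clamp (codist (U n) x * k.+1%:R).
have wc n : continuous (w n).
  apply: (@lipschitz_continuous _ _ _ k.+1%:R) => x y.
  apply: (le_trans (clamp_lip _ _)); rewrite -mulrBl normrM [X in _ * X]gtr0_norm// mulrC ler_pM2l//.
  exact: codist_lip.
have Cw n : Cc (fun x => w n x * g x) by exact: Cc_mull.
have Uw n : dominated (U n) (fun x => w n x * g x).
  split=> // [x|x Ux].
    have /andP[g0 g1] := g01 x.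
    by rewrite mulr_ge0 ?clamp_ge0//= mulr_ile1 ?clamp_ge0 ?clamp_le1.
  by rewrite /w clamp_eq0 ?mul0r// pmulr_lle0//; exact: codist0.
apply: (@le_trans _ _ (\sum_(0 <= n < k) open_content (U n))%E); last first.
  by apply: nneseries_lim_ge => *; exact: open_content_ge0.
apply: (@le_trans _ _ (\sum_(0 <= n < k) (L (fun x => w n x * g x))%:E)%E); last first.
  by apply: lee_sum => n _; exact: dominated_le.
rewrite sumEFin lee_fin -pf_sum//; apply: pf_mono => //; first exact: Cc_sum.
move=> x; have /andP[gx0 gx1] := g01 x.
have sum0 : 0 <= \sum_(0 <= i < k) w i x * g x.
  by apply: sumr_ge0 => i _; rewrite mulr_ge0 ?clamp_ge0.
have [gx|gx] := eqVneq (g x) 0; first by rewrite [leLHS]gx.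
have fx : eps <= f x.
  rewrite leNgt; apply: contra gx => fx; apply/eqP.
  by rewrite /g max_r// subr_le0 ltW.
have Kx : K x.
  split => //=; rewrite subr0 leNgt; apply/negP => /ltW /fr fx0.
  by move: fx; rewrite fx0 leNgt eps0.
have [n nk hn] := hk x Kx.
rewrite big_mkord (bigD1 (Ordinal nk))//= {1}/w clamp_eq1 ?mul1r.
  by rewrite lerDl sumr_ge0// => i _; rewrite mulr_ge0 ?clamp_ge0.
by rewrite -ler_pdivrMr// mul1r.
Unshelve. all: by end_near. Qed.

Lemma riesz_outer_sigma_subadditive : sigma_subadditive riesz_outer.
Proof.
move=> A.
have [[n An]|/forallNP Afin] := pselect (exists n, riesz_outer (A n) = +oo%E).
  rewrite (nneseries_pinfty _ _ An) ?leey// => k _; exact: riesz_outer_ge0.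
apply/lee_addgt0Pr => e e0.
have /choice[U hU] : forall n, exists U, [/\ open U, A n `<=` U &
    (open_content U <= riesz_outer (A n) + (e / (2 ^ n.+1)%:R)%:E)%E].
  move=> n.
  have en : 0 < e / (2 ^ n.+1)%:R by rewrite divr_gt0// ltr0n expn_gt0.
  have [|_ [U [oU AU] <-] hU] := @lb_ereal_inf_adherent R
    [set open_content U | U in [set U | open U /\ A n `<=` U]] _ en.
    by rewrite ge0_fin_numE ?ltey; [exact/eqP/Afin|exact: riesz_outer_ge0].
  by exists U; split=> //; exact: ltW.
apply: le_trans (epsilon_trick xpredT _ (ltW e0)); last by move=> n; exact: riesz_outer_ge0.
apply: (@le_trans _ _ (open_content (\bigcup_n U n))).
  rewrite -riesz_outer_open; last by apply: bigcup_open => n _; have [] := hU n.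
  apply: riesz_outer_mono; apply: subset_bigcup => n _; by have [] := hU n.
apply: (le_trans (open_content_bigcup _)); first by move=> n; have [] := hU n.
apply: lee_nneseries => [n _ _|n _]; first exact: open_content_ge0.
by have [] := hU n.
Qed.

(** Inside an open [V] containing the test set, an almost optimal [f] for [V] and [U] is trimmed to
    [g]. The open set [W] where [f < eps] contains [V] minus [U] and misses the support of [g], so
    [g] plus any function dominated by [W] is dominated by [V]. *)
Lemma riesz_caratheodory (m : {outer_measure set E -> \bar R}) (U : set E) :
  (m : set E -> \bar R) = riesz_outer -> open U -> m.-caratheodory U.
Proof.
move=> mE oU; apply: le_caratheodory_measurable => X; rewrite mE.
apply: le_ereal_inf_tmp => _ [V [oV XV] <-].
apply: (@le_trans _ _ (riesz_outer (V `&` U) + riesz_outer (V `&` ~` U))%E).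
  by apply: leeD; apply: riesz_outer_mono; exact: setSI.
rewrite riesz_outer_open; last exact: openI.
apply/lee_addgt0Pr => e e0.
have [Vy|Vfin] := eqVneq (open_content V) +oo%E.
  by rewrite Vy addye ?leey// ltNye_eq.
have VUfin : open_content (V `&` U) \is a fin_num.
  rewrite ge0_fin_numE ?open_content_ge0//.
  by apply: (le_lt_trans (open_content_mono (@subIsetl _ V U))); rewrite ltey.
have e2 : 0 < e / 2 by rewrite divr_gt0.
have [_ [f Uf <-] hf] := ub_ereal_sup_adherent e2 VUfin.
have [eps eps0 [Ug fg]] := dominated_trim Uf e2.
set g := fun x => Num.max _ _ in Ug fg.
have [Cf f01 f0] := Uf; have [Cg g01 g0] := Ug.
pose W := V `&` [set x | f x < eps].
have oW : open W.
  apply: openI => //; rewrite (_ : [set x | _] = f @^-1` [set t | t < eps])//.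
  by apply: (@open_comp E R) => [x _|]; [exact: Cf.1|exact: open_lt].
have VW : (riesz_outer (V `&` ~` U) <= open_content W)%E.
  rewrite -riesz_outer_open//; apply: riesz_outer_mono => x [Vx Ux]; split => //=.
  by rewrite f0// => -[].
have gW : ((L g)%:E + open_content W <= open_content V)%E.
  rewrite -leeBrDl//; apply: ge_ereal_sup => _ [w [Cw w01 w0] <-].
  rewrite leeBrDl// -EFinD -(pf_add hL)//; apply: dominated_le; split.
  - exact: Cc_add.
  - move=> x; have /andP[wx0 wx1] := w01 x; have /andP[gx0 gx1] := g01 x.
    rewrite addr_ge0//=; have [fx|fx] := ltP (f x) eps.
      by rewrite /g max_r ?add0r// subr_le0 ltW.
    by rewrite w0 ?addr0// => -[_ /=]; rewrite ltNge fx.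
  - by move=> x Vx; rewrite g0 ?w0 ?addr0// => -[].
apply: (@le_trans _ _ ((L g)%:E + e%:E + open_content W)%E); last first.
  by rewrite addeAC leeD2r.
apply: leeD => //; rewrite leNgt; apply/negP => h.
move: hf; rewrite lteBlDr// => /(lt_trans h); rewrite -!EFinD lte_fin => h2.
by move: fg; lra.
Qed.

Lemma riesz_bounds (f : E -> R) r : 0 < r -> (forall x, r <= enorm x -> f x = 0) ->
  (open_content [set x | (0 < f x)%R] < +oo)%E.
Proof.
move=> r0 fr; have Cb := bump_Cc (0 : E) r0.
apply: (@le_lt_trans _ _ (L (bump 0 r))%:E); last exact: ltry.
apply: ge_ereal_sup => _ [g [Cg g01 g0] <-]; rewrite lee_fin; apply: pf_mono => // x.
have /andP[gx0 gx1] := g01 x.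
have [xr|/ltW xr] := leP (enorm x) r; first by rewrite bump_eq1// subr0.
by rewrite g0 ?bump_ge0//= fr// ltxx.
Qed.

End positive.

(* Comparison of two functionals through the layers [f - j eps]. *)
Lemma layer_compare (I1 I2 : (E -> R) -> R) (f : E -> R) (m : R -> R) (eps : R) :
  positive_functional I1 -> positive_functional I2 ->
  Cc f -> (forall x, 0 <= f x) -> 0 < eps -> (forall t, 0 <= m t) ->
  (forall t g, 0 <= t -> Cc g -> (forall x, 0 <= g x <= eps) ->
     (forall x, f x <= t -> g x = 0) -> I1 g <= eps * m t) ->
  (forall t g, 0 <= t -> Cc g -> (forall x, 0 <= g x <= eps) ->
     (forall x, t <= f x -> g x = eps) -> eps * m t <= I2 g) ->
  I1 f <= I2 f + eps * m 0.
Proof.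
move=> h1 h2 Cf f0 e0 m0 hI1 hI2.
pose p j x := Num.max (f x - j%:R * eps) 0.
have Cp j : Cc (p j) by apply: Cc_trunc => //; rewrite mulr_ge0// ltW.
have [M M0 fM] := Cc_bounded Cf.
have p0 j x : 0 <= p j x by rewrite /p le_max lexx orbT.
pose q j x := p j x - p j.+1 x.
have Cq j : Cc (q j) by exact: Cc_sub.
have q01 j x : 0 <= q j x <= eps.
  rewrite /q /p -natr1 mulrDl mul1r; have := f0 x; have := mulr_ge0 (ler0n R j) (ltW e0).
  move: (j%:R * eps) => a a0 fx.
  by case: (leP (f x - a) 0) => h; case: (leP (f x - (a + eps)) 0) => h'; lra.
have q0 j x : f x <= j%:R * eps -> q j x = 0.
  rewrite /q /p -natr1 mulrDl mul1r; move: (j%:R * eps) => a fa.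
  by rewrite !max_r ?subr0//; lra.
have q1 j x : j.+1%:R * eps <= f x -> q j x = eps.
  rewrite /q /p -natr1 mulrDl mul1r; move: (j%:R * eps) => a fa.
  by rewrite !max_l; lra.
have pS j : p j = fun x => q j x + p j.+1 x by apply/funext => x; rewrite /q subrK.
(* Layer [j] of [I1] costs at most [eps * m (j eps)], while layer [j] of [I2] yields at least
   [eps * m ((j + 1) eps)]. The shift by one telescopes and leaves a single term. *)
have key j n : M <= (n + j)%:R * eps -> I1 (p j) <= I2 (p j) + eps * m (j%:R * eps).
  elim: n j => [|n IH] j.
    rewrite add0n => Mj.
    have -> : p j = fun=> 0.
      apply/funext => x; rewrite /p max_r// subr_le0 (le_trans _ Mj)//.
      exact: le_trans (ler_norm _) (fM x).
    by rewrite (pf0 h1) (pf0 h2) add0r mulr_ge0// ltW.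
  rewrite addSnnS => /IH h.
  rewrite pS (pf_add h1)// (pf_add h2)//.
  have a1 := hI1 (j%:R * eps) (q j) (mulr_ge0 (ler0n R j) (ltW e0)) (Cq j) (q01 j) (q0 j).
  have a2 := hI2 (j.+1%:R * eps) (q j) (mulr_ge0 (ler0n R j.+1) (ltW e0)) (Cq j) (q01 j) (q1 j).
  lra.
have -> : f = p 0%N by apply/funext => x; rewrite /p mul0r subr0 max_l.
have := key 0%N (Num.bound (M / eps)); rewrite mul0r; apply.
rewrite addn0 -ler_pdivrMr// ltW//; apply: archi_boundP.
by rewrite divr_ge0// ltW.
Qed.

End riesz.

Section riesz_measure.
Variables (R : realType) (d : nat).
Local Notation E := 'rV[R]_d.
Local Notation B := (borelE R d).

Lemma integrable_indic_lty (mu : {measure set B -> \bar R}) (A : set B) :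
  measurable A -> (mu A < +oo)%E -> mu.-integrable setT (EFin \o (\1_A : B -> R)).
Proof.
move=> mA Afin; apply/integrableP; split.
  by apply/measurable_EFinP; exact: measurable_indic.
under eq_integral do rewrite /= ger0_norm//.
by rewrite integral_indic// setIT.
Qed.

Lemma integrable_bounded (mu : {measure set B -> \bar R}) (F : B -> R) (A : set B) (M : R) :
  measurable A -> (mu A < +oo)%E -> measurable_fun setT F -> (forall x, `|F x| <= M) ->
  (forall x, ~ A x -> F x = 0) -> mu.-integrable setT (EFin \o F).
Proof.
move=> mA Afin mF FM F0.
apply: (@le_integrable _ _ _ mu setT measurableT (EFin \o F) (fun x => M%:E * (\1_A x)%:E)%E).
- exact/measurable_EFinP.
- move=> x _ /=; rewrite lee_fin indicE; case: (boolP (x \in A)) => [_|/negP xA].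
    by rewrite mulr1 (le_trans (FM x))// ler_norm.
  by rewrite F0 ?mulr0 ?normr0// => Ax; apply: xA; rewrite inE.
- by apply: integrableZl => //; exact: integrable_indic_lty.
Qed.

Lemma integrable_Cc (mu : {measure set B -> \bar R}) (f : E -> R) :
  (forall r, mu (eball 0 r) < +oo)%E -> Cc f -> mu.-integrable setT (EFin \o (f : B -> R)).
Proof.
move=> mufin Cf; have [r _ fr] := Cc_bounded_support Cf; have [M _ fM] := Cc_bounded Cf.
apply: (@integrable_bounded mu f (eball 0 r) M) => //.
- exact: measurable_eball.
- exact: continuous_measurable Cf.1.
- by move=> x /negP; rewrite /eball/= subr0 -leNgt => /fr.
Qed.

Lemma Rintegral_positive (mu : {measure set B -> \bar R}) :
  (forall r, mu (eball 0 r) < +oo)%E ->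
  positive_functional (fun f : E -> R => \int[mu]_x (f : B -> R) x).
Proof.
move=> mufin; split.
- by move=> f Cf f0; exact: Rintegral_ge0.
- by move=> f g Cf Cg; rewrite RintegralD//; exact: integrable_Cc.
- by move=> a f Cf; rewrite RintegralZl//; exact: integrable_Cc.
Qed.

Lemma layer_integral_le (mu : {measure set B -> \bar R}) (U : set E) (g : E -> R) (e : R) :
  (forall r, mu (eball 0 r) < +oo)%E -> open U -> (mu U < +oo)%E -> Cc g ->
  ((forall x, 0 <= g x <= e) -> (forall x, ~ U x -> g x = 0) ->
     \int[mu]_x (g : B -> R) x <= e * fine (mu U)) /\
  ((forall x, 0 <= g x) -> (forall x, U x -> g x = e) ->
     e * fine (mu U) <= \int[mu]_x (g : B -> R) x).
Proof.
move=> mufin oU Ufin Cg.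
have mU : measurable (U : set B) by exact: measurable_open.
have ig := integrable_Cc mufin Cg.
have iU : mu.-integrable setT (EFin \o (\1_U : B -> R)) by exact: integrable_indic_lty.
have iZ : mu.-integrable setT (EFin \o (fun x : B => e * \1_U x)).
  exact: (@integrableZl _ _ _ mu setT measurableT e _ iU).
have hU : \int[mu]_x (e * \1_U x) = e * fine (mu U).
  by rewrite RintegralZl// /Rintegral integral_indic// setIT.
split=> [ge g0|g0 ge]; rewrite -hU; apply: le_Rintegral => // x _; rewrite indicE.
  case: (boolP (x \in U)) => [_|/negP xU]; first by rewrite mulr1; case/andP: (ge x).
  by rewrite mulr0 g0// => Ux; apply: xU; rewrite inE.
case: (boolP (x \in U)) => [/set_mem /ge ->|_]; first by rewrite mulr1.
by rewrite mulr0.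
Qed.

(** For [f >= 0], [L] and the integral against [nu] both satisfy the layer bounds with [mm t], the
    measure of the set where [f > t]. [layer_compare] in both directions then gives equality up to
    [e * mm 0], with [e] arbitrary. *)
Theorem riesz_representation (L : (E -> R) -> R) : positive_functional L ->
  exists nu : {measure set B -> \bar R},
    (forall U : set E, open U -> nu U = open_content L U) /\
    forall f : E -> R, Cc f -> \int[nu]_x (f : B -> R) x = L f.
Proof.
move=> hL.
pose m : {outer_measure set E -> \bar R} := HB.pack (riesz_outer L)
  (@isOuterMeasure.Build R E (riesz_outer L) (riesz_outer0 hL) (riesz_outer_ge0 hL)
    (@riesz_outer_mono R d L) (riesz_outer_sigma_subadditive hL)).
have mB (A : set B) : measurable A -> m.-caratheodory A.
  apply: smallest_sub.
    exact: (@sigma_algebra_measurable _ (caratheodory_type m)).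
  by move=> U oU; exact: (riesz_caratheodory hL).
have sa : semi_sigma_additive (riesz_outer L : set B -> \bar R).
  move=> F mF tF mUF; apply: (@caratheodory_measure_sigma_additive R E m F) => //.
    by move=> i; exact: mB.
  exact: mB.
pose nu : {measure set B -> \bar R} := HB.pack (riesz_outer L : set B -> \bar R)
  (@isMeasure.Build _ B R (riesz_outer L) (riesz_outer0 hL) (riesz_outer_ge0 hL) sa).
exists nu.
have nuE (U : set E) : open U -> nu U = open_content L U by exact: riesz_outer_open.
split=> //.
have nufin r : (nu (eball 0 r) < +oo)%E.
  have r0 : 0 < `|r| + 1 by rewrite ltr_wpDl.
  apply: le_lt_trans (riesz_bounds hL (mulr_gt0 (@ltr0n R 2) r0)
    (f := bump 0 (`|r| + 1)) _); last first.
    by move=> x xr; apply: bump_eq0 => //; rewrite subr0.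
  rewrite nuE; last exact: open_eball.
  apply: open_content_mono => x; rewrite /eball/= => xr.
  by rewrite bump_eq1// ltW// (lt_le_trans xr)// (le_trans (ler_norm r))// lerDl.
have hI := Rintegral_positive nufin.
have pos f : Cc f -> (forall x, 0 <= f x) -> \int[nu]_x (f : B -> R) x = L f.
  move=> Cf f0.
  have oU t : open [set x | t < f x].
    rewrite (_ : [set x | _] = f @^-1` [set u | t < u])//.
    by apply: (@open_comp E R) => [x _|]; [exact: Cf.1|exact: open_gt].
  have Ufin t : 0 <= t -> (nu [set x | (t < f x)%R] < +oo)%E.
    move=> t0; have [r r0 fr] := Cc_bounded_support Cf.
    apply: le_lt_trans (riesz_bounds hL r0 fr); rewrite nuE//.
    by apply: open_content_mono => x /=; exact: le_lt_trans.
  pose mm t := fine (nu [set x | t < f x]).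
  have mm0 t : 0 <= mm t by exact: fine_ge0.
  have hL1 t g e : 0 < e -> 0 <= t -> Cc g -> (forall x, 0 <= g x <= e) ->
      (forall x, f x <= t -> g x = 0) -> L g <= e * mm t.
    move=> e0 t0 Cg ge g0.
    have : ((L (fun x => e^-1 * g x))%:E <= nu [set x | (t < f x)%R])%E.
      rewrite nuE//; apply: dominated_le; split; first exact: Cc_scale.
        move=> x; have /andP[gx0 gx1] := ge x.
        by rewrite mulr_ge0 ?invr_ge0 ?(ltW e0)//= ler_pdivrMl// mulr1.
      by move=> x /= /negP; rewrite -leNgt => /g0 ->; rewrite mulr0.
    rewrite (pf_scale hL)// -[X in (_ <= X)%E]fineK ?ge0_fin_numE ?Ufin//.
    by rewrite lee_fin ler_pdivrMl.
  have hL2 t g e : 0 < e -> 0 <= t -> Cc g -> (forall x, 0 <= g x <= e) ->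
      (forall x, t <= f x -> g x = e) -> e * mm t <= L g.
    move=> e0 t0 Cg ge g0.
    rewrite -ler_pdivlMl// -lee_fin fineK ?ge0_fin_numE ?Ufin// nuE//.
    apply: ge_ereal_sup => _ [w [Cw w01 w0] <-]; rewrite lee_fin ler_pdivlMl// -(pf_scale hL)//.
    apply: (pf_mono hL) => //; first exact: Cc_scale.
    move=> x; have /andP[gx0 gx1] := ge x; have /andP[wx0 wx1] := w01 x.
    have [/ltW fx|fx] := ltP t (f x); first by rewrite (g0 _ fx) ger_pMr.
    by rewrite w0 ?mulr0// => /=; rewrite ltNge fx.
  have hI1 t g e : 0 < e -> 0 <= t -> Cc g -> (forall x, 0 <= g x <= e) ->
      (forall x, f x <= t -> g x = 0) -> \int[nu]_x (g : B -> R) x <= e * mm t.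
    move=> e0 t0 Cg ge g0; apply: (layer_integral_le e nufin (oU t) (Ufin t t0) Cg).1 => //.
    by move=> x /= /negP; rewrite -leNgt => /g0.
  have hI2 t g e : 0 < e -> 0 <= t -> Cc g -> (forall x, 0 <= g x <= e) ->
      (forall x, t <= f x -> g x = e) -> e * mm t <= \int[nu]_x (g : B -> R) x.
    move=> e0 t0 Cg ge g0; apply: (layer_integral_le e nufin (oU t) (Ufin t t0) Cg).2 => //.
      by move=> x; case/andP: (ge x).
    by move=> x /= /ltW /g0.
  have split_eps a : 0 < a -> exists2 e, 0 < e & e * mm 0 <= a.
    move=> a0; exists (a / (mm 0 + 1)); first by rewrite divr_gt0// ltr_wpDl.
    by rewrite mulrAC ler_pdivrMr ?ltr_wpDl// ler_pM2l// lerDl.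
  apply/eqP; rewrite eq_le; apply/andP; split; apply/ler_addgt0Pr => a a0;
    have [e e0 ea] := split_eps a a0.
    apply: le_trans (layer_compare hI hL Cf f0 e0 mm0 _ _) _ => //.
    - by move=> t g t0; exact: hI1.
    - by move=> t g t0; exact: hL2.
    - by rewrite lerD2l.
  apply: le_trans (layer_compare hL hI Cf f0 e0 mm0 _ _) _ => //.
  - by move=> t g t0; exact: hL1.
  - by move=> t g t0; exact: hI2.
  - by rewrite lerD2l.
move=> f Cf.
have fE : f = fun x => Num.max (f x - 0) 0 - Num.max (- f x - 0) 0.
  by apply/funext => x; rewrite !subr0; case: (leP (f x) 0) => fx;
    [rewrite max_l ?oppr_ge0// sub0r opprK|rewrite max_r ?subr0// oppr_le0 ltW].
have C1 : Cc (fun x => Num.max (f x - 0) 0) by exact: Cc_trunc.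
have C2 : Cc (fun x => Num.max (- f x - 0) 0) by apply: Cc_trunc => //; exact: Cc_opp.
have p1 x : 0 <= Num.max (f x - 0) 0 by rewrite le_max lexx orbT.
have p2 x : 0 <= Num.max (- f x - 0) 0 by rewrite le_max lexx orbT.
by rewrite fE (pf_sub hI)// (pf_sub hL)// !pos.
Qed.

End riesz_measure.

(** * Weak limits *)

Section ultralimit.
Variables (R : realType) (U : set_system nat) (UU : UltraFilter U).

Lemma ultra_image_filter (T : Type) (u : nat -> T) : UltraFilter (u @ U).
Proof.
split; first exact: fmap_proper_filter.
move=> G PG sUG; apply/seteqP; split=> // A GA.
have [//|UA] := in_ultra_setVsetC (u @^-1` A) UU.
have GCA : G (~` A) by apply: sUG; rewrite /= /nbhs/= preimage_setC.
by have /filter_ex[? []] : G (A `&` ~` A) by exact: filterI.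
Qed.

Lemma ultra_cvg (u : nat -> R) (M : R) : (forall k, `|u k| <= M) ->
  exists l : R, u @ U --> l.
Proof.
move=> uM; have := @segment_compact R (- M) M.
rewrite compact_ultra => /(_ (u @ U) (ultra_image_filter u)) [].
  have : U (u @^-1` `[- M, M]%classic).
    by apply: filterS filterT => k _ /=; rewrite in_itv/= -ler_norml.
  by [].
by move=> l [_ lu]; exists l.
Qed.

End ultralimit.

Section potential.
Variables (R : realType) (d s : nat).
Local Notation E := 'rV[R]_d.
Local Notation B := (borelE R d).

(** The kernel is taken at [x - y] with [x] integrated, so for an odd kernel this is the negative of
    [T (f mu)] at [y]. *)
Definition potential (k f : E -> R) (mu : {measure set B -> \bar R}) (y : E) : R :=
  \int[mu]_x (k ((x : E) - y) * f x).

Lemma translate_continuous (k : E -> R) y : continuous k -> continuous (fun x : E => k (x - y)).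
Proof.
move=> ck x; apply: (@continuous_comp E E R (fun x => x - y) k); last exact: ck.
by apply: cvgB; [exact: cvg_id|exact: cvg_cst].
Qed.

(** The radius [t] is chosen before the measure, which enters only through its growth constant [L].
    This uniformity lets double integrals pass to a weak limit. *)
Lemma potential_equicontinuous (L : R) (k f : E -> R) (y : E) (e : R) :
  0 <= L -> continuous k -> Cc f -> 0 < e -> exists2 t : R, 0 < t &
    forall (mu : {sigma_finite_measure set B -> \bar R}) y', nice s L mu ->
      enorm (y' - y) < t -> `|potential k f mu y' - potential k f mu y| <= e.
Proof.
move=> L0 ck Cf e0.
have [r r0 fr] := Cc_bounded_support Cf; have [M M0 fM] := Cc_bounded Cf.
pose c := M * (L * r ^+ s) + 1.
have c0 : 0 < c by rewrite ltr_wpDl// !mulr_ge0 ?exprn_ge0// ltW.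
pose e' := e / c; have e'0 : 0 < e' by rewrite divr_gt0.
have : nbhs y [set y' | [set x : E | enorm (x - 0) <= r] `<=`
    [set x | `|k (x - y') - k (x - y)| <= e']].
  apply: (@compact_near _ _ _ _ _ (fun y' x => `|k (x - y') - k (x - y)| <= e')).
    exact: compact_cball.
  move=> x _.
  have [t t0 ht] : exists2 t : R, 0 < t & eball (x - y) t `<=` [set z | `|k (x - y) - k z| < e' / 2].
    by apply/nbhs_eballP; have /cvgrPdist_lt := ck (x - y); apply; rewrite divr_gt0.
  exists (t / 2); first by rewrite divr_gt0.
  apply/nbhs_eballP; exists (t / 2); first by rewrite divr_gt0.
  move=> y' y'y x' x'x.
  have h1 : `|k (x - y) - k (x' - y')| < e' / 2.
    apply: ht; rewrite /eball/=.
    rewrite (_ : x' - y' - (x - y) = (x' - x) + (y - y')); last first.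
      by rewrite !opprD !opprK addrACA (addrC y) addrACA.
    apply: (le_lt_trans (enormD _ _)); rewrite [ltRHS]splitr ltrD// enormB; exact: y'y.
  have h2 : `|k (x - y) - k (x' - y)| < e' / 2.
    apply: ht; rewrite /eball/=.
    rewrite (_ : x' - y - (x - y) = x' - x); last by rewrite opprB addrA subrK.
    by apply: (lt_trans x'x); rewrite ltr_pdivrMr// ltr_pMr// ltr1n.
  rewrite (_ : _ - _ = (k (x - y) - k (x' - y)) - (k (x - y) - k (x' - y'))); last by ring.
  by apply: (le_trans (ler_normB _ _)); lra.
move=> /nbhs_eballP[t t0 ht]; exists t => // mu y' nmu y'y.
have Ck z : Cc (fun x : E => k (x - z) * f x).
  by apply: Cc_mull => //; exact: translate_continuous.
have mufin q : (mu (eball 0 q) < +oo)%E by exact: nice_eball_lty nmu.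
rewrite /potential -RintegralB//; [|exact: (integrable_Cc mufin (Ck y'))|exact: (integrable_Cc mufin (Ck y))].
apply: (@le_trans _ _ (e' * M * (L * r ^+ s))); last first.
  rewrite -mulrA /e' mulrAC ler_pdivrMr// ler_pM2l//.
  by rewrite /c lerDl.
have := @rint_bounded R d s L mu nmu
  (fun x => k ((x : E) - y') * f x - k ((x : E) - y) * f x) (e' * M) r.
case=> //; first by rewrite mulr_ge0// ltW.
- by apply: measurable_funB; apply: continuous_measurable; case: (Ck y'); case: (Ck y).
- move=> x; have [xr|/ltW xr] := leP (enorm x) r; last first.
    by rewrite fr// !mulr0 subr0 normr0 mulr_ge0// ltW.
  rewrite -mulrBl normrM; apply: ler_pM => //.
  by apply: (ht y' y'y x); rewrite /= subr0.
- by move=> x xr; rewrite fr// !mulr0 subr0.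
Qed.

Lemma potential_continuous (L : R) (k f : E -> R) (mu : {sigma_finite_measure set B -> \bar R}) :
  0 <= L -> nice s L mu -> continuous k -> Cc f -> continuous (potential k f mu).
Proof.
move=> L0 nmu ck Cf y; apply/cvgrPdist_le => e e0.
have [t t0 ht] := @potential_equicontinuous L k f y _ L0 ck Cf e0.
by apply/nbhs_eballP; exists t => // z zy; rewrite distrC; exact: ht.
Qed.

End potential.

Section weak_limit.
Variables (R : realType) (d s : nat).
Local Notation E := 'rV[R]_d.
Local Notation B := (borelE R d).
Variables (L : R) (L0 : 0 <= L) (U : set_system nat) (UU : UltraFilter U).
Variable mus : nat -> {sigma_finite_measure set B -> \bar R}.
Hypothesis nmus : forall k, nice s L (mus k).

Lemma Rintegral_Cc_bound (mu : {sigma_finite_measure set B -> \bar R}) (f : E -> R) M r :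
  nice s L mu -> Cc f -> 0 <= M -> 0 < r -> (forall x, `|f x| <= M) ->
  (forall x, r <= enorm x -> f x = 0) ->
  `|\int[mu]_x (f : B -> R) x| <= M * (L * r ^+ s).
Proof.
move=> nmu Cf M0 r0 fM fr.
have [] // := @rint_bounded R d s L mu nmu (f : B -> R) M r.
by apply: continuous_measurable; exact: Cf.1.
Qed.

(** The integrals of a fixed test function are bounded, hence converge along the ultrafilter, and
    the limits form a positive functional. The constant [L] is kept because the measure of an open
    ball is a supremum over functions below its indicator. *)
Lemma weak_limit_exists : exists nu : {sigma_finite_measure set B -> \bar R},
  nice s L nu /\ forall f : E -> R, Cc f ->
    (fun k => \int[mus k]_x (f : B -> R) x) @ U --> \int[nu]_x (f : B -> R) x.
Proof.
pose I f k := \int[mus k]_x (f : B -> R) x.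
have Ilim f : Cc f -> I f @ U --> lim (I f @ U).
  move=> Cf; have [r r0 fr] := Cc_bounded_support Cf; have [M M0 fM] := Cc_bounded Cf.
  have [l ul] := @ultra_cvg R U UU (I f) (M * (L * r ^+ s))
    (fun k => Rintegral_Cc_bound (nmus k) Cf (ltW M0) r0 fM fr).
  by apply/cvg_ex; exists l.
have hI k := Rintegral_positive (fun r => @nice_eball_lty R d s L (mus k) 0 r (nmus k)).
have hL : positive_functional (fun f => lim (I f @ U)).
  split.
  - move=> f Cf f0; apply: (cvgr_to_ge (Ilim f Cf)).
    by apply: nearW => k; exact: (pf_ge0 (hI k)).
  - move=> f g Cf Cg; apply/cvg_lim => //.
    have -> : I (fun x => f x + g x) = fun k => I f k + I g k.
      by apply/funext => k; exact: (pf_add (hI k)).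
    by apply: cvgD; exact: Ilim.
  - move=> a f Cf; apply/cvg_lim => //.
    have -> : I (fun x => a * f x) = fun k => a * I f k.
      by apply/funext => k; exact: (pf_scale (hI k)).
    by apply: cvgM; [exact: cvg_cst|exact: Ilim].
have [nu [nuU nuI]] := riesz_representation hL.
have nnu : nice s L nu.
  move=> x r r0; rewrite nuU; last exact: open_eball.
  apply: ge_ereal_sup => _ [f [Cf f01 f0] <-]; rewrite lee_fin.
  apply: (cvgr_to_le (Ilim f Cf)); apply: nearW => k.
  have mufin := fun q => @nice_eball_lty R d s L (mus k) 0 q (nmus k).
  have [h _] := layer_integral_le 1 mufin (@open_eball R d x r) (@nice_eball_lty R d s L (mus k) x r (nmus k)) Cf.
  apply: (le_trans (h f01 f0)); rewrite mul1r -lee_fin fineK.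
    exact: nmus.
  by rewrite ge0_fin_numE//; exact: nice_eball_lty (nmus k).
have [nu' E'] := nice_sigma_finite_measure nnu.
exists nu'; rewrite -E'; split=> // f Cf; rewrite nuI//; exact: Ilim.
Qed.

(** Weak convergence against [k (x - y) * f x] gives pointwise convergence of the potentials, and
    equicontinuity makes it uniform on the support of [g]; it remains to integrate the fixed
    function [g * potential k f nu]. *)
Lemma weak_limit_double (nu : {sigma_finite_measure set B -> \bar R}) (k f g : E -> R) :
  nice s L nu ->
  (forall f : E -> R, Cc f ->
    (fun i => \int[mus i]_x (f : B -> R) x) @ U --> \int[nu]_x (f : B -> R) x) ->
  continuous k -> Cc f -> Cc g ->
  (fun i => \int[mus i]_y (g y * potential k f (mus i) y)) @ U -->
    \int[nu]_y (g y * potential k f nu y).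
Proof.
move=> nnu wlim ck Cf Cg.
have [r r0 gr] := Cc_bounded_support Cg; have [M M0 gM] := Cc_bounded Cg.
have cV := potential_continuous L0 nnu ck Cf.
have CgV : Cc (fun y => g y * potential k f nu y).
  by have := Cc_mull cV Cg; under eq_fun do rewrite mulrC.
apply/cvgrPdist_le => e e0.
pose c := M * (L * r ^+ s) + 1.
have c0 : 0 < c by rewrite ltr_wpDl// !mulr_ge0 ?exprn_ge0// ltW.
pose e' := e / 2 / c; have e'0 : 0 < e' by rewrite !divr_gt0.
have unif : U [set i | [set y : E | enorm (y - 0) <= r] `<=`
    [set y | `|potential k f (mus i) y - potential k f nu y| <= e']].
  apply: (@compact_near _ _ _ _ _ (fun i y => `|potential k f (mus i) y - potential k f nu y| <= e')).
    exact: compact_cball.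
  move=> y _; have e3 : 0 < e' / 3 by rewrite divr_gt0.
  have [t t0 ht] := @potential_equicontinuous R d s L k f y _ L0 ck Cf e3.
  exists t => //.
  have Cky : Cc (fun x : E => k (x - y) * f x).
    by apply: Cc_mull => //; exact: translate_continuous.
  have /cvgrPdist_le /(_ _ e3) := wlim _ Cky.
  apply: filterS => i hi y' y'y.
  have h1 := ht (mus i) y' (nmus i) y'y.
  have h2 := ht nu y' nnu y'y.
  rewrite /= -!/(potential k f _ y) in hi.
  rewrite (_ : _ - _ = (potential k f (mus i) y' - potential k f (mus i) y)
    - (potential k f nu y - potential k f (mus i) y)
    - (potential k f nu y' - potential k f nu y)); last by ring.
  rewrite (le_trans (ler_normB _ _))// (le_trans (lerD (ler_normB _ _) (lexx _)))//.
  by rewrite -[leRHS](mulfVK (_ : (3 : R) != 0))//; lra.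
have e20 : 0 < e / 2 by rewrite divr_gt0.
have /cvgrPdist_le /(_ _ e20) := wlim _ CgV.
apply: filterS2 unif => i hu hi.
have cVi := potential_continuous L0 (nmus i) ck Cf.
have CgVi : Cc (fun y => g y * potential k f (mus i) y).
  by have := Cc_mull cVi Cg; under eq_fun do rewrite mulrC.
have diff : `|\int[mus i]_y (g y * potential k f (mus i) y) - \int[mus i]_y (g y * potential k f nu y)| <= e / 2.
  have mufin := fun q => @nice_eball_lty R d s L (mus i) 0 q (nmus i).
  rewrite -(pf_sub (Rintegral_positive mufin))//.
  apply: (@le_trans _ _ (M * e' * (L * r ^+ s))); last first.
    rewrite [M * e']mulrC -mulrA /e' mulrAC ler_pdivrMr// ler_pM2l//.
    by rewrite /c lerDl.
  apply: Rintegral_Cc_bound => //.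
  - exact: Cc_sub.
  - by rewrite mulr_ge0// ltW.
  - move=> y; rewrite -mulrBr normrM.
    have [yr|/ltW yr] := leP (enorm y) r; last by rewrite gr// normr0 mul0r mulr_ge0// ltW.
    by apply: ler_pM => //; apply: (hu y); rewrite /= subr0.
  - by move=> y yr; rewrite gr// !mul0r subr0.
rewrite (_ : _ - _ = (\int[nu]_y (g y * potential k f nu y) - \int[mus i]_y (g y * potential k f nu y))
   - (\int[mus i]_y (g y * potential k f (mus i) y) - \int[mus i]_y (g y * potential k f nu y))); last by ring.
by rewrite (le_trans (ler_normB _ _))// [leRHS]splitr lerD.
Qed.

End weak_limit.

(** * Pairings with the singular kernel *)

Section singular_pairing.
Variables (R : realType) (d s : nat) (alpha C : R) (h : 'rV[R]_d -> R).
Local Notation E := 'rV[R]_d.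
Local Notation B := (borelE R d).
Hypotheses (s0 : (0 < s)%N) (a01 : 0 < alpha <= 1) (C0 : 0 <= C)
  (hh : numerator alpha C h).
Variables (L : R) (mu : {sigma_finite_measure set B -> \bar R}).
Hypotheses (L0 : 0 <= L) (nmu : nice s L mu).
Local Notation P := (mu \x mu)%E.
Local Notation k := (kreg s alpha h).

Let a0 : 0 < alpha. Proof. by case/andP: a01. Qed.

(** One parameter bounds size, Lipschitz constant and support radius, so that the tests at unit
    scale are indexed by a single integer. *)
Definition lip_bump (b : R) (f : E -> R) :=
  [/\ forall x, `|f x| <= b, forall x y, `|f x - f y| <= b * enorm (x - y) &
      forall x, b <= enorm x -> f x = 0].

Definition lip_bounded (b r : R) (f : E -> R) :=
  [/\ forall x, `|f x| <= b, forall x y, `|f x - f y| <= b * enorm (x - y) &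
      forall x, r <= enorm x -> f x = 0].

Lemma lip_bounded_Cc b r f : lip_bounded b r f -> Cc f.
Proof.
by move=> [_ fl f0]; split; [exact: lipschitz_continuous fl|exists r].
Qed.

Lemma lip_bounded_ge0 b r f : lip_bounded b r f -> 0 <= b.
Proof. by move=> [fb _ _]; apply: le_trans (fb 0). Qed.

(** The negative of a real component of the integrand of [Tpair]: [f] sits on the first variable, in
    accordance with the sign of [potential]. *)
Definition sym_kernel (delta : R) (f phi : E -> R) (z : B * B) : R :=
  k delta ((z.1 : E) - z.2) * (f z.1 * phi z.2 - f z.2 * phi z.1) / 2.

Lemma measurable_sym_kernel delta f phi : 0 <= delta -> continuous f -> continuous phi ->
  measurable_fun setT (sym_kernel delta f phi).
Proof.
move=> d0 cf cp.
have mf := continuous_measurable cf; have mp := continuous_measurable cp.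
apply: measurable_funM; last exact: measurable_cst.
apply: measurable_funM; first exact: (measurable_diff (measurable_kreg s a01 hh d0)).
by apply: measurable_funB; apply: measurable_funM;
  do [exact: (measurableT_comp mf measurable_fst)|exact: (measurableT_comp mf measurable_snd)
     |exact: (measurableT_comp mp measurable_fst)|exact: (measurableT_comp mp measurable_snd)].
Qed.

Lemma antisym_le b b' r r' f phi x y : lip_bounded b r f -> lip_bounded b' r' phi ->
  `|f x * phi y - f y * phi x| <= 2 * b * b' * enorm (x - y).
Proof.
move=> hf hp; have b0 := lip_bounded_ge0 hf; have b'0 := lip_bounded_ge0 hp.
have [fb fl _] := hf; have [pb pl _] := hp.
rewrite (_ : _ - _ = (f x - f y) * phi y + f y * (phi y - phi x)); last by ring.
apply: (le_trans (ler_normD _ _)); rewrite !normrM.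
have h1 : `|f x - f y| * `|phi y| <= b * enorm (x - y) * b' by exact: ler_pM.
have h2 : `|f y| * `|phi y - phi x| <= b * (b' * enorm (x - y)).
  by apply: ler_pM => //; rewrite enormB.
by apply: (le_trans (lerD h1 h2)); rewrite le_eqVlt; apply/orP; left; apply/eqP; ring.
Qed.

Lemma integral_near_le (F : B * B -> R) (c e : R) (x : E) : 0 <= c -> 0 < e ->
  measurable_fun setT F ->
  (forall y, `|F (x, y)| <= c * near_fun s e ((y : E) - x)) ->
  (\int[mu]_y `|(F (x, y))%:E| <= (c * (L * 4 ^+ s * e))%:E)%E.
Proof.
move=> c0 e0 mF hF.
have mN : measurable_fun setT (fun y : B => near_fun s e ((y : E) - x)).
  exact: (measurableT_comp (measurable_near_fun s e) (measurable_shift x)).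
apply: (@le_trans _ _ (\int[mu]_y (c * near_fun s e ((y : E) - x))%:E)%E).
  apply: ge0_le_integral => //.
  - do 2 (apply: measurableT_comp => //).
    exact: (measurableT_comp mF (pair1_measurable (x : B))).
  - by apply/measurable_EFinP; apply: measurable_funM => //; exact: measurable_cst.
  - by move=> y _; rewrite lee_fin.
under eq_integral do rewrite EFinM.
rewrite ge0_integralZl//.
- by rewrite EFinM; apply: lee_wpmul2l; [rewrite lee_fin|exact: integral_near].
- exact/measurable_EFinP.
- by move=> y _; rewrite lee_fin near_fun_ge0.
Qed.

(** Antisymmetrization gains a factor [|x - y|], which lowers the singularity to [|x - y|^(1 - s)];
    this covers the singular kernel, [delta = 0]. The integrand vanishes unless both points have
    norm below [r]. *)
Lemma sym_kernel_integrable delta b b' r f phi : 0 <= delta -> 0 < r ->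
  lip_bounded b r f -> lip_bounded b' r phi ->
  P.-integrable setT (EFin \o sym_kernel delta f phi).
Proof.
move=> d0 r0 hf hp; have b0 := lip_bounded_ge0 hf; have b'0 := lip_bounded_ge0 hp.
have [cf _] := lip_bounded_Cc hf; have [cp _] := lip_bounded_Cc hp.
have [fb fl f0] := hf; have [pb pl p0] := hp.
have mS := measurable_sym_kernel d0 cf cp.
have r20 : 0 < 2 * r by rewrite mulr_gt0.
have bb : 0 <= b * b' by rewrite mulr_ge0.
have [] // := @prod_rint_le R d s L mu nmu (sym_kernel delta f phi)
  (b * b' * (L * 4 ^+ s * (2 * r))) r.
- by rewrite !mulr_ge0// ?exprn_ge0// ltW.
- by move=> x y xr; rewrite /sym_kernel/= (f0 x xr) (p0 x xr) mulr0 mul0r subr0 mulr0 mul0r.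
move=> x; apply: integral_near_le => // y.
have [xr|xr] := leP r (enorm x).
  by rewrite /sym_kernel/= (f0 x xr) (p0 x xr) mulr0 mul0r subr0 mulr0 mul0r normr0 mulr_ge0 ?near_fun_ge0.
have [yr|yr] := leP r (enorm y).
  by rewrite /sym_kernel/= (f0 y yr) (p0 y yr) mulr0 mul0r subr0 mulr0 mul0r normr0 mulr_ge0 ?near_fun_ge0.
rewrite /near_fun ifT; last by rewrite (le_lt_trans (enormD _ _))// enormN mulr_natl mulr2n ltrD.
rewrite /sym_kernel/=; move: (antisym_le x y hf hp) (kreg_near_size s0 a01 hh (x - y) d0).
rewrite [enorm (y - x)]enormB; move: (k delta (x - y)) (_ - f y * _) (enorm (x - y)) => u v e hv hu.
rewrite !normrM [X in _ * X]ger0_norm//.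
apply: (@le_trans _ _ (b * b' * (`|u| * e))); last by rewrite ler_wpM2l.
rewrite (_ : b * b' * _ = `|u| * (b * b' * e)); last by ring.
by rewrite -mulrA ler_wpM2l// ler_pdivrMr//; lra.
Qed.

(** The bound does not involve [r]: the difference lives on [|x - y| < eps <= 1] with one of the
    points in the support of [f], so [|x| < b + 1]. This matters because [phi] will be a bump whose
    radius tends to infinity. *)
Lemma sym_kernel_diff delta eps b b' r f phi : 0 <= delta -> delta <= eps -> 0 < eps ->
  eps <= 1 -> 0 < b -> b <= r -> lip_bump b f -> lip_bounded b' r phi ->
  `|\int[P]_z sym_kernel delta f phi z - \int[P]_z sym_kernel eps f phi z| <=
    2 * (b * b') * (L * 4 ^+ s * eps) * (L * (b + 1) ^+ s).
Proof.
move=> d0 de e0 e1 b0 br hf hp.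
have hfr : lip_bounded b r f.
  by have [fb fl f0] := hf; split=> // x xr; apply: f0; exact: le_trans xr.
have b'0 := lip_bounded_ge0 hp.
have [cf _] := lip_bounded_Cc hfr; have [cp _] := lip_bounded_Cc hp.
have [fb fl f0] := hf.
have r0 : 0 < r by exact: lt_le_trans br.
have bb : 0 <= 2 * (b * b') by rewrite !mulr_ge0// ltW.
have b10 : 0 < b + 1 by rewrite addr_gt0.
have i1 := sym_kernel_integrable d0 r0 hfr hp.
have i2 := sym_kernel_integrable (ltW e0) r0 hfr hp.
rewrite -RintegralB//.
have mF : measurable_fun setT (fun z => sym_kernel delta f phi z - sym_kernel eps f phi z).
  by apply: measurable_funB; apply: measurable_sym_kernel => //; exact: ltW.
have FE x y : sym_kernel delta f phi (x, y) - sym_kernel eps f phi (x, y) =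
    (k delta (x - y) - k eps (x - y)) * (f x * phi y - f y * phi x) / 2.
  by rewrite /sym_kernel/=; ring.
have near x y : `|sym_kernel delta f phi (x, y) - sym_kernel eps f phi (x, y)| <=
    2 * (b * b') * near_fun s eps (y - x).
  rewrite FE !normrM [X in _ * X]ger0_norm//.
  apply: (@le_trans _ _ (b * b' * (`|k delta (x - y) - k eps (x - y)| * enorm (x - y)))).
    rewrite -mulrA [leRHS]mulrCA; apply: ler_wpM2l => //.
    by rewrite ler_pdivrMr//; have := antisym_le x y hfr hp; lra.
  rewrite (_ : 2 * (b * b') * _ = b * b' * (2 * near_fun s eps (y - x))); last by ring.
  rewrite ler_wpM2l ?(mulr_ge0 (ltW b0))//.
  rewrite (_ : near_fun s eps (y - x) = near_fun s eps (x - y)); last by rewrite /near_fun enormB.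
  exact: (kreg_diff s0 a01 hh (x - y) d0 de).
have [] // := @prod_rint_le R d s L mu nmu
  (fun z => sym_kernel delta f phi z - sym_kernel eps f phi z)
  (2 * (b * b') * (L * 4 ^+ s * eps)) (b + 1).
- by rewrite mulr_ge0// !mulr_ge0// ?exprn_ge0// ltW.
- move=> x y xb; have fx : f x = 0 by apply: f0; rewrite (le_trans _ xb)// lerDl.
  have [yb|yb] := leP b (enorm y); first by rewrite FE fx f0// !mul0r subr0 mulr0 mul0r.
  apply/eqP; rewrite -normr_le0 (le_trans (near x y))//.
  rewrite /near_fun ifF ?mulr0//; apply/negP => h1.
  have := enorm_subl x y; rewrite enormB; lra.
by move=> x; apply: (@integral_near_le (fun z => sym_kernel delta f phi z - sym_kernel eps f phi z)).
Qed.

Definition pairing (delta : R) (f g : E -> R) : R :=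
  \int[mu]_y (g y * potential (k delta) f mu y).

(** The last form lets the kernel act on [g], as in [test_pairing]. The functions are merely bounded
    and measurable because [g] will be an indicator. *)
Lemma pairing_fubini delta (f g : B -> R) (b r : R) : 0 < delta -> 0 <= b -> 0 < r ->
  measurable_fun setT f -> measurable_fun setT g ->
  (forall x, `|f x| <= b) -> (forall x, `|g x| <= b) ->
  (forall x : E, r <= enorm x -> f x = 0) -> (forall x : E, r <= enorm x -> g x = 0) ->
  let F := fun z : B * B => k delta ((z.1 : E) - z.2) * f z.1 * g z.2 in
  [/\ P.-integrable setT (EFin \o F),
      \int[P]_z F z = pairing delta f g &
      \int[P]_z F z = \int[mu]_x (f x * \int[mu]_y (k delta ((x : E) - y) * g y))].
Proof.
move=> d0 b0 r0 mf mg fb gb f0 g0 F.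
have mk := measurable_kreg s a01 hh (ltW d0).
have mkx (x : E) : measurable_fun setT (fun y : B => k delta (x - (y : E))).
  by apply: (measurableT_comp mk); apply: measurable_subE; [exact: measurable_cst|exact: measurable_id].
have mky (y : E) : measurable_fun setT (fun x : B => k delta ((x : E) - y)).
  by apply: (measurableT_comp mk); exact: measurable_shift.
have kb x : `|k delta x| <= delta ^- s by exact: (kreg_bound s a01 hh).
have ds0 : 0 <= delta ^- s by rewrite invr_ge0 exprn_ge0// ltW.
have mF : measurable_fun setT F.
  apply: measurable_funM; last exact: (measurableT_comp mg measurable_snd).
  apply: measurable_funM; last exact: (measurableT_comp mf measurable_fst).
  exact: measurable_diff.
have Fb x y : `|F (x, y)| <= delta ^- s * b * b.
  rewrite /F/=; move: (k _ _) (kb (x - y)) => u ub; rewrite !normrM.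
  by apply: ler_pM => //; apply: ler_pM.
have bnd0 : 0 <= delta ^- s * b * b by rewrite !mulr_ge0.
have secy x : (\int[mu]_y `|(F (x, y))%:E| <= (delta ^- s * b * b * (L * r ^+ s))%:E)%E.
  have [] // := @rint_bounded R d s L mu nmu (fun y => `|F (x, y)|) (delta ^- s * b * b) r => //.
  - apply: measurableT_comp => //; exact: (measurableT_comp mF (pair1_measurable x)).
  - by move=> y; rewrite normr_id.
  - by move=> y yr; rewrite /F/= g0// mulr0 normr0.
  move=> iy; rewrite ger0_norm ?Rintegral_ge0// /Rintegral -lee_fin fineK//.
  exact: integrable_fin_num.
have secx y : (\int[mu]_x `|(F (x, y))%:E| < +oo)%E.
  have [] // := @rint_bounded R d s L mu nmu (fun x => F (x, y)) (delta ^- s * b * b) r => //.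
  - exact: (measurableT_comp mF (pair2_measurable y)).
  - by move=> x xr; rewrite /F/= f0// mulr0 mul0r.
  by move=> /integrableP[].
have [iF _] := @prod_rint_le R d s L mu nmu F (delta ^- s * b * b * (L * r ^+ s)) r
  (mulr_ge0 bnd0 (mulr_ge0 L0 (exprn_ge0 s (ltW r0)))) r0 mF
  (fun x y xr => (ltac:(by rewrite /F/= f0// mulr0 mul0r) : F (x, y) = 0)) secy.
split=> //.
- rewrite (Rintegral_prod21 iF secx); apply: eq_Rintegral => y _.
  rewrite /F/= mulrC /potential -RintegralZr//.
  have [] // := @rint_bounded R d s L mu nmu (fun x => k delta ((x : E) - y) * f x) (delta ^- s * b) r => //.
  - by rewrite mulr_ge0.
  - exact: (measurable_funM (mky y) mf).
  - by move=> x; rewrite normrM ler_pM.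
  - by move=> x xr; rewrite f0// mulr0.
- rewrite (Rintegral_prod12 iF (fun x => le_lt_trans (secy x) (ltry _))).
  apply: eq_Rintegral => x _.
  rewrite -RintegralZl//.
    by apply: eq_Rintegral => y _; rewrite /F/=; ring.
  have [] // := @rint_bounded R d s L mu nmu (fun y => k delta (x - (y : E)) * g y) (delta ^- s * b) r => //.
  - by rewrite mulr_ge0.
  - exact: (measurable_funM (mkx x) mg).
  - by move=> y; rewrite normrM ler_pM.
  - by move=> y yr; rewrite g0// mulr0.
Qed.

(** Oddness of the kernel and the exchange of variables make the two halves of the symmetrized
    integral equal; for [delta > 0] each half converges by itself. *)
Lemma sym_kernel_pairing delta b b' r f phi : 0 < delta -> 0 < r ->
  lip_bounded b r f -> lip_bounded b' r phi ->
  \int[P]_z sym_kernel delta f phi z = pairing delta f phi.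
Proof.
move=> d0 r0 hf hp; have b0 := lip_bounded_ge0 hf; have b'0 := lip_bounded_ge0 hp.
have [cf _] := lip_bounded_Cc hf; have [cp _] := lip_bounded_Cc hp.
have [fb fl f0] := hf; have [pb pl p0] := hp.
have [|||iF FE _] := @pairing_fubini delta f phi (Num.max b b') r d0 _ r0
  (continuous_measurable cf) (continuous_measurable cp) _ _ f0 p0.
- by rewrite le_max b0.
- by move=> x; rewrite le_max fb.
- by move=> x; rewrite le_max pb orbT.
set F := fun z => _ in iF FE.
have [iFs FsE] := prod_rint_swap iF.
rewrite -FE.
have -> : sym_kernel delta f phi = fun z => 2^-1 * (F z + F (z.2, z.1)).
  apply/funext => z; rewrite /sym_kernel /F/= -[z.2 - z.1]opprB (kreg_odd _ hh).
  by field.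
rewrite RintegralZl//; last first.
  have := @integrableD _ _ _ P setT measurableT _ _ iF iFs.
  by apply: eq_integrable.
by rewrite RintegralD// FsE; field.
Qed.

(** The constant of [kreg_far] at [rho = b], times the bound [b] on [f] and the mass bound [L * b^s]
    on its support. *)
Definition far_const (b : R) : R :=
  2 `^ (s%:R + alpha) * (C * b `^ alpha + s.+1%:R * b) * b * (L * b ^+ s).

Lemma far_const_ge0 b : 0 <= b -> 0 <= far_const b.
Proof. by move=> b0; rewrite /far_const !mulr_ge0 ?addr_ge0 ?mulr_ge0 ?powR_ge0 ?exprn_ge0. Qed.

(** Mean zero allows [k (x - y)] to be replaced by [k (x - y) - k (- y)], to which [kreg_far]
    applies on the support of [f]. *)
Lemma potential_far delta b f y : 0 <= delta -> 0 < b -> lip_bump b f ->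
  \int[mu]_x (f : B -> R) x = 0 ->
  1 <= enorm y -> 2 * b <= enorm y -> 2 * delta <= enorm y ->
  `|potential (k delta) f mu y| <= far_const b * enorm y `^ (- (s%:R + alpha)).
Proof.
move=> d0 b0 [fb fl f0] if0 y1 yb yd.
have y0 : 0 < enorm y by exact: lt_le_trans y1.
have cf := lipschitz_continuous fl.
have mf := continuous_measurable cf.
have Cf : Cc f by split=> //; exists b.
have mufin q : (mu (eball 0 q) < +oo)%E by exact: nice_eball_lty nmu.
have intf := integrable_Cc mufin Cf.
pose c := 2 `^ (s%:R + alpha) * (C * b `^ alpha + s.+1%:R * b) * enorm y `^ (- (s%:R + alpha)).
have c0 : 0 <= c by rewrite /c !mulr_ge0 ?addr_ge0 ?mulr_ge0 ?powR_ge0// ltW.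
have mk := measurable_kreg s a01 hh d0.
have mky : measurable_fun setT (fun x : B => k delta ((x : E) - y)).
  by apply: (measurableT_comp mk); exact: measurable_shift.
pose G (x : B) := (k delta ((x : E) - y) - k delta (- y)) * f x.
have mG : measurable_fun setT G.
  exact: (measurable_funM (measurable_funB mky (measurable_cst _)) mf).
have Gb (x : E) : `|G x| <= c * b.
  rewrite /G normrM; have [xb|/ltW xb] := leP b (enorm x).
    by rewrite (f0 x xb) normr0 mulr0 mulr_ge0// ltW.
  by apply: ler_pM => //; exact: (kreg_far s a01 C0 hh (ltW b0)).
have cb0 : 0 <= c * b by rewrite mulr_ge0// ltW.
have G0 (x : E) : b <= enorm x -> G x = 0 by move=> xb; rewrite /G (f0 x xb) mulr0.
have [iG Gle] := rint_bounded nmu cb0 b0 mG Gb G0.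
have -> : potential (k delta) f mu y = \int[mu]_x G x.
  rewrite /potential.
  have -> : (fun x : B => k delta ((x : E) - y) * f x) = (fun x => G x + k delta (- y) * f x).
    by apply/funext => x; rewrite /G mulrBl subrK.
  rewrite RintegralD//; last exact: (@integrableZl _ _ _ mu setT measurableT (k delta (- y)) _ intf).
  by rewrite RintegralZl// if0 mulr0 addr0.
apply: (le_trans Gle); rewrite /c /far_const le_eqVlt; apply/orP; left; apply/eqP; ring.
Qed.

Lemma integral_far_potential delta b N f (w : E -> R) : 0 < delta -> 0 < b -> lip_bump b f ->
  \int[mu]_x (f : B -> R) x = 0 -> 1 <= N -> 2 * b <= N -> 2 * delta <= N ->
  measurable_fun setT (w : B -> R) -> (forall y, `|w y| <= 1) ->
  (forall y, enorm y < N -> w y = 0) ->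
  mu.-integrable setT (EFin \o (fun y : B => w y * potential (k delta) f mu y)) /\
  `|\int[mu]_y (w y * potential (k delta) f mu y)| <=
     far_const b * (L * 2 ^+ s / (1 - 2 `^ (- alpha)) * N `^ (- alpha)).
Proof.
move=> d0 b0 hf if0 N1 Nb Nd mw w1 w0.
have N0 : 0 < N by exact: lt_le_trans N1.
have hfb : lip_bounded b b f by [].
have cV : continuous (potential (k delta) f mu).
  exact: potential_continuous L0 nmu (kreg_continuous a01 hh d0) (lip_bounded_Cc hfb).
have mF : measurable_fun setT (fun y : B => w y * potential (k delta) f mu y).
  by apply: measurable_funM => //; exact: continuous_measurable.
have fc := far_const_ge0 (ltW b0).
have Fb y : `|w y * potential (k delta) f mu y| <= far_const b * far_fun (s%:R + alpha) N y.
  have [yN|yN] := ltP (enorm y) N.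
    by rewrite w0// mul0r normr0 mulr_ge0// far_fun_ge0.
  rewrite /far_fun yN normrM -[leRHS]mul1r; apply: ler_pM => //.
  apply: potential_far => //; first exact: ltW.
  - exact: le_trans yN.
  - exact: le_trans yN.
  - exact: le_trans yN.
have mfar := measurable_far_fun (d := d) (s%:R + alpha) N.
have hI : (\int[mu]_y `|(w y * potential (k delta) f mu y)%:E| <=
    (far_const b * (L * 2 ^+ s / (1 - 2 `^ (- alpha)) * N `^ (- alpha)))%:E)%E.
  apply: (@le_trans _ _ (\int[mu]_y (far_const b * far_fun (s%:R + alpha) N y)%:E)%E).
    apply: ge0_le_integral => //.
    - by do 2 (apply: measurableT_comp => //).
    - by apply/measurable_EFinP; apply: measurable_funM => //; exact: measurable_cst.
    - by move=> y _; rewrite lee_fin.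
  under eq_integral do rewrite EFinM.
  rewrite ge0_integralZl//.
  - by rewrite [leRHS]EFinM; apply: lee_wpmul2l; [rewrite lee_fin|exact: integral_far].
  - exact/measurable_EFinP.
  - by move=> y _; rewrite lee_fin far_fun_ge0.
have iF : mu.-integrable setT (EFin \o (fun y : B => w y * potential (k delta) f mu y)).
  apply/integrableP; split; first exact/measurable_EFinP.
  exact: le_lt_trans hI (ltry _).
split=> //; rewrite -lee_fin EFin_normr_Rintegral//.
apply: le_trans hI; apply: le_abse_integral => //.
exact/measurable_EFinP.
Qed.

(** The constant of [sym_kernel_diff] without its factor [eps], plus the constant of
    [integral_far_potential] without its factor [N^-alpha]. *)
Definition error_const (b b' : R) : R :=
  2 * (b * b') * (L * 4 ^+ s) * (L * (b + 1) ^+ s) +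
  far_const b * (L * 2 ^+ s / (1 - 2 `^ (- alpha))).

Let geom0 : 0 < 1 - 2 `^ (- alpha).
Proof.
rewrite subr_gt0 powRN invf_lt1 ?powR_gt0//.
have := @gt0_ltr_powR R alpha a0 1 2; rewrite powR1; apply; rewrite ?nnegrE//; lra.
Qed.

Lemma error_const_ge b b' eps N c : 0 <= b -> 0 <= b' -> 0 <= eps -> 0 <= c ->
  2 * (b * b') * (L * 4 ^+ s * eps) * (L * (b + 1) ^+ s) +
  c * (far_const b * (L * 2 ^+ s / (1 - 2 `^ (- alpha)) * N `^ (- alpha))) <=
  (1 + c) * error_const b b' * (eps + N `^ (- alpha)).
Proof.
move=> b0 b'0 e0 c0; rewrite /error_const; have fc := far_const_ge0 b0.
set x := 2 * (b * b') * (L * 4 ^+ s) * (L * (b + 1) ^+ s).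
set y := far_const b * (L * 2 ^+ s / (1 - 2 `^ (- alpha))).
have x0 : 0 <= x by rewrite /x !mulr_ge0 ?exprn_ge0 ?addr_ge0.
have y0 : 0 <= y by rewrite /y mulr_ge0// divr_ge0 ?(ltW geom0)// mulr_ge0 ?exprn_ge0.
have p0 : 0 <= N `^ (- alpha) by exact: powR_ge0.
rewrite (_ : _ + _ = x * eps + c * y * N `^ (- alpha)); last by rewrite /x /y; ring.
rewrite (_ : (1 + c) * (x + y) * (eps + N `^ (- alpha)) =
  (x * eps + c * y * N `^ (- alpha)) + (y * eps + c * x * eps + c * y * eps +
   (x + y + c * x) * N `^ (- alpha))); last by ring.
rewrite lerDl; move: p0; move: (N `^ (- alpha)) => p p0; clearbody x y.
by do ?[apply: addr_ge0|apply: mulr_ge0].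
Qed.

Lemma bump0_lip_bounded N : 1 <= N -> lip_bounded 1 (2 * N) (bump (0 : E) N).
Proof.
move=> N1; have N0 : 0 < N by exact: lt_le_trans N1.
split.
- by move=> x; rewrite ger0_norm ?bump_le1// bump_ge0.
- move=> x y; apply: (le_trans (bump_lip _ _ _ N0)).
  by rewrite ler_wpM2r ?enorm_ge0// invf_le1.
- by move=> x xN; apply: bump_eq0 => //; rewrite subr0.
Qed.

(* [f] has mean zero, so its potential decays like |y|^-(s+alpha), and [f] is
   Lipschitz, so truncating the kernel at height [eps] costs O(eps). *)
Lemma pairing_indic delta eps b N f (S : set B) T : 0 < delta -> delta <= eps -> eps <= 1 / 2 ->
  0 < b -> lip_bump b f -> \int[mu]_x (f : B -> R) x = 0 -> 1 <= N -> 2 * b <= N ->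
  measurable S -> S `<=` eball 0 T -> eball 0 (2 * N) `<=` S ->
  `|pairing delta f (\1_S : B -> R) - pairing eps f (bump 0 N)| <=
    2 * error_const b 1 * (eps + N `^ (- alpha)).
Proof.
move=> d0 de e1 b0 hf if0 N1 Nb mS ST NS.
have e0 : 0 < eps by exact: lt_le_trans de.
have N0 : 0 < N by exact: lt_le_trans N1.
have hchi := bump0_lip_bounded N1.
have bN : b <= 2 * N by lra.
have hfN : lip_bounded b (2 * N) f.
  by have [fb fl f0] := hf; split=> // x xr; apply: f0; exact: le_trans xr.
have N20 : 0 < 2 * N by rewrite mulr_gt0.
have Cchi := lip_bounded_Cc hchi; have Cf := lip_bounded_Cc hfN.
have mufin q : (mu (eball 0 q) < +oo)%E by exact: nice_eball_lty nmu.
have cV : continuous (potential (k delta) f mu).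
  exact: potential_continuous L0 nmu (kreg_continuous a01 hh d0) Cf.
(* Both functions equal 1 on the ball of radius [N], so only the decay of the potential beyond [N]
   is felt. *)
pose w (y : E) := \1_S (y : B) - bump 0 N y : R.
have mw : measurable_fun setT (w : B -> R).
  apply: measurable_funB; first exact: measurable_indic.
  exact: continuous_measurable Cchi.1.
have w1 y : `|w y| <= 1.
  rewrite /w indicE; have := bump_ge0 (0 : E) N y; have := bump_le1 (0 : E) N y.
  by case: (_ \in _) => /= b1 b2; rewrite ler_norml; lra.
have w0 y : enorm y < N -> w y = 0.
  move=> yN; rewrite /w bump_eq1 ?subr0//; last exact: ltW.
  rewrite indicE mem_set ?subrr//; apply: NS; rewrite /eball/= subr0.
  by rewrite (lt_trans yN)// ltr_pMl// ltr1n.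
have [iw wle] := integral_far_potential d0 b0 hf if0 N1 Nb
  (ltac:(lra) : 2 * delta <= N) mw w1 w0.
have ichi : mu.-integrable setT (EFin \o (fun y : B => bump 0 N y * potential (k delta) f mu y)).
  by apply: integrable_Cc => //; have := Cc_mull cV Cchi; under eq_fun do rewrite mulrC.
have E1 : pairing delta f (\1_S : B -> R) =
    pairing delta f (bump 0 N) + \int[mu]_y (w y * potential (k delta) f mu y).
  rewrite /pairing -RintegralD//; apply: eq_Rintegral => y _.
  by rewrite -mulrDl /w addrC subrK.
rewrite E1 -(sym_kernel_pairing d0 N20 hfN hchi) -(sym_kernel_pairing e0 N20 hfN hchi).
rewrite addrAC; apply: (le_trans (ler_normD _ _)).
have e1' : eps <= 1 by lra.
have h1 := sym_kernel_diff (ltW d0) de e0 e1' b0 bN hf hchi.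
apply: (le_trans (lerD h1 wle)).
have := @error_const_ge b 1 eps N 1 (ltW b0) ler01 (ltW e0) ler01.
by rewrite mul1r.
Qed.

(** Within [tau] of a point where [f] is nonzero, [c - psi] vanishes; elsewhere the truncation at
    [eps <= tau] is not felt. A general [c] is carried because near the support of [f] the real and
    imaginary parts of a cutoff are 1 and 0. *)
Lemma outer_potential_eq eps tau c f psi y : 0 < eps -> eps <= tau ->
  (forall x y, f x != 0 -> enorm (x - y) < tau -> psi y = c) ->
  (c - psi y) * potential (k 0) f mu y = (c - psi y) * potential (k eps) f mu y.
Proof.
move=> e0 et hc.
have potE : psi y != c -> potential (k 0) f mu y = potential (k eps) f mu y.
  move=> cy; apply: eq_Rintegral => x _; have [fx|fx] := eqVneq (f x) 0.
    by rewrite fx !mulr0.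
  rewrite (@kreg_eq R d s alpha h 0 eps (x - y)) ?(ltW e0)//.
  rewrite leNgt; apply/negP => xy; move/eqP: cy; apply.
  by apply: (hc x) => //; exact: lt_le_trans et.
move: potE; move: (potential (k 0) f mu y) (potential (k eps) f mu y) => A A'.
by case: (eqVneq (psi y) c) => [-> _|_ ->//]; rewrite subrr !mul0r.
Qed.

Lemma outer_potential_integrable b b' c tau r f psi :
  0 < b -> lip_bump b f -> \int[mu]_x (f : B -> R) x = 0 -> lip_bounded b' r psi -> 0 < tau ->
  (forall x y, f x != 0 -> enorm (x - y) < tau -> psi y = c) ->
  mu.-integrable setT (EFin \o (fun y : B => (c - psi y) * potential (k 0) f mu y)).
Proof.
move=> b0 hf if0 hpsi t0 hc.
have Cf : Cc f by apply: (@lip_bounded_Cc b b).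
have Cpsi := lip_bounded_Cc hpsi.
have mufin q : (mu (eball 0 q) < +oo)%E by exact: nice_eball_lty nmu.
have cV : continuous (potential (k tau) f mu).
  exact: potential_continuous L0 nmu (kreg_continuous a01 hh t0) Cf.
pose N := Num.max 1 (Num.max (2 * b) (2 * tau)).
have N1 : 1 <= N by rewrite le_max lexx.
have N0 : 0 < N by exact: lt_le_trans N1.
have Nb : 2 * b <= N by rewrite !le_max lexx orbT.
have Nt : 2 * tau <= N by rewrite !le_max lexx !orbT.
have Cchi := bump_Cc (0 : E) N0.
pose w (y : E) := 1 - bump 0 N y : R.
have mw : measurable_fun setT (w : B -> R).
  by apply: measurable_funB; [exact: measurable_cst|exact: continuous_measurable Cchi.1].
have w1 y : `|w y| <= 1.
  rewrite /w; have := bump_ge0 (0 : E) N y; have := bump_le1 (0 : E) N y.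
  by move=> b1 b2; rewrite ler_norml; lra.
have w0 y : enorm y < N -> w y = 0.
  by move=> yN; rewrite /w bump_eq1 ?subr0 ?subrr//; exact: ltW.
have [iw _] := integral_far_potential t0 b0 hf if0 N1 Nb Nt mw w1 w0.
have iV g : Cc g -> mu.-integrable setT (EFin \o (fun y : B => g y * potential (k tau) f mu y)).
  by move=> Cg; apply: integrable_Cc => //; have := Cc_mull cV Cg; under eq_fun do rewrite mulrC.
(* [c - psi = c (1 - bump) + (c bump - psi)]: the first term is controlled by the decay of the
   potential, the second has compact support. *)
have iw' := @integrableZl _ _ _ mu setT measurableT c _ iw.
have ic := iV _ (Cc_sub (Cc_scale c Cchi) Cpsi).
have := @integrableD _ _ _ mu setT measurableT _ _ iw' ic.
apply: eq_integrable => // y _; rewrite /= (outer_potential_eq y t0 (lexx _) hc) -EFinM -EFinD.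
by congr EFin; rewrite /w; move: (potential _ _ _ _) => A; ring.
Qed.

(** At truncation [eps] the cutoff drops out: pairing with [psi] plus the integral of [c - psi]
    against the potential equals [c] times the pairing with the bump, plus a tail beyond [N].
    Passing from the singular kernel to [eps] changes only the symmetrized term. *)
Lemma reflection_pairing eps b b' c tau r N f psi : 0 < eps -> eps <= 1 / 2 -> eps <= tau ->
  0 < b -> lip_bump b f -> \int[mu]_x (f : B -> R) x = 0 -> 0 < r -> lip_bounded b' r psi ->
  (forall x y, f x != 0 -> enorm (x - y) < tau -> psi y = c) ->
  1 <= N -> 2 * b <= N -> r <= 2 * N ->
  `|\int[P]_z sym_kernel 0 f psi z +
    \int[mu]_y ((c - psi y) * potential (k 0) f mu y) - c * pairing eps f (bump 0 N)| <=
    (1 + `|c|) * error_const b b' * (eps + N `^ (- alpha)).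
Proof.
move=> e0 e1 et b0 hf if0 r0 hpsi hc N1 Nb rN.
have N0 : 0 < N by exact: lt_le_trans N1.
have hchi := bump0_lip_bounded N1.
have bN : b <= 2 * N by lra.
have eN : 2 * eps <= N by lra.
have e1' : eps <= 1 by lra.
have hfN : lip_bounded b (2 * N) f.
  by have [fb fl f0] := hf; split=> // x xr; apply: f0; exact: le_trans xr.
have hpsiN : lip_bounded b' (2 * N) psi.
  by have [fb fl f0] := hpsi; split=> // x xr; apply: f0; exact: le_trans xr.
have N20 : 0 < 2 * N by rewrite mulr_gt0.
have Cchi := lip_bounded_Cc hchi; have Cf := lip_bounded_Cc hfN.
have Cpsi := lip_bounded_Cc hpsiN.
have mufin q : (mu (eball 0 q) < +oo)%E by exact: nice_eball_lty nmu.
have cV : continuous (potential (k eps) f mu).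
  exact: potential_continuous L0 nmu (kreg_continuous a01 hh e0) Cf.
have tails y := outer_potential_eq y e0 et hc.
pose w (y : E) := 1 - bump 0 N y : R.
have mw : measurable_fun setT (w : B -> R).
  apply: measurable_funB; first exact: measurable_cst.
  exact: continuous_measurable Cchi.1.
have w1 y : `|w y| <= 1.
  rewrite /w; have := bump_ge0 (0 : E) N y; have := bump_le1 (0 : E) N y.
  by move=> b1 b2; rewrite ler_norml; lra.
have w0 y : enorm y < N -> w y = 0.
  by move=> yN; rewrite /w bump_eq1 ?subr0 ?subrr//; exact: ltW.
have [iw wle] := integral_far_potential e0 b0 hf if0 N1 Nb
  eN mw w1 w0.
have ichi : mu.-integrable setT (EFin \o (fun y : B => bump 0 N y * potential (k eps) f mu y)).
  by apply: integrable_Cc => //; have := Cc_mull cV Cchi; under eq_fun do rewrite mulrC.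
have ipsi : mu.-integrable setT (EFin \o (fun y : B => psi y * potential (k eps) f mu y)).
  by apply: integrable_Cc => //; have := Cc_mull cV Cpsi; under eq_fun do rewrite mulrC.
have icw := @integrableZl _ _ _ mu setT measurableT c _ iw.
have icchi := @integrableZl _ _ _ mu setT measurableT c _ ichi.
have E1 : \int[mu]_y ((c - psi y) * potential (k 0) f mu y) =
    c * pairing eps f (bump 0 N) - pairing eps f psi
      + c * \int[mu]_y (w y * potential (k eps) f mu y).
  rewrite /pairing -!RintegralZl// -RintegralB// -RintegralD//; last first.
    exact: (@integrableB _ _ _ mu setT measurableT _ _ icchi ipsi).
  apply: eq_Rintegral => y _; rewrite tails /w; ring.
rewrite E1 -(sym_kernel_pairing e0 N20 hfN hpsiN).
have alg (u v p q : R) : u + (p - v + q) - p = (u - v) + q by ring.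
rewrite alg.
apply: (le_trans (ler_normD _ _)); rewrite [X in _ + X]normrM.
have h1 := sym_kernel_diff (lexx 0) (ltW e0) e0 e1' b0 bN hf hpsiN.
apply: (le_trans (lerD h1 (ler_wpM2l (normr_ge0 c) wle))).
exact: error_const_ge (ltW b0) (lip_bounded_ge0 hpsiN) (ltW e0) (normr_ge0 c).
Qed.

End singular_pairing.

(** * Measures carried by planes *)

Section plane_measures.
Variables (R : realType) (d s : nat).
Local Notation E := 'rV[R]_d.
Local Notation B := (borelE R d).
Hypothesis s0 : (0 < s)%N.

Lemma ediam_translate (A : set E) v : ediam [set x | A (x + v)] = ediam A.
Proof.
rewrite /ediam; congr (ereal_sup (_ `|` _)); apply/seteqP; split=> _ [[x y]/= [Ax Ay] <-].
  by exists (x + v, y + v) => //=; rewrite opprD addrACA subrr addr0.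
exists (x - v, y - v); first by split; rewrite /= subrK.
by congr (_%:E); congr (enorm _); apply/rowP => i; rewrite !mxE; ring.
Qed.

Lemma hausdorff_translate (A : set E) (v : E) :
  (hausdorff s A <= hausdorff s [set x | A (x - v)%R])%E.
Proof.
apply: ge_ereal_sup => _ [delta d0 <-].
apply: (@le_trans _ _ (hausdorff_content s delta [set x | A (x - v)%R])); last first.
  by apply: ereal_sup_ubound; exists delta.
apply: le_ereal_inf_tmp => _ [F [AF Fd] <-].
apply: ereal_inf_lbound; exists (fun k => [set x | F k (x + v)]).
  split=> [x Ax|k]; last by rewrite ediam_translate.
  by have [|k _ Fk] := AF (x + v); [rewrite /= addrK|exists k].
by under eq_eseriesr do rewrite ediam_translate.
Qed.

Lemma hausdorff_mono (A A' : set E) : A `<=` A' -> (hausdorff s A <= hausdorff s A')%E.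
Proof.
move=> AA'; apply: ge_ereal_sup => _ [delta d0 <-].
apply: (@le_trans _ _ (hausdorff_content s delta A')); last first.
  by apply: ereal_sup_ubound; exists delta.
apply: ereal_inf_le_tmp => _ [F [AF Fd] <-]; exists F => //; split=> //.
exact: subset_trans AF.
Qed.

Lemma hausdorff_set0 : (hausdorff s (@set0 E) <= 0)%E.
Proof.
apply: ge_ereal_sup => _ [delta /= d0 <-].
have D0 : ediam (@set0 E) = 0%E.
  apply/eqP; rewrite eq_le; apply/andP; split; last by apply: ereal_sup_ubound; left.
  by apply: ge_ereal_sup => _ [->//|[z [[]]]].
apply: ereal_inf_lbound; exists (fun=> set0).
  by split=> // k; rewrite D0 lee_fin ltW.
apply: eseries0 => k _ _; rewrite D0 -(prednK s0) expeS mul0e//.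
Qed.

(* Translating by half the difference of the two points preserves the plane, and
   with it the Hausdorff measure. *)
Lemma plane_midpoint (nu : {measure set B -> \bar R}) (x y : E) :
  is_plane_measure s nu ->
  (forall r, 0 < r -> (0 < nu (eball x r))%E) -> (forall r, 0 < r -> (0 < nu (eball y r))%E) ->
  forall r, 0 < r -> (0 < nu (eball (2^-1 *: (x + y)) r))%E.
Proof.
move=> [c [L [c0 [p [W [_ LE]]] nuE]]] hx hy r r0.
pose q := r / 3; have q0 : 0 < q by rewrite divr_gt0.
(* A point charged by [nu] is only approximated by points of [L], whence the third [q] of the
   radius: one for [x], one for the midpoint, one for the ball itself. *)
have meet w : (forall r, 0 < r -> (0 < nu (eball w r))%E) -> exists2 w', L w' & enorm (w' - w) < q.
  move=> hw; apply: contrapT => h; have := hw q q0.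
  rewrite nuE; last exact: measurable_eball.
  rewrite (_ : eball w q `&` L = set0); last first.
    by apply/seteqP; split=> // w' [w'q Lw']; apply: h; exists w'.
  by rewrite ltNge => /negP; apply; apply: mule_ge0_le0; rewrite ?lee_fin ?(ltW c0)// hausdorff_set0.
have [x' Lx' x'x] := meet x hx; have [y' Ly' y'y] := meet y hy.
set z := 2^-1 *: (x + y); pose v := 2^-1 *: (y' - x').
have vW : v \in W.
  move: Lx' Ly'; rewrite LE /= => Lx' Ly'; rewrite memvZ//.
  have -> : y' - x' = (y' - p) - (x' - p) by apply/rowP => i; rewrite !mxE; ring.
  exact: memvB.
have zv : enorm (x' + v - z) < q.
  rewrite (_ : x' + v - z = 2^-1 *: ((x' - x) + (y' - y))).
    rewrite enormZ ger0_norm ?invr_ge0// ltr_pdivrMl// mulr_natl mulr2n.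
    by apply: (le_lt_trans (enormD _ _)); rewrite ltrD.
  by apply/rowP => i; rewrite /v /z !mxE; field.
apply: (lt_le_trans (hx q q0)).
rewrite !nuE; [|exact: measurable_eball|exact: measurable_eball].
apply: lee_wpmul2l; first by rewrite lee_fin ltW.
apply: (le_trans (hausdorff_translate _ v)); apply: hausdorff_mono => w [wq Lw]; split; last first.
  move: Lw; rewrite LE/= => Lw.
  have -> : w - p = (w - v - p) + v by apply/rowP => i; rewrite !mxE; ring.
  exact: memvD.
rewrite /eball/=.
rewrite (_ : w - z = (w - v - x) + ((x' + v - z) + (x - x'))); last first.
  by apply/rowP => i; rewrite !mxE; ring.
apply: (le_lt_trans (enormD _ _)).
have h1 := enormD (x' + v - z) (x - x').
move: wq; rewrite /eball/= => wq; rewrite enormB in x'x.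
have -> : r = q + (q + q) by rewrite /q; field.
by rewrite ltrD// (le_lt_trans h1)// ltrD.
Qed.

End plane_measures.

(** * Regularity and support of weak limits *)

Section limit_regularity.
Variables (R : realType) (d s : nat).
Local Notation E := 'rV[R]_d.
Local Notation B := (borelE R d).
Variables (L : R) (L0 : 0 < L) (U : set_system nat) (UU : UltraFilter U).
Variable mus : nat -> {sigma_finite_measure set B -> \bar R}.
Hypothesis nmus : forall k, nice s L (mus k).
Hypothesis lower : forall k x r, msupp (mus k) x -> 0 < r ->
  ((L^-1 * r ^+ s)%:E <= mus k (eball x r))%E.
Variable nu : {sigma_finite_measure set B -> \bar R}.
Hypothesis nnu : nice s L nu.
Hypothesis wlim : forall f : E -> R, Cc f ->
  (fun k => \int[mus k]_x (f : B -> R) x) @ U --> \int[nu]_x (f : B -> R) x.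

Lemma bump_integral_bounds (mu : {measure set B -> \bar R}) x r : nice s L mu -> 0 < r ->
  fine (mu (eball x r)) <= \int[mu]_y (bump x r : B -> R) y <= fine (mu (eball x (2 * r))).
Proof.
move=> nmu r0.
have mufin q : (mu (eball 0 q) < +oo)%E by exact: nice_eball_lty nmu.
have Cb := bump_Cc x r0.
have [_ h1] := layer_integral_le 1 mufin (@open_eball R d x r) (@nice_eball_lty R d s L mu x r nmu) Cb.
have [h2 _] := layer_integral_le 1 mufin (@open_eball R d x (2 * r))
  (@nice_eball_lty R d s L mu x (2 * r) nmu) Cb.
rewrite mul1r in h1; rewrite mul1r in h2; apply/andP; split.
  apply: h1 => [y|y yr]; first exact: bump_ge0.
  by apply: bump_eq1 => //; exact: ltW.
apply: h2 => y; first by rewrite bump_ge0 bump_le1.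
by move=> /negP; rewrite /eball/= -leNgt => yr; exact: bump_eq0.
Qed.

Lemma nice_fineK (mu : {measure set B -> \bar R}) x r : nice s L mu ->
  (fine (mu (eball x r)))%:E = mu (eball x r).
Proof.
by move=> nmu; rewrite fineK// ge0_fin_numE//; exact: nice_eball_lty nmu.
Qed.

(** The ball of radius [r / 4] about [w] lies in [eball x (r / 2)], where [bump x (r / 2)] is 1, and
    the integral of that bump is at most the mass of [eball x r]. Hence the loss of [4^s]. *)
Lemma limit_lower x r : 0 < r ->
  U [set k | exists2 w, msupp (mus k) w & enorm (w - x) < r / 4] ->
  ((L^-1 * (r / 4) ^+ s)%:E <= nu (eball x r))%E.
Proof.
move=> r0 hU; have r2 : 0 < r / 2 by rewrite divr_gt0.
have r4 : 0 < r / 4 by rewrite divr_gt0.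
have /andP[_ hnu] := bump_integral_bounds x nnu r2.
rewrite -(nice_fineK x r nnu) lee_fin.
rewrite (_ : 2 * (r / 2) = r) in hnu; last by field.
apply: le_trans hnu.
apply: (cvgr_to_ge (wlim (bump_Cc x r2))).
apply: filterS hU => k [w sw wx].
have /andP[hk _] := bump_integral_bounds x (nmus k) r2.
apply: le_trans hk; rewrite -lee_fin (nice_fineK _ _ (nmus k)).
apply: (le_trans (lower sw r4)); apply: le_measure; rewrite ?inE; [exact: measurable_eball|exact: measurable_eball|].
by apply: sub_eball; lra.
Qed.

Lemma limit_null x r : 0 < r ->
  U [set k | eball x r `&` msupp (mus k) = set0] -> nu (eball x (r / 2)) = 0%E.
Proof.
move=> r0 hU; have r2 : 0 < r / 2 by rewrite divr_gt0.
apply/eqP; rewrite eq_le measure_ge0 andbT.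
have /andP[hnu _] := bump_integral_bounds x nnu r2.
rewrite -(nice_fineK x (r / 2) nnu) lee_fin; apply: (le_trans hnu).
apply: (cvgr_to_le (wlim (bump_Cc x r2))); apply: filterS hU => k hk.
have /andP[_ hk'] := bump_integral_bounds x (nmus k) r2.
apply: (le_trans hk'); rewrite (_ : 2 * (r / 2) = r); last by field.
by rewrite (null_open (@open_eball R d x r) hk).
Qed.

Lemma limit_support x : (forall r, 0 < r ->
    U [set k | exists2 w, msupp (mus k) w & enorm (w - x) < r]) ->
  forall r, 0 < r -> (0 < nu (eball x r))%E.
Proof.
move=> hx r r0; have r4 : 0 < r / 4 by rewrite divr_gt0.
apply: lt_le_trans (limit_lower r0 (hx _ r4)).
by rewrite lte_fin mulr_gt0 ?invr_gt0 ?exprn_gt0.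
Qed.

(** At a support point [y] of the limit the ultrafilter decides: either the supports come within
    [r / 4] of [y] for almost all indices, and [limit_lower] applies, or they miss that ball, and
    [limit_null] contradicts the choice of [y]. *)
Lemma limit_AD_regular x : (forall r, 0 < r -> (0 < nu (eball x r))%E) ->
  AD_regular_with s (4 ^+ s * L) nu.
Proof.
move=> hx; split.
- apply/eqP => nu0; have := hx 1 ltr01.
  suff -> : nu (eball x 1) = 0%E by rewrite ltxx.
  apply/eqP; rewrite eq_le measure_ge0 andbT -nu0.
  by apply: le_measure; rewrite ?inE; [exact: measurable_eball|exact: measurableT|].
- move=> y r r0; apply: (le_trans (nnu y r0)); rewrite lee_fin -mulrA.
  rewrite ler_peMl//; first by rewrite mulr_ge0 ?exprn_ge0// ltW.
  by rewrite exprn_ege1// ler1n.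
- move=> y r sy r0.
  rewrite (_ : (4 ^+ s * L)^-1 * r ^+ s = L^-1 * (r / 4) ^+ s); last first.
    by rewrite exprMn exprVn; field; rewrite expf_neq0// gt_eqF.
  apply: limit_lower => //.
  set A := [set k | _].
  have [//|UA] := in_ultra_setVsetC A UU; exfalso.
  have r4 : 0 < r / 4 by rewrite divr_gt0.
  have : nu (eball y (r / 4 / 2)) = 0%E.
    apply: limit_null => //; apply: filterS UA => k Ak.
    apply/seteqP; split=> // w [wr sw]; apply: Ak; exists w => //.
  have := sy _ (@open_eball R d y (r / 4 / 2)) (eball_center _ _).
  move=> pos nu0; have := pos (divr_gt0 r4 (@ltr0n R 2)).
  by rewrite lt_neqAle => /andP[/eqP + _]; apply; exact: esym nu0.
Qed.

End limit_regularity.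

(** * Compactness at unit scale *)

Section compactness.
Variables (R : realType) (d s : nat) (alpha C : R) (I : Type) (h : I -> 'rV[R]_d -> R).
Local Notation E := 'rV[R]_d.
Local Notation B := (borelE R d).
Hypotheses (s0 : (0 < s)%N) (a01 : 0 < alpha <= 1) (C0 : 0 <= C)
  (hh : forall i, numerator alpha C (h i)).
Local Notation k i := (kreg s alpha (h i)).

Let a0 : 0 < alpha. Proof. by case/andP: a01. Qed.

Definition test_pairing (mu : {measure set B -> \bar R}) (i : I) (delta : R) (S : set B)
    (psi : E -> R) : R :=
  \int[mu]_x (psi x * \int[mu]_y (k i delta ((x : E) - y) * \1_S y)).

(** The reflectionless condition for real components, up to an overall sign. The value [c] of [psi]
    near the support of [f] is free, so that imaginary parts of cutoffs, where [c = 0], are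
    included. *)
Definition real_reflectionless (nu : {sigma_finite_measure set B -> \bar R}) :=
  forall i f psi b b' r c tau, 0 < b -> lip_bump b f -> \int[nu]_x (f : B -> R) x = 0 ->
    0 < r -> lip_bounded b' r psi -> 0 < tau ->
    (forall x y, f x != 0 -> enorm (x - y) < tau -> psi y = c) ->
    \int[(nu \x nu)%E]_z sym_kernel s alpha (h i) 0 f psi z +
      \int[nu]_y ((c - psi y) * potential (k i 0) f nu y) = 0.

Lemma lip_bump_mono b b' (f : E -> R) : b <= b' -> lip_bump b f -> lip_bump b' f.
Proof.
move=> bb [fb fl f0]; split.
- by move=> x; exact: le_trans (fb x) bb.
- by move=> x y; apply: (le_trans (fl x y)); rewrite ler_wpM2r ?enorm_ge0.
- by move=> x bx; apply: f0; exact: le_trans bx.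
Qed.

Lemma lip_bump_sub b (f g : E -> R) a : `|a| <= 1 -> lip_bump b f -> lip_bump b g ->
  lip_bump (2 * b) (fun x => f x - a * g x).
Proof.
move=> a1 hf hg; have b0 : 0 <= b by have [fb _ _] := hf; exact: le_trans (fb 0).
have ag u v : `|u| <= v -> `|a * u| <= v.
  by move=> uv; rewrite normrM -[leRHS]mul1r ler_pM.
have [fb fl f0] := hf; have [gb gl g0] := hg; split.
- move=> x; apply: (le_trans (ler_normB _ _)).
  by have := fb x; have := ag _ _ (gb x); lra.
- move=> x y; rewrite (_ : _ - _ = (f x - f y) - a * (g x - g y)); last by ring.
  apply: (le_trans (ler_normB _ _)).
  by have := fl x y; have := ag _ _ (gl x y); lra.
- move=> x bx; have bx' : b <= enorm x by lra.
  by rewrite f0// g0// mulr0 subr0.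
Qed.

Lemma bump1_lip_bump (x0 : E) : lip_bump (2 + enorm x0) (bump x0 1).
Proof.
have e0 := enorm_ge0 x0; split.
- move=> x; rewrite ger0_norm ?bump_ge0//.
  by apply: (le_trans (bump_le1 _ _ _)); lra.
- move=> x y; apply: (le_trans (bump_lip _ _ _ ltr01)); rewrite invr1.
  by rewrite ler_wpM2r ?enorm_ge0//; lra.
- move=> x hx; apply: bump_eq0 => //; rewrite mulr1.
  by have := enorm_subl x x0; lra.
Qed.

Section limit.
Variables (L : R) (L0 : 0 < L) (U : set_system nat) (UU : UltraFilter U).
Hypothesis Uoo : \oo `<=` U.
Variable mus : nat -> {sigma_finite_measure set B -> \bar R}.
Hypothesis nmus : forall n, nice s L (mus n).
Variable nu : {sigma_finite_measure set B -> \bar R}.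
Hypothesis nnu : nice s L nu.
Hypothesis wlim : forall f : E -> R, Cc f ->
  (fun n => \int[mus n]_x (f : B -> R) x) @ U --> \int[nu]_x (f : B -> R) x.
Hypothesis small : forall n psi, lip_bump n.+1%:R psi -> \int[mus n]_x (psi : B -> R) x = 0 ->
  forall i, exists (delta : R) (S : set B) (T : R), [/\ 0 < delta < n.+1%:R^-1, measurable S,
    S `<=` eball (0 : E) T, eball (0 : E) n.+1%:R `<=` S &
    `|test_pairing (mus n) i delta S psi| < n.+1%:R^-1].

Lemma lip_bump_Cc b (f : E -> R) : lip_bump b f -> Cc f.
Proof. by move=> hf; apply: (@lip_bounded_Cc R d b b). Qed.

Lemma test_pairingE (mu : {sigma_finite_measure set B -> \bar R}) i delta (S : set B) T b f :
  nice s L mu -> 0 < delta -> measurable S -> S `<=` eball 0 T -> lip_bump b f ->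
  test_pairing mu i delta S f = pairing s alpha (h i) mu delta f (\1_S : B -> R).
Proof.
move=> nmu d0 mS ST hf; have [fb fl f0] := hf.
have r0 : 0 < Num.max (Num.max b T) 1 by rewrite lt_max ltr01 orbT.
have m0 : 0 <= Num.max b 1 by rewrite le_max ler01 orbT.
have Cf := lip_bump_Cc hf.
have m1 : measurable_fun setT (f : B -> R) by exact: continuous_measurable Cf.1.
have m2 : measurable_fun setT (\1_S : B -> R) by exact: measurable_indic.
have b1 (x : B) : `|f x| <= Num.max b 1 by rewrite le_max fb.
have b2 (x : B) : `|(\1_S x : R)| <= Num.max b 1.
  by rewrite indicE le_max; case: (_ \in _); rewrite ?normr1 ?normr0 ?lexx ?ler01 orbT.
have z1 (x : E) : Num.max (Num.max b T) 1 <= enorm x -> f x = 0.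
  by rewrite !ge_max -!andbA => /and3P[bx _ _]; exact: f0.
have z2 (x : E) : Num.max (Num.max b T) 1 <= enorm x -> (\1_S : B -> R) x = 0.
  rewrite !ge_max -!andbA => /and3P[_ Tx _]; rewrite indicE memNset// => /ST.
  by rewrite /eball/= subr0 ltNge Tx.
have [_ <- ->] // := pairing_fubini a01 (hh i) (ltW L0) nmu d0 m0 r0 m1 m2 b1 b2 z1 z2.
Qed.

Lemma potential_sub (mu : {sigma_finite_measure set B -> \bar R}) (kk : E -> R) (f g : E -> R) a y :
  nice s L mu -> continuous kk -> Cc f -> Cc g ->
  potential kk (fun x => f x - a * g x) mu y = potential kk f mu y - a * potential kk g mu y.
Proof.
move=> nmu ck Cf Cg.
have mufin q : (mu (eball 0 q) < +oo)%E by exact: nice_eball_lty nmu.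
have hI := Rintegral_positive mufin.
have C1 := Cc_mull (translate_continuous (y := y) ck) Cf.
have C2 := Cc_mull (translate_continuous (y := y) ck) Cg.
rewrite /potential -(pf_scale hI)// -(pf_sub hI)//; last exact: Cc_scale.
by apply: eq_Rintegral => x _; ring.
Qed.

Lemma pairing_sub (mu : {sigma_finite_measure set B -> \bar R}) i eps (f g w : E -> R) a :
  nice s L mu -> 0 < eps -> Cc f -> Cc g -> Cc w ->
  pairing s alpha (h i) mu eps (fun x => f x - a * g x) w =
    pairing s alpha (h i) mu eps f w - a * pairing s alpha (h i) mu eps g w.
Proof.
move=> nmu e0 Cf Cg Cw.
have mufin q : (mu (eball 0 q) < +oo)%E by exact: nice_eball_lty nmu.
have hI := Rintegral_positive mufin.
have ck : continuous (k i eps) by exact: (kreg_continuous a01 (hh i) e0).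
have CV g' : Cc g' -> Cc (fun y => w y * potential (k i eps) g' mu y).
  move=> Cg'; have cV := potential_continuous (ltW L0) nmu ck Cg'.
  by have := Cc_mull cV Cw; under eq_fun do rewrite mulrC.
rewrite /pairing -(pf_scale hI); last exact: CV.
rewrite -(pf_sub hI); [|exact: CV|apply: Cc_scale; exact: CV].
apply: eq_Rintegral => y _; rewrite (potential_sub _ _ nmu ck Cf Cg).
by move: (potential _ _ _ _) (potential _ _ _ _) => A A'; ring.
Qed.

Lemma pairing_cvg i eps (f w : E -> R) : 0 < eps -> Cc f -> Cc w ->
  (fun n => pairing s alpha (h i) (mus n) eps f w) @ U --> pairing s alpha (h i) nu eps f w.
Proof.
move=> e0 Cf Cw; apply: (weak_limit_double (ltW L0) UU nmus nnu wlim) => //.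
exact: (kreg_continuous a01 (hh i) e0).
Qed.

(** [f] has mean zero for [nu] only, so [small] is applied to [f - a n * g], where [g] is a bump at
    the support point [x0] and [a n] tends to 0. This doubles [b]; the isolated [eps] bounds the
    test pairing itself. *)
Lemma pairing_limit_le i eps N b f x0 : 0 < eps -> eps <= 1 / 2 -> 1 <= N -> 4 * b <= N ->
  0 < b -> 2 + enorm x0 <= b -> (forall r, 0 < r -> (0 < nu (eball x0 r))%E) ->
  lip_bump b f -> \int[nu]_x (f : B -> R) x = 0 ->
  `|pairing s alpha (h i) nu eps f (bump 0 N)| <=
    eps + 2 * error_const s alpha C L (2 * b) 1 * (eps + N `^ (- alpha)).
Proof.
move=> e0 e1 N1 Nb b0 x0b hx0 hf if0.
have N0 : 0 < N by exact: lt_le_trans N1.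
have Nb' : 2 * (2 * b) <= N by lra.
have b20 : 0 < 2 * b by rewrite mulr_gt0.
have hg : lip_bump b (bump x0 1) by apply: lip_bump_mono x0b _; exact: bump1_lip_bump.
set g := bump x0 1 in hg.
have Cf := lip_bump_Cc hf; have Cg := lip_bump_Cc hg.
have Cw : Cc (bump (0 : E) N) by exact: bump_Cc.
have m0 : 0 < \int[nu]_x (g : B -> R) x.
  have /andP[h1 _] := bump_integral_bounds x0 nnu ltr01.
  apply: lt_le_trans h1; rewrite -lte_fin (nice_fineK _ _ nnu).
  exact: hx0.
pose a n := (\int[mus n]_x (f : B -> R) x) / (\int[mus n]_x (g : B -> R) x).
have ma : a @ U --> (0 : R).
  have -> : (0 : R) = 0 / \int[nu]_x (g : B -> R) x by rewrite mul0r.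
  apply: cvgM; first by rewrite -if0; exact: wlim.
  by apply: cvgV; [rewrite gt_eqF|exact: wlim].
have lim1 : (fun n => pairing s alpha (h i) (mus n) eps f (bump 0 N) -
      a n * pairing s alpha (h i) (mus n) eps g (bump 0 N)) @ U -->
    pairing s alpha (h i) nu eps f (bump 0 N) - 0 * pairing s alpha (h i) nu eps g (bump 0 N).
  apply: cvgB; first exact: pairing_cvg.
  by apply: cvgM => //; exact: pairing_cvg.
rewrite mul0r subr0 in lim1.
apply: (cvgr_to_le (cvg_norm lim1)).
have ev1 : U [set n | `|a n| <= 1].
  have /cvgrPdist_le /(_ 1 ltr01) := ma.
  by apply: filterS => n; rewrite sub0r normrN.
have ev2 : U [set n | \int[mus n]_x (g : B -> R) x != 0].
  have /cvgrPdist_lt /(_ _ m0) := wlim Cg.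
  apply: filterS => n; apply: contraTneq => ->.
  by rewrite subr0 gtr0_norm// ltxx.
(* For such [n] the set [S] contains the ball of radius [2 N], and both the truncation and the test
   pairing are below [eps]. *)
have ev3 : U [set n | 2 * N <= n.+1%:R /\ n.+1%:R^-1 <= eps].
  apply: Uoo; near=> n; split.
    have : 2 * N <= n%:R by near: n; exact: nbhs_infty_ger.
    by move/le_trans; apply; rewrite ler_nat.
  have : eps^-1 <= n%:R by near: n; exact: nbhs_infty_ger.
  move=> hn; rewrite invf_ple ?posrE//.
  by apply: (le_trans hn); rewrite ler_nat.
apply: filterS3 ev1 ev2 ev3 => n an gn [nN neps].
have bn : 2 * b <= n.+1%:R by apply: le_trans nN; lra.
have hfn := lip_bump_sub an hf hg.
have mufin q : (mus n (eball 0 q) < +oo)%E by exact: nice_eball_lty (nmus n).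
have hI := Rintegral_positive mufin.
have ifn : \int[mus n]_x ((fun x => f x - a n * g x) : B -> R) x = 0.
  rewrite (pf_sub hI)//; last exact: Cc_scale.
  by rewrite (pf_scale hI)// /a divfK// subrr.
have [delta [S [T [/andP[d0 dn] mS ST NS htest]]]] := small (lip_bump_mono bn hfn) ifn i.
rewrite -(pairing_sub i _ (nmus n) e0 Cf Cg Cw).
have NS' : eball (0 : E) (2 * N) `<=` S.
  by apply: subset_trans NS; apply: sub_eball; rewrite subrr enorm0 add0r.
have de : delta <= eps by rewrite (le_trans (ltW dn)).
have := pairing_indic s0 a01 C0 (hh i) (ltW L0) (nmus n) d0 de e1 b20 hfn ifn N1 Nb' mS ST NS'.
rewrite (test_pairingE _ (nmus n) d0 mS ST hfn) in htest.
move: htest; move: (pairing _ _ _ _ _ _ _) (pairing _ _ _ _ _ _ _) => p q pn pq.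
have -> : p = q - (q - p) by ring.
apply: (le_trans (ler_normB _ _)); apply: lerD => //.
by rewrite (le_trans (ltW pn)).
Unshelve. all: by end_near. Qed.

(** The quantity [Q] involves neither [eps] nor [N], yet is bounded by a multiple of
    [eps + N^-alpha], which can be made arbitrarily small. *)
Lemma limit_real_reflectionless x0 : (forall r, 0 < r -> (0 < nu (eball x0 r))%E) ->
  real_reflectionless nu.
Proof.
move=> hx0 i f psi b b' r c tau b0 hf if0 r0 hpsi t0 gap.
set Q := _ + _.
(* Large enough for [f] and for the correcting bump at [x0], whose [lip_bump] parameter is
   [2 + |x0|]. *)
pose b1 := b + (2 + enorm x0).
have e00 := enorm_ge0 x0.
have b10 : 0 < b1 by rewrite /b1; lra.
have hf1 : lip_bump b1 f by apply: lip_bump_mono hf; rewrite /b1; lra.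
pose c1 := 1 + 2 * error_const s alpha C L (2 * b1) 1.
pose c2 := (1 + `|c|) * error_const s alpha C L b1 b'.
pose K := `| (`|c| * c1) | + `|c2| + 1.
have K0 : 0 < K by rewrite /K ltr_wpDl// addr_ge0.
have key eps N : 0 < eps -> eps <= 1 / 2 -> eps <= tau -> 1 <= N -> 4 * b1 <= N -> r <= N ->
    `|Q| <= K * (eps + N `^ (- alpha)).
  move=> e0 e1 et N1 Nb Nr.
  have N0 : 0 < N by exact: lt_le_trans N1.
  have Nb2 : 2 * b1 <= N by lra.
  have Nr2 : r <= 2 * N by lra.
  have p0 : 0 <= N `^ (- alpha) by exact: powR_ge0.
  have hx0b : 2 + enorm x0 <= b1 by rewrite /b1; lra.
  have h1 := reflection_pairing s0 a01 C0 (hh i) (ltW L0) nnu e0 e1 et b10 hf1 if0 r0 hpsi gap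
    N1 Nb2 Nr2.
  have h2 := pairing_limit_le i e0 e1 N1 Nb b10 hx0b hx0 hf1 if0.
  rewrite -/Q -/c2 in h1.
  move: h1 h2; move: (pairing _ _ _ _ _ _ _) => p h1 h2.
  have {}h2 : `|p| <= c1 * (eps + N `^ (- alpha)).
    apply: (le_trans h2); rewrite /c1 [leRHS]mulrDl mul1r lerD2r lerDl.
    exact: powR_ge0.
  have -> : Q = (Q - c * p) + c * p by ring.
  apply: (le_trans (ler_normD _ _)); rewrite normrM.
  have h3 : `|c| * `|p| <= `|c| * c1 * (eps + N `^ (- alpha)) by rewrite -mulrA ler_wpM2l.
  apply: (le_trans (lerD h1 h3)).
  rewrite -mulrDl ler_wpM2r ?addr_ge0 ?(ltW e0)//.
  have := ler_norm c2; have := ler_norm (`|c| * c1); rewrite /K; lra.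
apply/eqP; rewrite -normr_le0; apply/ler_addgt0Pr => e e0; rewrite add0r.
(* Both [eps] and [N^-alpha] are made at most [t], for a total of [2 K t = e]. *)
pose t := e / (2 * K).
have tp : 0 < t by rewrite divr_gt0// mulr_gt0.
pose eps := Num.min (Num.min (1 / 2) tau) t.
pose N := Num.max (Num.max 1 (4 * b1)) (Num.max r (t `^ (- alpha^-1))).
have ep0 : 0 < eps by rewrite !lt_min t0 tp !andbT; lra.
have et : eps <= t by rewrite ge_min lexx orbT.
have N1 : 1 <= N by rewrite !le_max lexx.
have Nt : t `^ (- alpha^-1) <= N by rewrite !le_max lexx !orbT.
have hk := key eps N ep0.
apply: (le_trans (hk _ _ _ _ _)).
- by rewrite !ge_min lexx.
- by rewrite !ge_min lexx orbT.
- by [].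
- by rewrite !le_max lexx orbT.
- by rewrite !le_max lexx !orbT.
have Na : N `^ (- alpha) <= t.
  apply: (le_trans (powRN_le _ Nt (ltW a0))); first by rewrite powR_gt0.
  by rewrite -powRrM mulrNN mulVf ?gt_eqF// powRr1// ltW.
have -> : e = K * (t + t) by rewrite /t; field; rewrite gt_eqF.
by rewrite ler_pM2l// lerD.
Qed.

End limit.

(** The same integer governs the regularity of the test function, the admissible truncations and
    sets, and the lower bound. Failure for every [n] thus produces a sequence of measures satisfying
    [small], with the pairs of points confined to a fixed compact ball. *)
Lemma unit_scale_detection (L rho delta : R) : 0 < L -> 0 < delta ->
  (forall nu : {sigma_finite_measure set B -> \bar R}, AD_regular s nu ->
    real_reflectionless nu -> is_plane_measure s nu) ->
  exists n : nat, forall mu : {measure set B -> \bar R}, AD_regular_with s L mu ->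
    (exists x y : E, [/\ msupp mu x, msupp mu y, enorm x <= rho, enorm y <= rho &
      eball (2^-1 *: (x + y)) delta `&` msupp mu = set0]) ->
    exists psi, [/\ lip_bump n.+1%:R psi, \int[mu]_x (psi : B -> R) x = 0 &
      exists i, forall (t : R) (S : set B) (T : R), 0 < t < n.+1%:R^-1 -> measurable S ->
        S `<=` eball (0 : E) T -> eball (0 : E) n.+1%:R `<=` S ->
        n.+1%:R^-1 <= `|test_pairing mu i t S psi|].
Proof.
move=> L0 d0 hplane; apply: contrapT => /forallNP hno.
have /choice[F hF] : forall n, exists Fn : {sigma_finite_measure set B -> \bar R} * (E * E),
  [/\ AD_regular_with s L Fn.1,
     [/\ msupp Fn.1 Fn.2.1, msupp Fn.1 Fn.2.2, enorm Fn.2.1 <= rho, enorm Fn.2.2 <= rho &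
      eball (2^-1 *: (Fn.2.1 + Fn.2.2)) delta `&` msupp Fn.1 = set0] &
     forall psi, lip_bump n.+1%:R psi -> \int[Fn.1]_x (psi : B -> R) x = 0 ->
      forall i, exists (t : R) (S : set B) (T : R), [/\ 0 < t < n.+1%:R^-1, measurable S,
        S `<=` eball (0 : E) T, eball (0 : E) n.+1%:R `<=` S &
        `|test_pairing Fn.1 i t S psi| < n.+1%:R^-1]].
  move=> n; have := hno n => /existsNP[mu] /not_implyP[ADmu] /not_implyP[[x [y hxy]] hpsi].
  have [_ nmu _] := ADmu; have [mu' E'] := nice_sigma_finite_measure nmu.
  rewrite E' in ADmu hxy hpsi; exists (mu', (x, y)); split=> //= psi hb ip i.
  apply: contrapT => hi; apply: hpsi; exists psi; split=> //; exists i => t S T tn mS ST NS.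
  rewrite leNgt; apply/negP => hlt; apply: hi; exists t, S, T; split=> //.
pose mus n := (F n).1; pose xs n := (F n).2.1; pose ys n := (F n).2.2.
have [U [UU Uoo]] := @ultraFilterLemma nat \oo _.
have nmus n : nice s L (mus n) by have [[]] := hF n.
have lower n x r : msupp (mus n) x -> 0 < r -> ((L^-1 * r ^+ s)%:E <= mus n (eball x r))%E.
  by have [[_ _ +] _ _] := hF n; apply.
have [nu [nnu wlim]] := weak_limit_exists UU nmus.
have lims (zs : nat -> E) : (forall n, enorm (zs n) <= rho) ->
    exists z, forall r, 0 < r -> U [set n | enorm (zs n - z) < r].
  move=> zr; have := @compact_cball R d 0 rho; rewrite compact_ultra.
  move=> /(_ (zs @ U) (ultra_image_filter UU zs)) [].
    have : U (zs @^-1` [set y | enorm (y - 0) <= rho]).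
      by apply: filterS filterT => n _ /=; rewrite subr0.
    by [].
  move=> z [_ zz]; exists z => r r0.
  have : nbhs z (eball z r) by apply/nbhs_eballP; exists r.
  by move/zz.
have [x hx] : exists x, forall r, 0 < r -> U [set n | enorm (xs n - x) < r].
  by apply: lims => n; have [_ [_ _ + _ _] _] := hF n.
have [y hy] : exists y, forall r, 0 < r -> U [set n | enorm (ys n - y) < r].
  by apply: lims => n; have [_ [_ _ _ + _] _] := hF n.
have sx r : 0 < r -> (0 < nu (eball x r))%E.
  apply: (limit_support L0 UU nmus lower nnu wlim) => {}r r0.
  apply: filterS (hx _ r0) => n hn; exists (xs n) => //.
  by have [_ []] := hF n.
have sy r : 0 < r -> (0 < nu (eball y r))%E.
  apply: (limit_support L0 UU nmus lower nnu wlim) => {}r r0.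
  apply: filterS (hy _ r0) => n hn; exists (ys n) => //.
  by have [_ []] := hF n.
have ADnu : AD_regular s nu.
  exists (4 ^+ s * L); first by rewrite mulr_gt0// exprn_gt0.
  exact: (limit_AD_regular L0 UU nmus lower nnu wlim sx).
have Rnu : real_reflectionless nu.
  apply: (limit_real_reflectionless L0 UU Uoo nmus nnu wlim _ sx).
  by move=> n; have [_ _] := hF n.
(* Along the ultrafilter the midpoints are within [delta / 2] of [z], so the ball of radius
   [delta / 2] about [z] misses the supports; [limit_null] halves the radius once more. *)
have d2 : 0 < delta / 2 by rewrite divr_gt0.
have := plane_midpoint s0 (hplane nu ADnu Rnu) sx sy (divr_gt0 d2 (@ltr0n R 2)).
set z := 2^-1 *: (x + y).
suff nz : nu (eball z (delta / 2 / 2)) = 0%E.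
  by rewrite lt_neqAle => /andP[/eqP + _]; apply; exact: esym nz.
apply: (limit_null UU nmus nnu wlim) => //.
apply: filterS2 (hx _ d2) (hy _ d2) => n hxn hyn.
have [_ [_ _ _ _ hz] _] := hF n.
apply/seteqP; split=> // w [wz sw].
have : (eball (2^-1 *: ((F n).2.1 + (F n).2.2)) delta `&` msupp (F n).1) w.
  split=> //; rewrite /eball/=; rewrite /eball/= in wz.
  rewrite (_ : w - _ = (w - z) - 2^-1 *: ((xs n - x) + (ys n - y))).
    apply: (le_lt_trans (enormD _ _)); rewrite enormN enormZ ger0_norm//.
    have := enormD (xs n - x) (ys n - y); rewrite /= in hxn hyn; lra.
  by apply/rowP => j; rewrite /z !mxE; field.
by rewrite hz.
Qed.

End compactness.

(** * From the complex kernel to its real components *)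

Section complex_parts.
Variable R : realType.

Definition cpart (b : bool) (z : R[i]) : R := if b then complex.Im z else complex.Re z.

Lemma cpartD b (z w : R[i]) : cpart b (z + w) = cpart b z + cpart b w.
Proof. by case: b; case: z; case: w. Qed.

Lemma cpartN b (z : R[i]) : cpart b (- z) = - cpart b z.
Proof. by case: b; case: z. Qed.

Lemma cpartZ b (a : R) (z : R[i]) : cpart b (a%:C%C * z) = a * cpart b z.
Proof. by case: b; case: z => x y /=; rewrite ?mul0r ?subr0 ?addr0. Qed.

Lemma cpart_le b (z : R[i]) : `|cpart b z| <= Normc.normc z.
Proof.
case: z => x y; rewrite /Normc.normc -sqrtr_sqr ler_wsqrtr//.
by case: b => /=; rewrite ?lerDl ?lerDr sqr_ge0.
Qed.

Lemma cpart_le_cnorm n b (v : 'rV[R[i]]_n) j : `|cpart b (v ord0 j)| <= cnorm v.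
Proof.
apply: (le_trans (cpart_le _ _)); rewrite /cnorm -(ger0_norm (_ : 0 <= Normc.normc (v ord0 j))).
  by rewrite -sqrtr_sqr ler_wsqrtr// (bigD1 j)//= lerDl sumr_ge0// => i _; exact: sqr_ge0.
by case: (v ord0 j) => x y; exact: sqrtr_ge0.
Qed.

End complex_parts.

Section czo_numerator.
Variables (R : realType) (d d' s : nat) (alpha : R) (K : 'rV[R]_d -> 'rV[R[i]]_d').
Local Notation E := 'rV[R]_d.
Hypotheses (s0 : (0 < s)%N) (hK : is_CZO s alpha K).

(** The index is a coordinate together with the choice of real or imaginary part. The value at 0 is
    set to 0 since [K 0] is arbitrary. *)
Definition czo_part (i : 'I_d' * bool) (x : E) : R :=
  if x == 0 then 0 else enorm x `^ (s%:R + alpha) * cpart i.2 (K x ord0 i.1).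

Lemma czo_numerator : exists2 C : R, 0 <= C & forall i, numerator alpha C (czo_part i).
Proof.
have [size odd [/andP[a0 a1] [C0 holder]] hom] := hK.
have sa0 : s%:R + alpha != 0 by rewrite gt_eqF// ltr_wpDl.
(* The Hölder condition on [K] concerns nonzero points; when one point is 0 the size bound gives it
   with constant 1. *)
pose C := Num.max C0 1; exists C => [|[j b]]; first by rewrite le_max ler01 orbT.
have hsize x : `|czo_part (j, b) x| <= enorm x `^ alpha.
  rewrite /czo_part; have [->|x0] := eqVneq x 0; first by rewrite normr0 powR_ge0.
  have e0 : 0 < enorm x by rewrite enorm_gt0.
  rewrite normrM ger0_norm ?powR_ge0// powRD; last by rewrite (gt_eqF e0) implybT.
  rewrite powR_mulrn ?enorm_ge0// mulrAC; apply: ler_piMl; first exact: powR_ge0.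
  rewrite -ler_pdivlMl ?exprn_gt0// mulr1.
  exact: le_trans (cpart_le_cnorm b (K x) j) (size _ x0).
split=> //.
- move=> x; rewrite /czo_part oppr_eq0; have [_|x0] := eqVneq x 0; first by rewrite oppr0.
  by rewrite enormN (odd _ x0) /= mxE cpartN mulrN.
- move=> x y; have CC : 1 <= C by rewrite le_max lexx orbT.
  have p0 : 0 <= enorm (x - y) `^ alpha by exact: powR_ge0.
  have [x0|x0] := eqVneq x 0.
    rewrite {1}/czo_part x0 eqxx !sub0r normrN enormN.
    by apply: (le_trans (hsize y)); rewrite ler_peMl// powR_ge0.
  have [y0|y0] := eqVneq y 0.
    rewrite {2}/czo_part y0 eqxx !subr0.
    by apply: (le_trans (hsize x)); rewrite ler_peMl// powR_ge0.
  rewrite /czo_part (negbTE x0) (negbTE y0) /=.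
  have := cpart_le_cnorm b ((enorm x `^ (s%:R + alpha))%:C%C *: K x -
    (enorm y `^ (s%:R + alpha))%:C%C *: K y) j.
  rewrite !mxE cpartD cpartN !cpartZ => /le_trans; apply.
  apply: (le_trans (holder _ _ x0 y0)).
  by rewrite ler_wpM2r// le_max lexx.
- move=> l x l0; rewrite /czo_part scaler_eq0 (gt_eqF l0) /=.
  have [_|x0] := eqVneq x 0; first by rewrite mulr0.
  rewrite (hom _ _ x0 l0) mxE cpartZ enormZ gtr0_norm// powRM ?enorm_ge0 ?ltW//.
  rewrite powRD ?(gt_eqF l0) ?implybT// powR_mulrn ?ltW//=.
  have := exprn_gt0 s l0; move: (l ^+ s) (l `^ alpha) (_ `^ _) (cpart _ _) => u v p q u0.
  by field; rewrite gt_eqF.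
Qed.

Lemma czo_part_kreg i x : x != 0 -> kreg s alpha (czo_part i) 0 x = cpart i.2 (K x ord0 i.1).
Proof.
move=> x0; have e0 : 0 < enorm x by rewrite enorm_gt0.
rewrite /kreg /czo_part (negbTE x0) max_l ?ltW// powRN mulrAC.
by rewrite mulfV ?mul1r// gt_eqF// powR_gt0.
Qed.

Lemma czo_part_Kreg i delta x : 0 < delta ->
  kreg s alpha (czo_part i) delta x = cpart i.2 (Kreg s alpha K delta x ord0 i.1).
Proof.
move=> d0; rewrite /kreg /czo_part /Kreg; have [_|x0] := eqVneq x 0.
  by rewrite mxE mul0r; case: i.2.
rewrite mxE cpartZ mulrAC; congr (_ * _).
have m0 : 0 < Num.max (enorm x) delta by rewrite lt_max d0 orbT.
rewrite powRM ?invr_ge0 ?enorm_ge0 ?ltW//; congr (_ * _).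
by rewrite -powR_inv1 ?ltW// -powRrM mulN1r.
Qed.

End czo_numerator.

Section reflectionless_parts.
Variables (R : realType) (d d' s : nat) (alpha : R) (K : 'rV[R]_d -> 'rV[R[i]]_d').
Local Notation E := 'rV[R]_d.
Local Notation B := (borelE R d).

(** Four terms, one for each choice of real or imaginary parts of [f] and [psi]; shorter
    combinations are padded with zero coefficients. *)
Lemma Rintegral_lin4 disp (T : measurableType disp) (m : {measure set T -> \bar R})
    (f g p q : T -> R) (t u v w : R) :
  m.-integrable setT (EFin \o f) -> m.-integrable setT (EFin \o g) ->
  m.-integrable setT (EFin \o p) -> m.-integrable setT (EFin \o q) ->
  \int[m]_x (t * f x + u * g x + v * p x + w * q x) =
    t * \int[m]_x f x + u * \int[m]_x g x + v * \int[m]_x p x + w * \int[m]_x q x.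
Proof.
move=> hf hg hp hq.
have iZ a (F : T -> R) : m.-integrable setT (EFin \o F) ->
  m.-integrable setT (EFin \o (fun x => a * F x)).
  by move=> iF; exact: (@integrableZl _ _ _ m setT measurableT a _ iF).
have iD (F G : T -> R) : m.-integrable setT (EFin \o F) -> m.-integrable setT (EFin \o G) ->
  m.-integrable setT (EFin \o (fun x => F x + G x)).
  by move=> iF iG; exact: (@integrableD _ _ _ m setT measurableT _ _ iF iG).
rewrite RintegralD//; [|by apply: (iD _ _ (iD _ _ (iZ _ _ hf) (iZ _ _ hg)) (iZ _ _ hp))|exact: iZ].
rewrite RintegralD//; [|by apply: (iD _ _ (iZ _ _ hf) (iZ _ _ hg))|exact: iZ].
by rewrite RintegralD//; [|exact: iZ|exact: iZ]; rewrite !RintegralZl.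
Qed.

Lemma Lip0_lip_bump (f : E -> R[i]) : Lip0 f ->
  exists2 b, 0 < b & forall c, lip_bump b (fun x => cpart c (f x)).
Proof.
move=> [cf [C fl]]; have [r r0 fr] := compact_bounded cf.
have zf x : r <= enorm x -> f x = 0.
  move=> xr; apply/eqP; apply/negP => /negP fx; move: xr; rewrite leNgt => /negP; apply.
  rewrite -[x]subr0; apply: fr; exact: subset_closure.
have lip c x y : `|cpart c (f x) - cpart c (f y)| <= C * enorm (x - y).
  by rewrite -cpartN -cpartD; apply: (le_trans (cpart_le c _)); exact: fl.
have Cf c : Cc (fun x => cpart c (f x)).
  split; first exact: lipschitz_continuous (lip c).
  by exists r => x /zf ->; case: c.
have [M0 M00 h0] := Cc_bounded (Cf false); have [M1 M10 h1] := Cc_bounded (Cf true).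
exists (M0 + M1 + `|C| + r); first by have := normr_ge0 C; lra.
have C0 := normr_ge0 C.
move=> c; split.
- by move=> x; case: c; [have := h1 x|have := h0 x]; lra.
- move=> x y; apply: (le_trans (lip c x y)); rewrite ler_wpM2r ?enorm_ge0//.
  by have := ler_norm C; lra.
- by move=> x xr; rewrite zf; [case: c|lra].
Qed.

(** The integral of a nonnegative function is a supremum over simple functions below it, hence
    monotone for arbitrary such functions and an arbitrary set [A]. *)
Lemma integral_le_any disp (T : measurableType disp) (m : {measure set T -> \bar R})
    (A : set T) (f g : T -> \bar R) : (forall x, 0 <= f x)%E -> (forall x, 0 <= g x)%E ->
  (forall x, A x -> f x <= g x)%E -> (\int[m]_(x in A) f x <= \int[m]_x g x)%E.
Proof.
move=> f0 g0 fg; rewrite ge0_integralE; last by move=> x _; exact: f0.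
rewrite ge0_integralTE//; apply: le_ereal_sup => _ [k hk <-]; exists k => // x.
apply: (le_trans (hk x)); rewrite patchE; case: ifPn => [|_]; last exact: g0.
by rewrite inE => /fg.
Qed.

Section nice.
Variables (L : R) (nu : {sigma_finite_measure set B -> \bar R}).
Hypotheses (s0 : (0 < s)%N) (L0 : 0 < L) (nnu : nice s L nu).

Lemma nice_atomless (x : E) : nu [set x] = 0%E.
Proof.
apply/eqP; rewrite eq_le measure_ge0 andbT; apply/lee_addgt0Pr => e e0; rewrite add0e.
pose r := Num.min 1 (e / L).
have r0 : 0 < r by rewrite lt_min ltr01 divr_gt0.
apply: (@le_trans _ _ (nu (eball x r))).
  apply: le_measure; rewrite ?inE; [exact: measurable_singleton|exact: measurable_eball|].
  by move=> _ ->; exact: eball_center.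
apply: (le_trans (nnu x r0)); rewrite lee_fin mulrC -ler_pdivlMr//.
have r1 : r <= 1 by rewrite ge_min lexx.
apply: (@le_trans _ _ r); last by rewrite ge_min lexx orbT.
by rewrite -[leRHS]expr1 ler_wiXn2l// ltW.
Qed.

(** A compact set lies in a product of two balls of radius [r], where the integrand is
    [near_fun s (2 * r)] of the difference; its integral in one variable is bounded uniformly in the
    other. *)
Lemma nice_diffuse : diffuse s nu.
Proof.
split=> [x|A cA]; first exact: nice_atomless.
have [r r0 Ar] : exists2 r : R, 0 < r & forall z : E * E, A z -> enorm z.1 < r /\ enorm z.2 < r.
  have c1 : compact (fst @` A).
    by apply: continuous_compact => //; apply: continuous_subspaceT => x; exact: cvg_fst.
  have c2 : compact (snd @` A).
    by apply: continuous_compact => //; apply: continuous_subspaceT => x; exact: cvg_snd.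
  have [r1 r10 h1] := compact_bounded c1; have [r2 r20 h2] := compact_bounded c2.
  exists (r1 + r2); first exact: addr_gt0.
  move=> z Az; have := h1 z.1 (ex_intro2 _ _ z Az erefl).
  have := h2 z.2 (ex_intro2 _ _ z Az erefl); rewrite /eball/= !subr0 => z2 z1; split; lra.
pose F (z : B * B) := \1_(eball (0 : E) r : set B) z.1 * near_fun s (2 * r) ((z.1 : E) - z.2).
have mF : measurable_fun setT F.
  apply: measurable_funM; last exact: measurable_diff (measurable_near_fun s _).
  apply: (measurableT_comp _ measurable_fst); apply: measurable_indic; exact: measurable_eball.
have F0 z : 0 <= F z by rewrite /F mulr_ge0// near_fun_ge0.
have D0 : 0 <= L * 4 ^+ s * (2 * r) by rewrite !mulr_ge0// ?exprn_ge0// ltW.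
have [] // := @prod_rint_le R d s L nu nnu F (L * 4 ^+ s * (2 * r)) r D0 r0 mF.
- move=> x y xr; rewrite /F /= indicE memNset ?mul0r//= /eball/= subr0.
  by apply/negP; rewrite -leNgt.
- move=> x; have r20 : 0 < 2 * r by rewrite mulr_gt0.
  apply: le_trans (integral_near (ltW L0) nnu s0 x r20).
  apply: ge0_le_integral => //.
  + do 2 (apply: measurableT_comp => //).
    exact: (measurableT_comp mF (pair1_measurable (x : B))).
  + apply/measurable_EFinP.
    exact: (measurableT_comp (measurable_near_fun s (2 * r)) (measurable_shift x)).
  + move=> y _; rewrite lee_fin ger0_norm// /F/= indicE /near_fun enormB.
    case: (_ \in _); rewrite ?mul1r ?mul0r//; case: ifP => // _.
    by rewrite invr_ge0 exprn_ge0// enorm_ge0.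
move=> /integrableP[_ iF] _; apply: le_lt_trans iF.
apply: integral_le_any.
- by move=> z; rewrite lee_fin invr_ge0 exprn_ge0// enorm_ge0.
- by move=> z; exact: abse_ge0.
- move=> z Az; rewrite /= lee_fin ger0_norm// /F.
  have [z1 z2] := Ar z Az.
  rewrite indicE mem_set ?mul1r /near_fun; last by rewrite /eball/= subr0.
  rewrite ifT//; have := enormD z.1 (- z.2); rewrite enormN; lra.
Qed.

Lemma nice_restricted_growth : 0 < alpha -> restricted_growth s alpha nu.
Proof.
move=> a0; rewrite /restricted_growth.
apply: le_lt_trans (_ : (\int[nu]_y (far_fun (s%:R + alpha) 1 y)%:E < +oo)%E).
  apply: integral_le_any.
  - by move=> x; rewrite lee_fin powR_ge0.
  - by move=> x; rewrite lee_fin far_fun_ge0.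
  - by move=> x /= x1; rewrite /far_fun x1.
exact: le_lt_trans (integral_far (ltW L0) nnu a0 ltr01) (ltry _).
Qed.

Hypothesis hK : is_CZO s alpha K.

(** Each part of each coordinate of the complex pairing is a signed sum of four real functionals,
    all zero by hypothesis. The cutoff equals 1 on a [tau]-neighbourhood of the support of [f],
    which is compact, so its two parts are constant there. *)
Lemma czo_reflectionless : real_reflectionless s alpha (czo_part s alpha K) nu ->
  reflectionless s alpha K nu.
Proof.
move=> hrr; have [_ _ [a01 _] _] := hK; have a0 : 0 < alpha by case/andP: a01.
have [C C0 hh] := czo_numerator hK.
split; [exact: nice_diffuse|exact: nice_restricted_growth|].
move=> f hf if0 psi [hpsi [U [oU fU psi1]]].
have [b b0 hfb] := Lip0_lip_bump hf; have [r r0 hp] := Lip0_lip_bump hpsi.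
have if0c c : \int[nu]_x (fun x : B => cpart c (f x)) x = 0.
  by case: c; [have := congr1 (@complex.Im R) if0|have := congr1 (@complex.Re R) if0].
have [tau t0 gap] : exists2 tau : R, 0 < tau &
    forall x y, f x != 0 -> enorm (x - y) < tau -> psi y = 1.
  have [cf _] := hf.
  have : (0 : R)^'+ [set t | fsupp f `<=` [set x | forall y, enorm (x - y) < t -> U y]].
    apply: (@compact_near R d (fsupp f) R ((0 : R)^'+) 
      (fun t x => forall y, enorm (x - y) < t -> U y)) => // x fx.
    have [q q0 qU] : exists2 q : R, 0 < q & eball x q `<=` U.
      by apply/nbhs_eballP; apply: open_nbhs_nbhs; split=> //; exact: fU.
    exists (q / 2); first by rewrite divr_gt0.
    near=> t => x' x'x y x'y; apply: qU; rewrite /eball/=.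
    have tq : t < q / 2 by near: t; apply: nbhs_right_lt; rewrite divr_gt0.
    rewrite (_ : y - x = (x' - x) - (x' - y)); last by rewrite opprB [RHS]addrC addrA subrK.
    apply: (le_lt_trans (enormD _ _)); rewrite enormN; lra.
  move=> ht; have /filter_ex[t [t0 {}ht]] : (0 : R)^'+ [set t | 0 < t /\
      (fsupp f `<=` [set x | forall y, enorm (x - y) < t -> U y])].
    by apply: filterI => //; near=> t; rewrite /=; near: t; exact: nbhs_right_gt.
  exists t => // x y fx xy; apply: psi1; apply: (ht x) xy; exact: subset_closure.
have gapc a c x y : cpart a (f x) != 0 -> enorm (x - y) < tau -> cpart c (psi y) = (~~ c)%:R.
  move=> fx xy; rewrite (gap x y)//; first by case: c.
  by apply: contraNN fx => /eqP ->; case: a.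
pose k i := kreg s alpha (czo_part s alpha K i) 0.
pose S i a c := sym_kernel s alpha (czo_part s alpha K i) 0
  (fun x => cpart a (f x)) (fun x => cpart c (psi x)).
pose W i a c (y : B) := ((~~ c)%:R - cpart c (psi y)) *
  potential (k i) (fun x => cpart a (f x)) nu y.
have Q i a c : \int[(nu \x nu)%E]_z S i a c z + \int[nu]_y W i a c y = 0.
  exact: (hrr i _ _ b r r _ tau b0 (hfb a) (if0c a) r0 (hp c) t0 (gapc a c)).
have iS i a c : (nu \x nu)%E.-integrable setT (EFin \o S i a c).
  have m0 : 0 < Num.max b r by rewrite lt_max b0.
  have mono q (w : E -> R) : q <= Num.max b r -> lip_bump q w -> lip_bounded q (Num.max b r) w.
    by move=> qm [w1 w2 w3]; split=> // x qx; apply: w3; exact: le_trans qx.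
  apply: (sym_kernel_integrable s0 a01 (hh i) (ltW L0) nnu (lexx 0) m0
    (mono _ _ _ (hfb a)) (mono _ _ _ (hp c))).
  - by rewrite le_max lexx.
  - by rewrite le_max lexx orbT.
have iW i a c : nu.-integrable setT (EFin \o W i a c).
  exact: (outer_potential_integrable a01 C0 (hh i) (ltW L0) nnu b0 (hfb a) (if0c a) (hp c) t0 (gapc a c)).
apply/rowP => j; rewrite /Tpair_one_via !mxE.
(* The sign of the product of imaginary parts, or of the second cross term, in part [c] of a complex
   product; see [cmul] below. *)
pose u c : R := if c then 1 else -1.
suff H c : \int[(nu \x nu)%E]_z cpart c (((2^-1 * (f z.2 * psi z.1 - psi z.2 * f z.1)) *:
      K ((z.1 : E) - z.2)) ord0 j) +
    \int[nu]_x cpart c (((1 - psi x) *: Tmeas K nu f x) ord0 j) = 0.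
  have H0 := H false; have H1 := H true.
  by apply/eqP; rewrite eq_complex; apply/andP; split; apply/eqP; [exact: H0|exact: H1].
(* The overall sign is reversed because [sym_kernel] and [potential] are negatives of [Tpair] and
   [Tmeas]. A mixed choice of parts of [f] and [psi] exchanges the parts of [K], whence [~~ c]. *)
transitivity (\int[(nu \x nu)%E]_z (-1 * S (j, c) false false z + 1 * S (j, c) true true z +
     - u c * S (j, ~~ c) false true z + - u c * S (j, ~~ c) true false z) +
   \int[nu]_y (-1 * W (j, c) false false y + 1 * W (j, c) true true y +
     - u c * W (j, ~~ c) false true y + - u c * W (j, ~~ c) true false y)); last first.
  rewrite !Rintegral_lin4//.
  have := Q (j, c) false false; have := Q (j, c) true true.
  have := Q (j, ~~ c) false true; have := Q (j, ~~ c) true false.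
  move: (Rintegral _ _ (S (j, c) false false)) (Rintegral _ _ (S (j, c) true true))
    (Rintegral _ _ (S (j, ~~ c) false true)) (Rintegral _ _ (S (j, ~~ c) true false)).
  move: (Rintegral _ _ (W (j, c) false false)) (Rintegral _ _ (W (j, c) true true))
    (Rintegral _ _ (W (j, ~~ c) false true)) (Rintegral _ _ (W (j, ~~ c) true false)).
  move=> w1 w2 w3 w4 v1 v2 v3 v4 e4 e3 e2 e1.
  rewrite (_ : _ + _ = - (v1 + w1) + (v2 + w2) - u c * (v3 + w3) - u c * (v4 + w4)); last by ring.
  by rewrite e1 e2 e3 e4 !mulr0 !subr0 addr0 oppr0.
have cmul (v w : R[i]) : cpart c (v * w) =
    cpart false v * cpart c w + u c * (cpart true v * cpart (~~ c) w).
  by rewrite /u; case: c; case: v => v1 v2; case: w => w1 w2 /=; ring.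
congr (_ + _); apply: eq_Rintegral.
  move=> [x y] _ /=; rewrite mxE /S /sym_kernel /=.
  have [->|xy] := eqVneq x y.
    rewrite [psi y * f y]mulrC !subrr !(kreg0 _ a01 (hh _)) !mul0r !mulr0 mul0r !addr0.
    by case: (c).
  have xy0 : x - y != 0 by rewrite subr_eq0.
  rewrite !(czo_part_kreg s alpha K _ xy0) /=.
  have -> : (2^-1 : R[i]) = (2^-1 : R)%:C%C by rewrite fmorphV rmorph_nat.
  rewrite cmul !cpartZ; move: (K (x - y) ord0 j) (f x) (f y) (psi x) (psi y).
  move=> [k1 k2] [x1 x2] [y1 y2] [p1 p2] [q1 q2]; rewrite /u.
  by case: (c) => /=; field.
move=> x _; rewrite mxE /W.
(* Where [psi] is 1 both sides vanish. Elsewhere [f] vanishes within [tau] of [x], so the singular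
   kernel can be integrated against it. *)
have [px|px] := eqVneq (psi x) 1.
  rewrite px subrr mul0r /= !subrr !mul0r !mulr0 !addr0; by case: (c).
have fxy y : enorm (y - x) < tau -> f y = 0.
  move=> yx; apply/eqP; apply: contraNT px => fy; apply/eqP; exact: gap fy yx.
have fx : f x = 0 by apply: fxy; rewrite subrr enorm0.
have iV i a : nu.-integrable setT (EFin \o (fun y : B => k i ((y : E) - x) * cpart a (f y))).
  have mufin q : (nu (eball 0 q) < +oo)%E by exact: nice_eball_lty nnu.
  have Cf : Cc (fun y => cpart a (f y)) by apply: (@lip_bounded_Cc R d b b); exact: hfb.
  have := integrable_Cc mufin (Cc_mull (translate_continuous (y := x)
    (kreg_continuous a01 (hh i) t0)) Cf) => /(_ s).
  apply: eq_integrable => // y _ /=; congr EFin.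
  have [yx|yx] := ltP (enorm (y - x)) tau; first by rewrite fxy//; case: (a); rewrite !mulr0.
  by congr (_ * _); apply/esym/kreg_eq => //; exact: ltW.
have E b' : cpart b' (Tmeas K nu f x ord0 j) =
    - (potential (k (j, b')) (fun y => cpart false (f y)) nu x +
       u b' * potential (k (j, ~~ b')) (fun y => cpart true (f y)) nu x).
  transitivity (\int[nu]_y cpart b' ((f y *: K (x - y)) ord0 j)); first by rewrite mxE; case: b'.
  transitivity (\int[nu]_y ( -1 * (k (j, b') ((y : E) - x) * cpart false (f y)) +
      - u b' * (k (j, ~~ b') ((y : E) - x) * cpart true (f y)) +
      0 * (k (j, ~~ b') ((y : E) - x) * cpart true (f y)) +
      0 * (k (j, ~~ b') ((y : E) - x) * cpart true (f y)))); last first.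
    rewrite Rintegral_lin4// /potential.
    by move: (Rintegral _ _ _) (Rintegral _ _ _) => v w; ring.
  apply: eq_Rintegral => y _; rewrite mxE.
  have [->|xy] := eqVneq y x.
    by rewrite fx mul0r; case: (b') => /=; rewrite !mulr0 !addr0.
  have xy0 : x - y != 0 by rewrite subr_eq0 eq_sym.
  rewrite -[(y : E) - x]opprB /k !(kreg_odd _ (hh _)) !(czo_part_kreg s alpha K _ xy0) /=.
  move: (K (x - y) ord0 j) (f y) => [k1 k2] [y1 y2]; rewrite /u.
  by case: (b') => /=; ring.
rewrite cmul !E negbK.
move: (potential (k (j, c)) (fun y => cpart false (f y)) nu x)
  (potential (k (j, c)) (fun y => cpart true (f y)) nu x)
  (potential (k (j, ~~ c)) (fun y => cpart false (f y)) nu x)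
  (potential (k (j, ~~ c)) (fun y => cpart true (f y)) nu x) => v1 v2 v3 v4.
move: (psi x) => [p1 p2]; rewrite /u.
by case: (c) => /=; ring.
Unshelve. all: by end_near. Qed.

End nice.
End reflectionless_parts.

(** * Almost orthogonality *)

Section dyadic_counting.
Variables (R : realType) (d : nat).
Local Notation E := 'rV[R]_d.

Lemma sum_inj_le (I : eqType) (T : finType) (r : seq I) (f : I -> T) (g : T -> R) :
  uniq r -> {in r &, injective f} -> (forall t, 0 <= g t) ->
  \sum_(x <- r) g (f x) <= \sum_t g t.
Proof.
move=> ur fi g0; rewrite -(big_map f xpredT g) (big_uniq _ (_ : uniq (map f r))).
  by rewrite [leRHS](bigID (mem (map f r)))/= lerDl sumr_ge0.
by rewrite map_inj_in_uniq.
Qed.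

Variable o : int -> E.

Definition grid_cube (Q : cube R d) := exists (k : int) (m : 'rV[int]_d),
  Q = (o k + (2 : R) ^ k *: map_mx intr m, (2 : R) ^ k).

Lemma grid_side_gt0 Q : grid_cube Q -> 0 < side Q.
Proof. by move=> [k [m ->]]; rewrite /side/= exprz_gt0. Qed.

Lemma sum_half_le n : \sum_(j < n) 2^-1 ^+ j <= 2 :> R.
Proof.
rewrite -(big_mkord xpredT (fun j => 2^-1 ^+ j)).
have := @sum_geometric_le R 2^-1 n; have -> : (1 - 2^-1)^-1 = 2 :> R by field.
by apply; apply/andP; split; lra.
Qed.

(* A larger cube close to [Q'] is determined by its relative generation and by
   the integer offset of its corner from the grid cell of the corner of [Q']. *)
Lemma near_cubes_sum (X : seq (cube R d)) (n : nat) (Q' : cube R d) :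
  uniq X -> {in X, forall Q, grid_cube Q} -> grid_cube Q' ->
  \sum_(Q <- X | (side Q' <= side Q) && (enorm (Q.1 - Q'.1) <= n%:R * side Q))
     side Q' / side Q <= 2 * ((2 * n).+3 ^ d)%:R.
Proof.
move=> uX gX gQ'.
have /choice[p hp] : forall Q, exists p : int * 'rV[int]_d, grid_cube Q ->
    Q = (o p.1 + (2 : R) ^ p.1 *: map_mx intr p.2, (2 : R) ^ p.1).
  move=> Q; have [[k [m QE]]|nQ] := pselect (grid_cube Q); first by exists (k, m).
  by exists (0, 0) => /nQ.
have sideE Q : grid_cube Q -> side Q = (2 : R) ^ (p Q).1 by move/hp => {1}->.
have cornerE Q i : grid_cube Q ->
    Q.1 ord0 i = o (p Q).1 ord0 i + (2 : R) ^ (p Q).1 * ((p Q).2 ord0 i)%:~R.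
  by move/hp => {1}->; rewrite /= !mxE.
pose k' := (p Q').1.
rewrite -big_filter; set Y := [seq _ <- _ | _].
have uY : uniq Y by exact: filter_uniq.
have hY Q : Q \in Y -> [/\ grid_cube Q, side Q' <= side Q & enorm (Q.1 - Q'.1) <= n%:R * side Q].
  by rewrite mem_filter => /andP[/andP[-> ->] /gX].
have k'k Q : Q \in Y -> k' <= (p Q).1.
  by move/hY => [gQ + _]; rewrite !sideE// ler_eXz2l// ltr1n.
pose gen Q := `|(p Q).1 - k'|%N.
have genE Q : Q \in Y -> (p Q).1 = k' + (gen Q)%:Z.
  by move=> /k'k; rewrite -subr_ge0 /gen => /gez0_abs ->; ring.
pose J := (\max_(Q <- Y) gen Q)%N.
have genJ Q : Q \in Y -> (gen Q < J.+1)%N.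
  by move=> QY; rewrite ltnS /J; exact: leq_bigmax_seq.
(* The corner of [Q'] in the coordinates of the grid containing [Q]; it depends on [Q] only through
   its generation, which makes the encoding injective. *)
pose c Q i : R := (Q'.1 ord0 i - o (p Q).1 ord0 i) / (2 : R) ^ (p Q).1.
pose z Q i : int := (p Q).2 ord0 i - Num.floor (c Q i).
(* The offset differs from a number of absolute value at most [n] by less than 1; adding [n + 1]
   puts it among [2 n + 3] natural numbers. *)
have zn Q i : Q \in Y -> 0 <= z Q i + n.+1%:Z <= (2 * n).+2%:Z.
  move=> QY; have [gQ _ near] := hY Q QY.
  have k0 : 0 < (2 : R) ^ (p Q).1 by rewrite exprz_gt0.
  have : `|((p Q).2 ord0 i)%:~R - c Q i| <= n%:R.
    rewrite -(ler_pM2r k0) -{2}sideE//.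
    apply: le_trans near; apply: le_trans (coord_le_enorm _ i).
    rewrite !mxE cornerE// /c -{2}(gtr0_norm k0) -normrM le_eqVlt; apply/orP; left.
    apply/eqP; congr `|_|.
    by move: (2 ^ _) k0 => t t0; field; rewrite gt_eqF.
  have /andP[] := floor_itv (c Q i).
  rewrite intrD /z ler_norml => f1 f2 /andP[m1 m2]; apply/andP; split.
    rewrite -(ler_int R) !rmorphD/= rmorphN/=; lra.
  rewrite -(ler_int R) !rmorphD/= rmorphN/=; lra.
pose w (Q : cube R d) : {ffun 'I_d -> 'I_(2 * n).+3} := [ffun i => inord `|(z Q i + n.+1%:Z)%R|%N].
pose f (Q : cube R d) : 'I_J.+1 * {ffun 'I_d -> 'I_(2 * n).+3} := (inord (gen Q), w Q).
pose g (t : 'I_J.+1 * {ffun 'I_d -> 'I_(2 * n).+3}) : R := 2^-1 ^+ t.1.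
have fi : {in Y &, injective f}.
  move=> Q1 Q2 Y1 Y2 [/(congr1 val)]; rewrite /= !inordK ?genJ// => gE wE.
  have kE : (p Q1).1 = (p Q2).1 by rewrite !genE// gE.
  have [[g1 _ _] [g2 _ _]] := (hY _ Y1, hY _ Y2).
  rewrite (hp Q1 g1) (hp Q2 g2) kE; congr (_ + _ *: map_mx _ _, _).
  apply/rowP => i; have /andP[z10 z11] := zn Q1 i Y1; have /andP[z20 z21] := zn Q2 i Y2.
  have /ffunP/(_ i) := wE; rewrite !ffunE => /(congr1 val) /=.
  rewrite !inordK ?ltnS -?lez_nat ?gez0_abs// => /(congr1 Posz).
  by rewrite !gez0_abs// => /addIr; rewrite /z /c kE => /addIr.
rewrite (_ : \sum_(Q <- Y) _ = \sum_(Q <- Y) g (f Q)); last first.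
  apply: eq_big_seq => Q QY; have [gQ _ _] := hY Q QY.
  rewrite /g /f /= inordK ?genJ// !sideE// (genE Q QY) -/k'.
  rewrite expfzDr ?pnatr_eq0// invfM mulrA mulfV ?mul1r ?exprVn//.
  by rewrite gt_eqF// exprz_gt0.
apply: (le_trans (sum_inj_le uY fi _)); first by move=> t; rewrite /g exprn_ge0// invr_ge0.
rewrite -(pair_bigA _ (fun j _ => 2^-1 ^+ (j : 'I__)))/=.
under eq_bigr do rewrite sumr_const card_ffun !card_ord -[_ *+ _]mulr_natr.
by rewrite -mulr_suml ler_wpM2r// sum_half_le.
Qed.

End dyadic_counting.

Section almost_orthogonality.
Variables (R : realType) (d s : nat) (o : int -> 'rV[R]_d).
Local Notation E := 'rV[R]_d.
Local Notation B := (borelE R d).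
Variables (L : R) (mu : {sigma_finite_measure set B -> \bar R}).
Hypotheses (L0 : 0 < L) (nmu : nice s L mu).

(** Normalized in sup norm at the scale of the cube; the lower corner [Q.1] serves as base point. *)
Definition adapted (M : R) (Q : cube R d) (psi : E -> R) :=
  [/\ forall x, `|psi x| <= M,
      forall x y, `|psi x - psi y| <= M / side Q * enorm (x - y) &
      forall x, M * side Q <= enorm (x - Q.1) -> psi x = 0].

Lemma adapted_Cc M Q psi : adapted M Q psi -> Cc psi.
Proof.
move=> [_ pl p0]; split; first exact: lipschitz_continuous pl.
exists (M * side Q + enorm Q.1) => x xr; apply: p0.
by have := enorm_subl x Q.1; lra.
Qed.

Let mufin q : (mu (eball 0 q) < +oo)%E. Proof. exact: nice_eball_lty nmu. Qed.
Let hI := Rintegral_positive mufin.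

(* [psi'] has mean zero, so [psi] may be replaced by its oscillation on the
   support of [psi'], which is O(side Q' / side Q). *)
Lemma adapted_pairing_le M (Q Q' : cube R d) psi psi' : 0 < M -> 0 < side Q' ->
  side Q' <= side Q -> adapted M Q psi -> adapted M Q' psi' ->
  \int[mu]_x (psi' : B -> R) x = 0 ->
  `|\int[mu]_x (psi x * psi' x)| <= M ^+ 3 * (L * M ^+ s) * (side Q' ^+ s * (side Q' / side Q)).
Proof.
move=> M0 l'0 l'l hpsi hpsi' ip.
have l0 : 0 < side Q by exact: lt_le_trans l'l.
have Cp := adapted_Cc hpsi; have Cp' := adapted_Cc hpsi'.
have [pb pl p0] := hpsi; have [pb' pl' p0'] := hpsi'.
have r0 : 0 < M * side Q' by rewrite mulr_gt0.
pose a := psi Q'.1.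
have b0 : 0 <= M / side Q * (M * side Q') * M.
  by rewrite !mulr_ge0 ?invr_ge0// ltW.
pose F (x : B) := psi x * psi' x - a * psi' x.
have mF : measurable_fun setT F.
  by apply: continuous_measurable; case: (Cc_sub (Cc_mull Cp.1 Cp') (Cc_scale a Cp')).
have F0 (x : E) : M * side Q' <= enorm (x - Q'.1) -> F x = 0.
  by move=> xr; rewrite /F p0'// !mulr0 subr0.
have Fb (x : E) : `|F x| <= M / side Q * (M * side Q') * M.
  have [xr|/ltW xr] := leP (M * side Q') (enorm (x - Q'.1)); first by rewrite F0// normr0.
  rewrite /F -mulrBl normrM; apply: ler_pM => //.
  by apply: (le_trans (pl _ _)); rewrite ler_wpM2l// divr_ge0// ltW.
have [_] := rint_bounded_at nmu b0 r0 mF Fb F0.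
rewrite (pf_sub hI (Cc_mull Cp.1 Cp') (Cc_scale a Cp')) (pf_scale hI)// ip mulr0 subr0.
move/le_trans; apply; rewrite le_eqVlt; apply/orP; left; apply/eqP.
by rewrite exprMn; field; rewrite gt_eqF.
Qed.

Lemma adapted_far M (Q Q' : cube R d) psi psi' x : adapted M Q psi -> adapted M Q' psi' ->
  M * side Q + M * side Q' <= enorm (Q.1 - Q'.1) -> psi x * psi' x = 0.
Proof.
move=> [_ _ p0] [_ _ p0'] far.
have [xQ|xQ] := leP (M * side Q) (enorm (x - Q.1)); first by rewrite p0// mul0r.
rewrite p0' ?mulr0//.
have := enormD (Q.1 - x) (x - Q'.1); rewrite addrA subrK (enormB Q.1 x); lra.
Qed.

(** A factor 2 for the two orders of a pair, the constant of [adapted_pairing_le] at [M = n + 1],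
    and the bound of [near_cubes_sum] for the distance [2 M side Q], beyond which the supports are
    disjoint. *)
Definition gram_const (n : nat) : R :=
  4 * (n.+1%:R ^+ 3 * (L * n.+1%:R ^+ s)) * ((2 * (2 * n.+1)).+3 ^ d)%:R.

(** Each Gram entry is charged to the ordered pair with the larger cube first. With the smaller cube
    fixed, [near_cubes_sum] bounds the sum of side ratios over the larger ones. *)
Lemma gram_sum_le (n : nat) (X : seq (cube R d)) (psi : cube R d -> E -> R)
    (a : cube R d -> R) : uniq X -> {in X, forall Q, grid_cube o Q} ->
  (forall Q, Cc (psi Q)) -> {in X, forall Q, adapted n.+1%:R Q (psi Q)} ->
  {in X, forall Q, \int[mu]_x (psi Q : B -> R) x = 0} -> (forall Q, `|a Q| <= 1) ->
  \int[mu]_x (\sum_(Q <- X) a Q * psi Q x) ^+ 2 <= gram_const n * \sum_(Q <- X) side Q ^+ s.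
Proof.
move=> uX gX Cp hp ip a1; set M : R := n.+1%:R; have M0 : 0 < M by rewrite ltr0n.
pose G (Q Q' : cube R d) := \int[mu]_x (psi Q x * psi Q' x).
pose c := M ^+ 3 * (L * M ^+ s).
have c0 : 0 <= c by rewrite /c !mulr_ge0 ?exprn_ge0// ltW.
pose t (Q Q' : cube R d) := if (side Q' <= side Q) &&
    (enorm (Q.1 - Q'.1) <= (2 * n.+1)%:R * side Q)
  then c * (side Q' ^+ s * (side Q' / side Q)) else 0.
have t0 Q Q' : Q \in X -> Q' \in X -> 0 <= t Q Q'.
  move=> /gX/grid_side_gt0 l0 /gX/grid_side_gt0 l'0; rewrite /t; case: ifP => // _.
  by rewrite !mulr_ge0 ?invr_ge0 ?exprn_ge0// ltW.
have Gt Q Q' : Q \in X -> Q' \in X -> side Q' <= side Q -> `|G Q Q'| <= t Q Q'.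
  move=> QX QX' l'l; rewrite /t l'l /=; case: ifPn => [_|].
    apply: adapted_pairing_le (hp _ QX) (hp _ QX') (ip _ QX') => //.
    exact: grid_side_gt0 (gX _ QX').
  rewrite -ltNge natrM -/M => far.
  have -> : G Q Q' = \int[mu]_x (cst 0 : B -> R) x.
    apply: eq_Rintegral => x _; apply: (adapted_far x (hp _ QX) (hp _ QX')).
    have := ler_pM2l M0 (side Q') (side Q); rewrite l'l -/M => h; lra.
  by rewrite /Rintegral integral0 normr0.
have Gtt Q Q' : Q \in X -> Q' \in X -> `|G Q Q'| <= t Q Q' + t Q' Q.
  move=> QX QX'; have [l'l|/ltW ll'] := leP (side Q') (side Q).
    by apply: (le_trans (Gt _ _ QX QX' l'l)); rewrite lerDl t0.
  have -> : G Q Q' = G Q' Q by apply: eq_Rintegral => x _; rewrite mulrC.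
  by apply: (le_trans (Gt _ _ QX' QX ll')); rewrite lerDr t0.
have -> : \int[mu]_x (\sum_(Q <- X) a Q * psi Q x) ^+ 2 =
    \sum_(Q <- X) \sum_(Q' <- X) (a Q * a Q') * G Q Q'.
  under eq_Rintegral do rewrite expr2 big_distrlr/=.
  have CG Q Q' : Cc (fun x => a Q * psi Q x * (a Q' * psi Q' x)).
    by apply: Cc_mull; [exact: (Cc_scale (a Q) (Cp Q)).1|exact: Cc_scale].
  rewrite (pf_sum hI); last by move=> Q; apply: Cc_sum => Q' _.
  apply: eq_bigr => Q _; rewrite (pf_sum hI)//; apply: eq_bigr => Q' _.
  rewrite -(pf_scale hI); last exact: Cc_mull (Cp Q).1 (Cp Q').
  by apply: eq_Rintegral => x _; ring.
apply: (@le_trans _ _ (\sum_(Q <- X) \sum_(Q' <- X) (t Q Q' + t Q' Q))).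
  rewrite big_seq [leRHS]big_seq; apply: ler_sum => Q QX.
  rewrite big_seq [leRHS]big_seq; apply: ler_sum => Q' QX'.
  apply: (le_trans (ler_norm _)); rewrite normrM.
  apply: le_trans (Gtt _ _ QX QX'); rewrite ler_piMl// normrM.
  by rewrite mulr_ile1.
under eq_bigr do rewrite big_split/=.
rewrite big_split/= [X in X + _]exchange_big/= -mulr2n -mulr_natl.
rewrite (_ : gram_const n * _ = 2 * \sum_(Q <- X) (c * side Q ^+ s *
  (2 * ((2 * (2 * n.+1)).+3 ^ d)%:R))); last first.
  by rewrite -mulr_suml -mulr_sumr /gram_const -/M /c; ring.
rewrite ler_wpM2l// big_seq [leRHS]big_seq; apply: ler_sum => Q' QX'.
rewrite /t -big_mkcond/= -mulr_sumr -mulr_sumr mulrA ler_wpM2l//.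
  by rewrite mulr_ge0// exprn_ge0// ltW// (grid_side_gt0 (gX _ QX')).
exact: near_cubes_sum uX gX (gX _ QX').
Qed.

(** Expand the integral of [(l G - F)^2 >= 0] at [l = 1 / (M C)]. Then [l^2 C sigma = l sigma / M],
    so the square term cancels half of the cross term and [l sigma / M] is at most the integral of
    [F^2]. *)
Lemma sum_le_of_duality (G F : E -> R) (T M0 M C sigma : R) : Cc G ->
  measurable_fun setT (F : B -> R) -> (forall x, `|F x| <= M0) ->
  (forall x, T <= enorm x -> F x = 0) -> 0 < M -> 0 < C ->
  sigma / M <= \int[mu]_x (G x * F x) -> \int[mu]_x (G x) ^+ 2 <= C * sigma ->
  sigma <= M ^+ 2 * C * \int[mu]_x (F x) ^+ 2.
Proof.
move=> CG mF FM F0 Mp Cp hGF hGG.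
have [N N0 GN] := Cc_bounded CG.
have mG : measurable_fun setT (G : B -> R) by exact: continuous_measurable CG.1.
have iF H K : measurable_fun setT (H : B -> R) -> (forall x, `|H x| <= K) ->
    mu.-integrable setT (EFin \o (fun x : B => H x * F x)).
  move=> mH HK; apply: (@integrable_bounded _ _ mu _ (eball 0 T) (K * M0)) => //.
  - exact: measurable_eball.
  - exact: mufin.
  - exact: measurable_funM.
  - by move=> x; rewrite normrM ler_pM.
  - by move=> x /negP; rewrite /eball/= subr0 -leNgt => /F0 ->; rewrite mulr0.
have iGG : mu.-integrable setT (EFin \o (fun x : B => G x ^+ 2)).
  by apply: integrable_Cc => //; have := Cc_mull CG.1 CG; under eq_fun do rewrite -expr2.
have iFF : mu.-integrable setT (EFin \o (fun x : B => F x ^+ 2)).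
  by have := iF F M0 mF FM; under eq_fun do rewrite -expr2.
pose l := (M * C)^-1.
have : 0 <= \int[mu]_x (l * G x - F x) ^+ 2 by apply: Rintegral_ge0 => x _; exact: sqr_ge0.
have -> : \int[mu]_x (l * G x - F x) ^+ 2 =
    \int[mu]_x (1 * (F x) ^+ 2 + l ^+ 2 * (G x) ^+ 2 + (- 2 * l) * (G x * F x) + 0 * (G x * F x)).
  by apply: eq_Rintegral => x _; ring.
have iGF := iF G N mG GN.
rewrite Rintegral_lin4//.
move: hGF hGG; move: (\int[mu]_x (G x * F x)) (\int[mu]_x (G x) ^+ 2) (\int[mu]_x (F x) ^+ 2).
move=> u g f hu hg hf.
have l0 : 0 < l by rewrite invr_gt0 mulr_gt0.
have h1 : l ^+ 2 * g <= l ^+ 2 * (C * sigma) by rewrite ler_wpM2l// exprn_ge0// ltW.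
have h2 : l * (sigma / M) <= l * u by rewrite ler_wpM2l// ltW.
have e1 : l ^+ 2 * (C * sigma) = l * (sigma / M) by rewrite /l; field; rewrite !gt_eqF.
have h3 : l * (sigma / M) <= f by rewrite -e1 in h2 *; nra.
rewrite -ler_pdivrMl ?mulr_gt0 ?exprn_gt0//.
by apply: le_trans h3; rewrite /l le_eqVlt; apply/orP; left; apply/eqP; field; rewrite !gt_eqF.
Qed.

End almost_orthogonality.

(** * Cubes of arbitrary size *)

Section rescaling.
Variables (R : realType) (d s : nat).
Local Notation E := 'rV[R]_d.
Local Notation B := (borelE R d).

Lemma msupp_eballP (mu : {measure set B -> \bar R}) (x : E) :
  msupp mu x <-> forall r, 0 < r -> (0 < mu (eball x r))%E.
Proof.
split=> [sx r r0|hx U oU Ux].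
  by apply: sx; [exact: (@open_eball R d x r)|exact: eball_center].
have [r r0 rU] : exists2 r : R, 0 < r & eball x r `<=` U.
  by apply/nbhs_eballP; exact: open_nbhs_nbhs.
apply: lt_le_trans (hx r r0) _; apply: le_measure => //; rewrite ?inE.
  exact: measurable_eball.
exact: measurable_open.
Qed.

(** Infinite values are included, so the change of variables in [rescaled_measure] covers every
    measurable function. *)
Lemma fine_scale_sub (k : R) (a b : \bar R) : 0 < k ->
  fine (k%:E * a - k%:E * b) = k * fine (a - b).
Proof.
by move=> k0; case: a => [a||]; case: b => [b||] //=;
  rewrite ?gt0_muley ?gt0_muleNy ?lte_fin//= ?mulr0// mulrBr.
Qed.

Variables (mu : {measure set B -> \bar R}) (o : E) (l : R).
Hypothesis l0 : 0 < l.
Local Notation phi := (fun x : B => (l^-1 *: ((x : E) - o)) : B).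

(** The factor [l^-s] preserves the regularity constant, so that one integer found at unit scale
    serves cubes of every size. *)
Lemma rescaled_measure : exists nu : {measure set B -> \bar R},
  (forall A, nu A = ((l ^- s)%:E * mu (phi @^-1` A))%E) /\
  (forall f : B -> R, measurable_fun setT f ->
     \int[nu]_x f x = l ^- s * \int[mu]_x f (phi x)).
Proof.
have mphi : measurable_fun setT phi by exact: measurable_affine.
pose m1 := measure_function_pushforward__canonical__measure_function_Measure mu mphi.
have k0 : 0 <= l ^- s by rewrite invr_ge0 exprn_ge0// ltW.
exists (mscale (NngNum k0) m1); split=> // f mf.
rewrite /Rintegral integralE [in RHS]integralE -fine_scale_sub ?invr_gt0 ?exprn_gt0//.
have mEf : measurable_fun setT (EFin \o f) by exact/measurable_EFinP.
rewrite !ge0_integral_mscale//; [|exact: measurable_funeneg|exact: measurable_funepos].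
rewrite /m1 /= !(ge0_integral_pushforward mphi)//.
- rewrite preimage_setT; congr (fine (_ * _ - _ * _))%E; apply: eq_integral => x _.
    by rewrite -funepos_comp.
  by rewrite -funeneg_comp.
- exact: measurable_funeneg.
- exact: measurable_funepos.
Qed.

Variable nu : {measure set B -> \bar R}.
Hypothesis nuE : forall A, nu A = ((l ^- s)%:E * mu (phi @^-1` A))%E.

Lemma rescaled_eball x r : nu (eball x r) = ((l ^- s)%:E * mu (eball (o + l *: x) (l * r)))%E.
Proof.
rewrite nuE; congr (_ * mu _)%E; apply/seteqP.
have e y : enorm (l^-1 *: (y - o) - x) = l^-1 * enorm (y - (o + l *: x)).
  rewrite -[l^-1 in RHS]gtr0_norm ?invr_gt0// -enormZ; congr enorm.
  by rewrite opprD addrA [RHS]scalerBr scalerA mulVf ?scale1r// gt_eqF.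
by split=> y; rewrite /eball/= e ltr_pdivrMl.
Qed.

Lemma rescaled_msupp x : msupp nu x <-> msupp mu (o + l *: x).
Proof.
have ls0 : 0 < l ^- s by rewrite invr_gt0 exprn_gt0.
split=> /msupp_eballP hx; apply/msupp_eballP => r r0.
  have := hx (l^-1 * r); rewrite rescaled_eball mulrA mulfV ?gt_eqF// mul1r.
  by rewrite mulr_gt0 ?invr_gt0// pmule_rgt0 ?lte_fin//; apply.
by rewrite rescaled_eball mule_gt0 ?lte_fin// hx// mulr_gt0.
Qed.

Lemma rescaled_AD_regular L : AD_regular_with s L mu -> AD_regular_with s L nu.
Proof.
have ls0 : 0 < l ^- s by rewrite invr_gt0 exprn_gt0.
move=> [mu0 nmu lmu]; split.
- by rewrite nuE preimage_setT mule_neq0// eqe gt_eqF.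
- move=> x r r0; rewrite rescaled_eball.
  apply: (@le_trans _ _ ((l ^- s)%:E * (L * (l * r) ^+ s)%:E)%E).
    by apply: lee_wpmul2l; [rewrite lee_fin ltW|apply: nmu; rewrite mulr_gt0].
  rewrite -EFinM lee_fin exprMn le_eqVlt; apply/orP; left; apply/eqP.
  by move: (l ^+ s) (exprn_gt0 s l0) => u u0; field; rewrite gt_eqF.
- move=> x r /rescaled_msupp sx r0; rewrite rescaled_eball.
  apply: (@le_trans _ _ ((l ^- s)%:E * (L^-1 * (l * r) ^+ s)%:E)%E).
    rewrite -EFinM lee_fin exprMn le_eqVlt; apply/orP; left; apply/eqP.
    by rewrite mulrCA; congr (_ * _); rewrite mulrA mulVf ?mul1r// gt_eqF// exprn_gt0.
  by apply: lee_wpmul2l; [rewrite lee_fin ltW|apply: lmu => //; rewrite mulr_gt0].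
Qed.

End rescaling.

(** * Transfer of detection from unit scale to a cube *)

Section detection.
Variables (R : realType) (d s : nat) (alpha C : R) (I : Type) (h : I -> 'rV[R]_d -> R).
Local Notation E := 'rV[R]_d.
Local Notation B := (borelE R d).
Hypotheses (s0 : (0 < s)%N) (a01 : 0 < alpha <= 1) (C0 : 0 <= C)
  (hh : forall i, numerator alpha C (h i)).

Lemma kreg_indic_bounded (mu : {sigma_finite_measure set B -> \bar R}) L i t (S : set B) T (x : E) :
  nice s L mu -> 0 < t -> measurable S -> S `<=` eball 0 T ->
  let F := fun y : B => kreg s alpha (h i) t (x - (y : E)) * \1_S y in
  mu.-integrable setT (EFin \o F) /\
  `|\int[mu]_y F y| <= t ^- s * (L * Num.max T 1 ^+ s).
Proof.
move=> nmu t0 mS ST F; apply: (rint_bounded nmu).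
- by rewrite invr_ge0 exprn_ge0// ltW.
- by rewrite lt_max ltr01 orbT.
- apply: measurable_funM; last exact: measurable_indic.
  exact: (measurableT_comp (measurable_diff (measurable_kreg s a01 (hh i) (ltW t0)))
    (pair1_measurable (x : B))).
- move=> y; rewrite /F; have := kreg_bound s a01 (hh i) (x - y) t0.
  move: (kreg _ _ _ _ _) => u ub; rewrite normrM indicE.
  by case: (_ \in _); rewrite ?normr1 ?mulr1// normr0 mulr0 (le_trans _ ub).
- move=> y; rewrite ge_max => /andP[Ty _]; rewrite /F indicE memNset ?mulr0// => /ST.
  by rewrite /eball/= subr0 ltNge Ty.
Qed.

Lemma measurable_kreg_indic (mu : {sigma_finite_measure set B -> \bar R}) i t (S : set B) :
  0 <= t -> measurable S ->
  measurable_fun setT (fun x : B => \int[mu]_y (kreg s alpha (h i) t ((x : E) - y) * \1_S y)).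
Proof.
move=> t0 mS.
have mk := measurable_diff (measurable_kreg s a01 (hh i) t0).
pose F (z : B * B) := kreg s alpha (h i) t ((z.2 : E) - z.1) * (\1_S : B -> R) z.1.
apply: (@measurable_Rintegral2 R d mu F).
apply: measurable_funM.
  exact: (measurableT_comp mk (measurable_fun_pair measurable_snd measurable_fst)).
by apply: measurableT_comp measurable_fst; exact: measurable_indic.
Qed.

(* The kernel is homogeneous of degree [-s] and [nu] is [l^-s] times the image of
   [mu], so one of the two factors [l^-s] cancels. *)
Lemma test_pairing_rescaled (mu : {sigma_finite_measure set B -> \bar R}) L
    (nu : {sigma_finite_measure set B -> \bar R}) o l i t (S : set B) T (psi : E -> R) :
  nice s L mu -> 0 < l -> 0 < t ->
  (forall f : B -> R, measurable_fun setT f ->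
     \int[nu]_x f x = l ^- s * \int[mu]_x f (l^-1 *: ((x : E) - o))) ->
  measurable_fun setT (psi : B -> R) -> measurable S -> S `<=` eball 0 T ->
  test_pairing s alpha h nu i (l^-1 * t) [set z | S (o + l *: (z : E))] psi =
  l ^- s * test_pairing s alpha h mu i t S (fun x => psi (l^-1 *: (x - o))).
Proof.
move=> nmu l0 t0 nuE mpsi mS ST.
have lne : l != 0 by rewrite gt_eqF.
set S' := [set z | _].
have S'E (y : E) : S' (l^-1 *: (y - o)) = S y.
  by rewrite /S' /= scalerA mulfV// scale1r addrC subrK.
have mS' : measurable (S' : set B).
  have := @measurable_affine R d l (- (l^-1 *: o)) measurableT _ mS; rewrite setTI.
  congr measurable; apply/seteqP; split=> z; rewrite /S' /= opprK scalerDr scalerA mulfV// scale1r addrC//.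
have lt0 : 0 <= l^-1 * t by rewrite mulr_ge0 ?invr_ge0// ltW.
have mk := measurable_diff (measurable_kreg s a01 (hh i) lt0).
pose G (x : B) := \int[nu]_y (kreg s alpha (h i) (l^-1 * t) ((x : E) - y) * \1_S' y).
have mG : measurable_fun setT G by exact: measurable_kreg_indic.
rewrite /test_pairing nuE; last exact: measurable_funM.
congr (_ * _); apply: eq_Rintegral => x _; congr (_ * _).
rewrite /G nuE; last first.
  apply: measurable_funM; last exact: measurable_indic.
  exact: (measurableT_comp mk (pair1_measurable (l^-1 *: ((x : E) - o) : B))).
have -> : \int[mu]_y (kreg s alpha (h i) (l^-1 * t) (l^-1 *: ((x : E) - o) - l^-1 *: ((y : E) - o)) *
    (\1_S' : B -> R) (l^-1 *: ((y : E) - o))) =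
    \int[mu]_y (l ^+ s * (kreg s alpha (h i) t ((x : E) - y) * (\1_S : B -> R) y)).
  apply: eq_Rintegral => y _.
  rewrite -scalerBr (_ : (x : E) - o - (y - o) = x - y); last by rewrite opprB addrA subrK.
  rewrite (kreg_scale _ (hh i)) ?invr_gt0//; last exact: ltW.
  rewrite exprVn invrK -mulrA; congr (_ * (_ * _)).
  by rewrite !indicE; have [Sy|Sy] := pselect (S y); [rewrite !mem_set|rewrite !memNset];
    rewrite ?S'E.
rewrite RintegralZl//.
  by rewrite mulrA mulVf ?mul1r// gt_eqF// exprn_gt0.
by have [] := kreg_indic_bounded i x nmu t0 mS ST.
Qed.

Lemma cube_detection (L delta : R) : 0 < L -> 0 < delta ->
  (forall nu : {sigma_finite_measure set B -> \bar R}, AD_regular s nu ->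
    real_reflectionless s alpha h nu -> is_plane_measure s nu) ->
  exists n : nat, forall (mu : {sigma_finite_measure set B -> \bar R}) (Q : cube R d),
    AD_regular_with s L mu -> 0 < side Q -> non_LCV mu delta Q ->
    exists psi, [/\ adapted n.+1%:R Q psi, \int[mu]_x (psi : B -> R) x = 0 &
      exists i, forall (t : R) (S : set B) (T : R), 0 < t < side Q / n.+1%:R -> measurable S ->
        S `<=` eball (0 : E) T -> eball Q.1 (n.+1%:R * side Q) `<=` S ->
        side Q ^+ s / n.+1%:R <= `|test_pairing s alpha h mu i t S psi|].
Proof.
move=> L0 d0 hplane.
(* Relative to the corner of [Q], points of the closed tripled cube have coordinates between [- l]
   and [2 l]; after division by [l] their norm is at most [2 d]. *)
have [n hn] := unit_scale_detection s0 a01 C0 hh (d%:R * 2) L0 d0 hplane.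
exists n => mu Q ADmu l0 [x [y [[cx sx] [cy sy] hxy]]].
set l := side Q in l0 *; set o := Q.1.
have lne : l != 0 by rewrite gt_eqF.
have [nu' [nuE nuI]] := rescaled_measure s mu o l0.
have ADnu' := rescaled_AD_regular l0 nuE ADmu.
have [_ nmu _] := ADmu; have [_ nnu' _] := ADnu'.
have [nu E'] := nice_sigma_finite_measure nnu'; rewrite E' in nuE nuI ADnu'; clear nnu' E' nu'.
have nuS := rescaled_msupp l0 nuE.
have phiK (z : E) : o + l *: (l^-1 *: (z - o)) = z.
  by rewrite scalerA mulfV// scale1r addrC subrK.
have near z : closure (cube_set (triple Q)) z -> enorm (l^-1 *: (z - o)) <= d%:R * 2.
  move=> cz; rewrite enormZ gtr0_norm ?invr_gt0// ler_pdivrMl//.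
  have : closure [set y | enorm (y - o) <= d%:R * (2 * l)] z.
    move: cz; apply: closure_subset => w Qw /=; apply: enorm_le_coord.
      by rewrite mulr_ge0// ltW.
    move=> i; have /andP[] := Qw i; rewrite !mxE /= -/l ler_norml => w1 w2.
    rewrite /side -/l in w2; apply/andP; split; rewrite /o; lra.
  rewrite -(closure_id _).1; last exact: closed_cball.
  by move/le_trans; apply; rewrite mulrA mulrC.
have [|psi [hpsi ipsi [i hi]]] := hn nu ADnu'.
  exists (l^-1 *: (x - o)), (l^-1 *: (y - o)); split.
  - by apply/nuS; rewrite phiK.
  - by apply/nuS; rewrite phiK.
  - exact: near.
  - exact: near.
  - apply/seteqP; split=> // z [zc /nuS sz].
    suff : (eball (2^-1 *: (x + y)) (delta * side Q) `&` msupp mu) (o + l *: z) by rewrite hxy.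
    split=> //; rewrite /eball/= in zc *.
    rewrite (_ : _ - _ = l *: (z - 2^-1 *: (l^-1 *: (x - o) + l^-1 *: (y - o)))).
      by rewrite enormZ gtr0_norm// mulrC ltr_pM2r.
    by apply/rowP => j; rewrite !mxE; field.
have [pb pl p0] := hpsi; have cpsi := lipschitz_continuous pl.
have mpsi : measurable_fun setT (psi : B -> R) by exact: continuous_measurable.
exists (fun z => psi (l^-1 *: (z - o))); split.
- split=> [z|z w|z zl].
  + exact: pb.
  + apply: (le_trans (pl _ _)).
    rewrite -scalerBr (_ : z - o - (w - o) = z - w); last by rewrite opprB addrA subrK.
    by rewrite enormZ gtr0_norm ?invr_gt0// mulrA.
  + by apply: p0; rewrite enormZ gtr0_norm ?invr_gt0// ler_pdivlMl// mulrC.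
- move: ipsi; rewrite nuI// => /eqP; rewrite mulf_eq0 invr_eq0 expf_eq0 (negbTE lne) andbF /=.
  by move/eqP.
exists i => t S T /andP[t0 tl] mS ST QS.
have := hi (l^-1 * t) [set z | S (o + l *: (z : E))] (l^-1 * (T + enorm o)).
rewrite (test_pairing_rescaled i nmu l0 t0 nuI mpsi mS ST).
move=> H; rewrite -(@ler_pM2l _ (l ^- s)) ?invr_gt0 ?exprn_gt0//.
rewrite mulrA mulVf ?mul1r; last by rewrite gt_eqF// exprn_gt0.
rewrite -[X in X * `|_|]gtr0_norm ?invr_gt0 ?exprn_gt0// -normrM; apply: H.
- rewrite mulr_gt0 ?invr_gt0//= ltr_pdivrMl//.
- have := @measurable_affine R d l (- (l^-1 *: o)) measurableT _ mS; rewrite setTI.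
  congr measurable; apply/seteqP; split=> z; rewrite /= opprK scalerDr scalerA mulfV// scale1r addrC//.
- move=> z /ST; rewrite /eball/= !subr0 => zT; rewrite ltr_pdivlMl//.
  have := enorm_subl (l *: z) (- o); rewrite opprK enormN enormZ gtr0_norm// [l *: z + o]addrC; lra.
- move=> z; rewrite /eball/= subr0 => zn; apply: QS; rewrite /eball/= addrAC subrr add0r.
  by rewrite enormZ gtr0_norm// mulrC ltr_pM2r.
Qed.

End detection.

(** * The Carleson condition *)

Section L2_bound.
Variables (R : realType) (d d' s : nat) (alpha : R) (K : 'rV[R]_d -> 'rV[R[i]]_d').
Local Notation E := 'rV[R]_d.
Local Notation B := (borelE R d).
Hypotheses (s0 : (0 < s)%N) (hK : is_CZO s alpha K).

Lemma poweR_half_le (x : \bar R) (N : R) : (0 <= x)%E -> 0 <= N ->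
  (x `^ 2^-1 <= N%:E)%E -> (x <= (N ^+ 2)%:E)%E.
Proof.
case: x => [x||] // x0 N0; last by rewrite poweRyr ?leye_eq// invr_eq0 pnatr_eq0.
rewrite poweR_EFin !lee_fin in x0 * => xN.
rewrite -[x]powRr1// -(mulVf (_ : 2 != 0 :> R))// powRrM powR_mulrn ?powR_ge0//.
by rewrite ler_pXn2r ?nnegrE ?powR_ge0.
Qed.

(** The operator norm is a supremum over the unit ball, so the operator is applied to [\1_S] divided
    by the square root of [m]. The constant is uniform in the truncation, the set and the
    component. *)
Lemma L2_bounded_indic (L : R) (mu : {sigma_finite_measure set B -> \bar R}) :
  0 <= L -> nice s L mu -> L2_bounded s alpha K mu ->
  exists2 N : R, 0 <= N & forall i (t T m : R) (S : set B), 0 < t -> 0 < m ->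
    measurable S -> S `<=` eball 0 T -> (mu S <= m%:E)%E ->
    (\int[mu]_x ((\int[mu]_y (kreg s alpha (czo_part s alpha K i) t ((x : E) - y) * \1_S y)) ^+ 2)%:E
       <= (N * m)%:E)%E.
Proof.
move=> L0 nmu hT; have [_ _ [a01 _] _] := hK; have [C C0 hh] := czo_numerator hK.
have [N N0 hN] : exists2 N : R, 0 <= N & forall t f, 0 < t -> L2fun mu f ->
    (Lnorm mu 2%:E (fun x => (Normc.normc (f x))%:E) <= 1)%E ->
    (Lnorm mu 2%:E (fun x => (cnorm (Treg s alpha K mu t f x))%:E) <= N%:E)%E.
  move: hT; rewrite /L2_bounded; set w := ereal_sup _ => wlt.
  have hw t f : 0 < t -> L2fun mu f ->
      (Lnorm mu 2%:E (fun x => (Normc.normc (f x))%:E) <= 1)%E ->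
      (Lnorm mu 2%:E (fun x => (cnorm (Treg s alpha K mu t f x))%:E) <= w)%E.
    move=> t0 hf f1.
    apply: (@le_trans _ _ (L2_opnorm mu (Treg s alpha K mu t : (B -> R[i]) -> B -> _))).
      by apply: ereal_sup_ubound; exists f.
    by apply: ereal_sup_ubound; exists t.
  move: w wlt hw => [r _|//|_] hw; first exists `|r| => // t f t0 hf f1.
    by apply: (le_trans (hw t f t0 hf f1)); rewrite lee_fin ler_norm.
  by exists 0 => // t f t0 hf f1; exact: le_trans (hw t f t0 hf f1) (leNye _).
exists (N ^+ 2); first exact: exprn_ge0.
move=> [j b] t T m S t0 m0 mS ST muS.
have sm0 : 0 < Num.sqrt m by rewrite sqrtr_gt0.
pose a := (Num.sqrt m)^-1.
have a0 : 0 < a by rewrite invr_gt0.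
have am : a ^+ 2 * m = 1 by rewrite /a exprVn sqr_sqrtr ?mulVf ?gt_eqF// ltW.
have mI : measurable_fun setT (\1_S : B -> R) by exact: measurable_indic.
pose f (x : B) : R[i] := (a * \1_S x)%:C%C.
have mf : measurable_fun setT (fun x : B => a * \1_S x : R).
  by apply: measurable_funM => //; exact: measurable_cst.
have fn x : Normc.normc (f x) = a * \1_S x.
  rewrite /f /Normc.normc /= expr0n addr0 sqrtr_sqr ger0_norm// mulr_ge0 ?(ltW a0)//.
have f1 : (Lnorm mu 2%:E (fun x => (Normc.normc (f x))%:E) <= 1)%E.
  have -> : (fun x => (Normc.normc (f x))%:E) = (fun x => (a * \1_S x)%:E).
    by apply/funext => x; rewrite fn.
  rewrite unlock /=.
  have -> : (\int[mu]_x `|(a * \1_S x)%:E| `^ 2 = \int[mu]_x ((a ^+ 2)%:E * (\1_S x)%:E))%E.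
    apply: eq_integral => x _ /=; rewrite powR_mulrn// -EFinM; congr EFin.
    rewrite real_normK ?num_real// exprMn indicE.
    by case: (_ \in _); rewrite ?expr1n ?expr0n.
  rewrite ge0_integralZl//; last 2 first.
  - exact/measurable_EFinP.
  - by rewrite lee_fin sqr_ge0.
  rewrite integral_indic// setIT.
  have h1 : ((a ^+ 2)%:E * mu S <= 1)%E.
    apply: (@le_trans _ _ ((a ^+ 2)%:E * m%:E)%E); last by rewrite -EFinM am.
    by apply: lee_wpmul2l => //; rewrite lee_fin exprn_ge0// ltW.
  rewrite -[leRHS](poweR1r 2^-1); apply: gt0_ler_poweR => //.
  - by rewrite in_itv/= leey andbT mule_ge0// lee_fin sqr_ge0.
  - by rewrite in_itv/= leey andbT.
have L2f : L2fun mu f.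
  split=> //; last exact: le_lt_trans f1 (ltry 1).
have := hN t f t0 L2f f1; rewrite unlock /= => /poweR_half_le hle.
have {}hle := hle (ltac:(by apply: integral_ge0 => x _; rewrite lee_fin powR_ge0)) N0.
pose F (x : B) := \int[mu]_y (kreg s alpha (czo_part s alpha K (j, b)) t ((x : E) - y) * \1_S y).
suff: (\int[mu]_x (F x ^+ 2)%:E <= (N ^+ 2 * m)%:E)%E by [].
have mF : measurable_fun setT F by exact: (measurable_kreg_indic s a01 hh mu (j, b) (ltW t0) mS).
have FE x : cpart b (Treg s alpha K mu t f x ord0 j) = a * F x.
  have [iF _] := kreg_indic_bounded a01 hh (j, b) x nmu t0 mS ST.
  rewrite /F -RintegralZl//.
  transitivity (\int[mu]_y cpart b ((f y *: Kreg s alpha K t (x - y)) ord0 j)).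
    by rewrite mxE; case: (b).
  apply: eq_Rintegral => y _; rewrite mxE cpartZ.
  rewrite (czo_part_Kreg _ _ _ _ _ t0) /=.
  by rewrite -mulrA; congr (_ * _); rewrite mulrC.
have : (\int[mu]_x ((a ^+ 2)%:E * (F x ^+ 2)%:E) <= (N ^+ 2)%:E)%E.
  apply: le_trans hle; apply: integral_le_any.
  - by move=> x; rewrite -EFinM lee_fin -exprMn sqr_ge0.
  - by move=> x; rewrite lee_fin powR_ge0.
  - move=> x _; rewrite powR_mulrn// -EFinM lee_fin -exprMn -FE.
    rewrite -[leLHS]real_normK ?num_real// ler_pXn2r ?nnegrE//.
    by rewrite [leRHS]ger0_norm ?sqrtr_ge0// cpart_le_cnorm.
rewrite ge0_integralZl//; last 3 first.
- by apply/measurable_EFinP; exact: measurable_funX.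
- by move=> x _; rewrite lee_fin sqr_ge0.
- by rewrite lee_fin sqr_ge0.
have : (0 <= \int[mu]_x (F x ^+ 2)%:E)%E by apply: integral_ge0 => x _; rewrite lee_fin sqr_ge0.
case: (\int[mu]_x (F x ^+ 2)%:E)%E => [r||] //= r0; last first.
  by rewrite gt0_muley ?lte_fin ?exprn_gt0.
rewrite -EFinM !lee_fin => h; rewrite -[r]mul1r -am mulrAC ler_wpM2r// ltW//.
Qed.

End L2_bound.

Section carleson.
Variables (R : realType).

(** Tested on the diagonal points [Q.1 + (e, ..., e)] of [Q]: if a face of [Q] stuck out of [P], a
    suitable [e] would give a point on or beyond the corresponding face of [P]. *)
Lemma subcube_bounds d (Q P : cube R d) : (0 < d)%N -> 0 < side Q -> 0 < side P ->
  cube_set Q `<=` cube_set P -> side Q <= side P /\ enorm (Q.1 - P.1) <= d%:R * side P.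
Proof.
move=> d0 l0 lP0 QP.
have pt e i : 0 < e < side Q -> P.1 ord0 i < Q.1 ord0 i + e < P.1 ord0 i + side P.
  move=> /andP[e0 el]; have : cube_set Q (Q.1 + const_mx e).
    by move=> k; rewrite !mxE ltrDl e0 ltrD2l.
  by move/QP/(_ i); rewrite !mxE.
have lo i : P.1 ord0 i <= Q.1 ord0 i.
  rewrite leNgt; apply/negP => lt.
  have := pt (Num.min (side Q / 2) (P.1 ord0 i - Q.1 ord0 i)) i.
  have : Num.min (side Q / 2) (P.1 ord0 i - Q.1 ord0 i) <= P.1 ord0 i - Q.1 ord0 i.
    by rewrite ge_min lexx orbT.
  have : 0 < Num.min (side Q / 2) (P.1 ord0 i - Q.1 ord0 i) by rewrite lt_min; lra.
  have : Num.min (side Q / 2) (P.1 ord0 i - Q.1 ord0 i) < side Q by rewrite gt_min; lra.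
  by move: (Num.min _ _) => e h1 h2 h3; rewrite h1 h2 => /(_ isT)/andP[]; lra.
have hi i : Q.1 ord0 i + side Q <= P.1 ord0 i + side P.
  rewrite leNgt; apply/negP => lt.
  have := pt (Num.max (side Q / 2) (P.1 ord0 i + side P - Q.1 ord0 i)) i.
  have : P.1 ord0 i + side P - Q.1 ord0 i <= Num.max (side Q / 2) (P.1 ord0 i + side P - Q.1 ord0 i).
    by rewrite le_max lexx orbT.
  have : 0 < Num.max (side Q / 2) (P.1 ord0 i + side P - Q.1 ord0 i) by rewrite lt_max; lra.
  have : Num.max (side Q / 2) (P.1 ord0 i + side P - Q.1 ord0 i) < side Q by rewrite gt_max; lra.
  by move: (Num.max _ _) => e h1 h2 h3; rewrite h1 h2 => /(_ isT)/andP[]; lra.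
split; first by have := lo (Ordinal d0); have := hi (Ordinal d0); lra.
apply: enorm_le_coord; first exact: ltW.
by move=> i; rewrite !mxE ler_norml; have := lo i; have := hi i; lra.
Qed.

Lemma pos_lower_bound (T : eqType) (r : seq T) (g : T -> R) : {in r, forall x, 0 < g x} ->
  exists2 t, 0 < t & {in r, forall x, t < g x}.
Proof.
elim: r => [_|x r IH hr]; first by exists 1.
have [y yr|t t0 ht] := IH; first by apply: hr; rewrite inE yr orbT.
have gx : 0 < g x by apply: hr; rewrite mem_head.
exists (Num.min t (g x / 2)); first by rewrite lt_min t0 divr_gt0.
move=> y; rewrite inE gt_min => /predU1P[->|/ht ->//].
by apply/orP; right; rewrite ltr_pdivrMr// ltr_pMr// ltr1n.
Qed.

Lemma Rintegral_sum_seq disp (T : measurableType disp) (m : {measure set T -> \bar R}) I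
    (r : seq I) (f : I -> T -> R) : (forall i, m.-integrable setT (EFin \o f i)) ->
  \int[m]_x (\sum_(i <- r) f i x) = \sum_(i <- r) \int[m]_x f i x.
Proof.
move=> hf; have ir q : m.-integrable setT (EFin \o (fun x => \sum_(i <- q) f i x)).
  have := @integrable_sum _ _ _ m setT measurableT I q xpredT (fun i => EFin \o f i) (fun i _ => hf i).
  by apply: eq_integrable => // x _ /=; rewrite sumEFin.
elim: r => [|i r IH].
  rewrite big_nil; transitivity (\int[m]_x (cst 0 : T -> R) x); last by rewrite /Rintegral integral0.
  by apply: eq_Rintegral => x _; rewrite big_nil.
rewrite big_cons -IH -RintegralD//.
by apply: eq_Rintegral => x _; rewrite big_cons.
Qed.

End carleson.

Theorem proposition3p1 (R : realType) (d d' s : nat) (D : set (cube R d))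
    (alpha : R) (K : 'rV[R]_d -> 'rV[R[i]]_d')
    (hd' : (0 < d')%N) (hs : (0 < s < d)%N) (hD : dyadic_lattice D)
    (hK : is_CZO s alpha K)
    (hrefl : forall nu : {measure set (borelE R d) -> \bar R},
        locally_finite nu -> AD_regular s nu -> reflectionless s alpha K nu ->
        is_plane_measure s nu)
    (mu : {measure set (borelE R d) -> \bar R})
    (hmu : locally_finite mu) (hAD : AD_regular s mu)
    (hT : L2_bounded s alpha K mu) :
  forall delta : R, 0 < delta -> Carleson_family s D (non_LCV mu delta).
Proof.
move=> delta delta0; have /andP[s0 sd] := hs.
have d0 : (0 < d)%N by exact: leq_ltn_trans sd.
have [_ _ [a01 _] _] := hK; have [C C0 hh] := czo_numerator hK.
have [L L0 ADmu] := hAD; have [_ nmu' _] := ADmu.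
have [mu' muE] := nice_sigma_finite_measure nmu'.
clear hmu hAD nmu'; subst mu; rename mu' into mu.
have [_ nmu _] := ADmu; have [org [_ DE]] := hD.
pose E := 'rV[R]_d; pose B := borelE R d; pose idx := ('I_d' * bool)%type.
have [|n hn] := cube_detection s0 a01 C0 hh L0 delta0.
  move=> nu [L' L'0 ADnu] hnu; have [_ nnu _] := ADnu.
  apply: hrefl; [exact: nice_locally_finite nnu|by exists L'|].
  exact: czo_reflectionless nnu hK hnu.
have [N N0 hN] := L2_bounded_indic hK (ltW L0) nmu hT.
pose M : R := n.+1%:R; have M0 : 0 < M by rewrite ltr0n.
(* A subcube of [P] has its corner within [d * side P] of [P.1], so the ball [S] of radius
   [A * side P] about [P.1] contains every [eball Q.1 (M * side Q)]. *)
pose A := M + d%:R; have A0 : 0 < A by rewrite ltr_wpDr.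
pose c := gram_const d s L n.
have c0 : 0 < c by rewrite !mulr_gt0 ?exprn_gt0// ltr0n ?expn_gt0.
(* [M^2 c] comes from duality, and [N (L A^s)] from the L^2 bound on [S], whose mass is at most
   [L (A side P)^s]. *)
pose C1 := M ^+ 2 * c * (N * (L * A ^+ s)).
have C10 : 0 <= C1 by rewrite !mulr_ge0 ?exprn_ge0// ltW.
exists (#|{: idx}|%:R * C1 + 1); first by rewrite ltr_wpDl// mulr_ge0.
move=> P; rewrite DE => gP; have lP0 : 0 < side P := grid_side_gt0 gP.
apply: ge_ereal_sup => _ [X [finX XD] <-].
rewrite fsbig_finite//= sumEFin lee_fin.
pose Xs : seq (cube R d) := finmap.enum_fset (fset_set X).
have XsP Q : Q \in Xs -> [/\ grid_cube org Q, cube_set Q `<=` cube_set P & non_LCV mu delta Q].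
  by rewrite (_ : (Q \in Xs) = (Q \in X)) ?inE; [move=> /XD|exact: (in_fset_set finX)].
have uXs : uniq Xs by exact: finmap.fset_uniq.
rewrite -[\sum_(Q <- _) _]/(\sum_(Q <- Xs) side Q ^+ s).
(* A total choice: off [Xs] it is the zero function with an arbitrary component, available because
   [0 < d']. *)
have /choice[p hp] : forall Q, exists p : (E -> R) * idx, Cc p.1 /\ (Q \in Xs ->
    [/\ adapted M Q p.1, \int[mu]_x (p.1 : B -> R) x = 0 &
      forall (t : R) (S : set B) (T : R), 0 < t < side Q / M -> measurable S ->
        S `<=` eball (0 : E) T -> eball Q.1 (M * side Q) `<=` S ->
        side Q ^+ s / M <= `|test_pairing s alpha (czo_part s alpha K) mu p.2 t S p.1|]).
  move=> Q; have [QX|] := boolP (Q \in Xs); last first.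
    by exists (fun=> 0, (Ordinal hd', false)); split=> //; exact: Cc0.
  have [gQ _ nQ] := XsP Q QX.
  have [psi [h1 h2 [i h3]]] := hn mu Q ADmu (grid_side_gt0 gQ) nQ.
  by exists (psi, i); split=> [|_]; [exact: adapted_Cc h1|split].
(* One truncation below the threshold of every cube, by finiteness of the family; the final bound
   does not involve [t]. *)
have [t t0 ht] : exists2 t : R, 0 < t & {in Xs, forall Q, t < side Q / M}.
  apply: pos_lower_bound => Q /XsP[/grid_side_gt0 l0 _ _]; exact: divr_gt0.
(* Within a class all cubes are detected by the same component [i], so a single function is paired
   with all their test functions. *)
rewrite (partition_big (fun Q => (p Q).2) xpredT)//=.
apply: (@le_trans _ _ (\sum_(i : idx) C1 * side P ^+ s)); last first.
  rewrite sumr_const -[_ *+ _]mulr_natl mulrA ler_wpM2r ?lerDl//.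
  by rewrite exprn_ge0// ltW.
apply: ler_sum => i _; rewrite -big_filter.
set Y := [seq Q <- Xs | _]; set sigma := \sum_(Q <- Y) _.
have YX : {subset Y <= Xs} by move=> Q; rewrite mem_filter => /andP[].
have uY : uniq Y by exact: filter_uniq.
pose S : set B := eball P.1 (A * side P).
have mS : measurable S by exact: measurable_eball.
have ST : S `<=` eball 0 (A * side P + enorm P.1).
  move=> x; rewrite /S /eball/= subr0 => xP.
  by have := enormD (x - P.1) P.1; rewrite subrK; lra.
have QS Q : Q \in Xs -> eball Q.1 (M * side Q) `<=` S.
  move=> /XsP[/grid_side_gt0 l0 QP _] x; rewrite /S /eball/= /A => xQ.
  have [lP oP] := subcube_bounds d0 l0 lP0 QP.
  have := enormD (x - Q.1) (Q.1 - P.1); rewrite addrA subrK => h.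
  have h1 : M * side Q <= M * side P by rewrite ler_pM2l.
  rewrite mulrDl; lra.
have m0 : 0 < L * (A * side P) ^+ s by rewrite mulr_gt0// exprn_gt0// mulr_gt0.
have hF2 := hN i t _ _ S t0 m0 mS ST (nmu _ _ (mulr_gt0 A0 lP0)).
pose F (x : B) : R := \int[mu]_y (kreg s alpha (czo_part s alpha K i) t ((x : E) - y) * \1_S y).
(* Restriction to [S] gives bounded support, hence integrability, and leaves the pairings unchanged
   since [S] contains the supports of the test functions. *)
pose F1 (x : B) : R := \1_S x * F x.
have mF : measurable_fun setT F by exact: (measurable_kreg_indic s a01 hh mu i (ltW t0) mS).
have mF1 : measurable_fun setT F1 by apply: measurable_funM => //; exact: measurable_indic.
pose M1 := t ^- s * (L * Num.max (A * side P + enorm P.1) 1 ^+ s).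
have F1b x : `|F1 x| <= M1.
  have [_ Fb] := kreg_indic_bounded a01 hh i x nmu t0 mS ST.
  rewrite /F1 indicE; case: (_ \in _); first by rewrite mul1r.
  by rewrite mul0r normr0; exact: le_trans Fb.
have F10 (x : E) : A * side P + enorm P.1 <= enorm x -> F1 x = 0.
  move=> xP; rewrite /F1 indicE memNset ?mul0r// => /ST.
  by rewrite /eball/= subr0 ltNge xP.
pose v Q := \int[mu]_x ((p Q).1 x * F1 x).
(* The signs turn the sum of pairings into the sum of their absolute values, which detection bounds
   below. *)
pose a Q := Num.sg (v Q).
pose G (x : E) := \sum_(Q <- Y) a Q * (p Q).1 x.
have CG : Cc G by apply: Cc_sum => Q _; apply: Cc_scale; case: (hp Q).
have ipF Q : mu.-integrable setT (EFin \o (fun x : B => (p Q).1 x * F1 x)).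
  have [Cp _] := hp Q; have [M2 M20 pM] := Cc_bounded Cp.
  apply: (@integrable_bounded _ _ mu _ S (M2 * M1)) => //.
  - exact: nice_eball_lty nmu.
  - by apply: measurable_funM => //; exact: continuous_measurable Cp.1.
  - by move=> x; rewrite normrM ler_pM.
  - by move=> x Sx; rewrite /F1 indicE memNset// mul0r mulr0.
have hGF : sigma / M <= \int[mu]_x (G x * F1 x).
  have -> : \int[mu]_x (G x * F1 x) = \sum_(Q <- Y) a Q * v Q.
    transitivity (\int[mu]_x (\sum_(Q <- Y) a Q * ((p Q).1 x * F1 x))).
      by apply: eq_Rintegral => x _; rewrite /G mulr_suml; apply: eq_bigr => Q _; rewrite -mulrA.
    rewrite Rintegral_sum_seq; last first.
      by move=> Q; exact: (@integrableZl _ _ _ mu setT measurableT (a Q) _ (ipF Q)).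
    by apply: eq_bigr => Q _; rewrite RintegralZl.
  rewrite /sigma mulr_suml big_seq [leRHS]big_seq; apply: ler_sum => Q QY.
  have QX := YX _ QY; have [_ /(_ QX)[[_ _ pz] _ hQ]] := hp Q.
  have Qi : (p Q).2 = i by move: QY; rewrite mem_filter => /andP[/eqP].
  rewrite /a -normrEsg; have := hQ t S _ _ mS ST (QS Q QX).
  rewrite t0 ht// => /(_ isT); rewrite Qi; congr (_ <= `|_|).
  apply: eq_Rintegral => x _; rewrite /F1 /F indicE.
  have [xQ|xQ] := leP (M * side Q) (enorm ((x : E) - Q.1)); first by rewrite pz// !mul0r.
  by rewrite mem_set ?mul1r//; exact: QS QX _ xQ.
have hGG : \int[mu]_x (G x) ^+ 2 <= c * sigma.
  apply: (@gram_sum_le R d s org L mu L0 nmu n Y (fun Q => (p Q).1) a uY).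
  - by move=> Q /YX/XsP[].
  - by move=> Q; case: (hp Q).
  - by move=> Q /YX QX; have [_ /(_ QX)[]] := hp Q.
  - by move=> Q /YX QX; have [_ /(_ QX)[]] := hp Q.
  - by move=> Q; rewrite /a normr_sg lern1 leq_b1.
have hFF : \int[mu]_x (F1 x) ^+ 2 <= N * (L * (A * side P) ^+ s).
  have h : (\int[mu]_x ((F1 x) ^+ 2)%:E <= (N * (L * (A * side P) ^+ s))%:E)%E.
    apply: le_trans hF2; apply: integral_le_any.
    - by move=> x; rewrite lee_fin sqr_ge0.
    - by move=> x; rewrite lee_fin sqr_ge0.
    - move=> x _; rewrite lee_fin /F1 indicE; case: (_ \in _); first by rewrite mul1r.
      by rewrite mul0r expr0n sqr_ge0.
  rewrite -lee_fin /Rintegral fineK// ge0_fin_numE; first exact: le_lt_trans h (ltry _).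
  by apply: integral_ge0 => x _; rewrite lee_fin sqr_ge0.
apply: (le_trans (sum_le_of_duality nmu CG mF1 F1b F10 M0 c0 hGF hGG)).
have -> : C1 * side P ^+ s = M ^+ 2 * c * (N * (L * (A * side P) ^+ s)).
  by rewrite exprMn /C1; ring.
by apply: ler_wpM2l hFF; rewrite mulr_ge0 ?sqr_ge0// ltW.
Qed.
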